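(* Let $L>0$, let $P\in H^2(0,L)$ be real-valued with $P(x)\ge P^0>0$ on $[0,L]$, and let $\theta_1,\dots,\theta_4\in\mathbb R$. Suppose there are constants $a,b>0$ with $(a+b-1)^2<4ab$ such that $\theta_1=\theta_3/b-a$, $\theta_2=\theta_4/b$, and suppose $\theta_1,\theta_3<0$, $\theta_2,\theta_4>0$. Let $\mathcal H=\{(w,v,\xi,\psi): w\in H^2(0,L),\ v\in H^1(0,L),\ \xi=v(L),\ \psi=v(0)\}$ with the norm $\|\cdot\|$ of $H^2\times H^1\times\mathbb C\times\mathbb C$, $F[w,v]=\theta_1v(0)+\theta_2v'(0)+\theta_3w(0)+\theta_4w'(0)$, and $A(w,v,\xi,\psi)=(v,(Pw')',-w'(L),F[w,v])$ with domain $$D(A)=\{(w,v,\xi,\psi): w\in H^3(0,L),\ v\in H^2(0,L),\ \xi=v(L),\ \psi=v(0),\ (Pw')'(L)=-w'(L),\ (Pw')'(0)=F[w,v]\}.$$ Then the $C_0$-semigroup $\{T(t)\}_{t\ge0}$ generated by $A$ is asymptotically stable, i.e. $\|T(t)z_0\|\to0$ as $t\to\infty$ for every $z_0\in\mathcal H$.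
   Context: Prime denotes $d/dx$; functions are complex-valued. *)

(* Defs.v *)
From HB Require Import structures.
From mathcomp Require Import all_boot all_order all_algebra.
From mathcomp Require Import all_classical all_reals all_analysis.
From mathcomp Require Import complex.
From Stdlib Require Import ClassicalEpsilon.

Set Implicit Arguments.
Unset Strict Implicit.
Unset Printing Implicit Defensive.

Import Order.TTheory GRing.Theory Num.Theory.
Import numFieldNormedType.Exports.

Local Open Scope classical_set_scope.
Local Open Scope ring_scope.

Section Defs.
Variable R : realType.
Variable L : R.

Local Notation C := (complex R).
Local Notation mu := (@lebesgue_measure R).

Definition I0L : set R := `[0, L].

Definition L2 (g : R -> R) : Prop :=
  measurable_fun I0L g /\
  (\int[mu]_(x in I0L) ((g x) ^+ 2)%:E < +oo)%E.

Definition sqL2 (g : R -> R) : R := \int[mu]_(x in `[0, L]) (g x) ^+ 2.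

Definition prim (f g : R -> R) : Prop :=
  forall x, 0 <= x <= L -> f x = f 0 + \int[mu]_(t in `[0, x]) g t.

(* f in H^k(0,L) (f taken as its continuous representative when k >= 1):
   f in L^2 and f = f(0) + \int_0^x g with g in H^(k-1)(0,L). *)
Fixpoint Hs (k : nat) (f : R -> R) : Prop :=
  match k with
  | 0 => L2 f
  | k'.+1 => L2 f /\ exists g, prim f g /\ Hs k' g
  end.

Fixpoint HsVal (k : nat) (f : R -> R) (s : R) : Prop :=
  match k with
  | 0 => L2 f /\ s = sqL2 f
  | k'.+1 => L2 f /\ exists g s', prim f g /\ HsVal k' g s' /\ s = sqL2 f + s'
  end.

(* squared H^k(0,L) norm (well defined since weak derivatives are unique a.e.) *)
Definition Hnorm2 (k : nat) (f : R -> R) : R :=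
  epsilon (inhabits 0) (HsVal k f).

Definition rdiff (f : R -> R) (x : R) : R :=
  lim ((fun h => (f (x + h) - f x) / h) @ 0^'+).
Definition ldiff (f : R -> R) (x : R) : R :=
  lim ((fun h => (f x - f (x - h)) / h) @ 0^'+).
Definition der (f : R -> R) (x : R) : R :=
  if x < L then rdiff f x else ldiff f x.

Definition reF (f : R -> C) : R -> R := fun x => complex.Re (f x).
Definition imF (f : R -> C) : R -> R := fun x => complex.Im (f x).

Definition cHs (k : nat) (f : R -> C) : Prop := Hs k (reF f) /\ Hs k (imF f).
Definition cHnorm2 (k : nat) (f : R -> C) : R :=
  Hnorm2 k (reF f) + Hnorm2 k (imF f).
Definition cder (f : R -> C) (x : R) : C :=
  Complex (der (reF f) x) (der (imF f) x).
Definition cabs2 (z : C) : R := complex.Re z ^+ 2 + complex.Im z ^+ 2.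

Record St := MkSt { sw : R -> C; sv : R -> C; sxi : C; spsi : C }.

Definition addSt (z1 z2 : St) : St :=
  MkSt (fun x => sw z1 x + sw z2 x) (fun x => sv z1 x + sv z2 x)
       (sxi z1 + sxi z2) (spsi z1 + spsi z2).
Definition sclSt (c : C) (z : St) : St :=
  MkSt (fun x => c * sw z x) (fun x => c * sv z x) (c * sxi z) (c * spsi z).
Definition subSt (z1 z2 : St) : St := addSt z1 (sclSt (-1) z2).

Definition inH (z : St) : Prop :=
  cHs 2 (sw z) /\ cHs 1 (sv z) /\ sxi z = sv z L /\ spsi z = sv z 0.

Definition normH (z : St) : R :=
  Num.sqrt (cHnorm2 2 (sw z) + cHnorm2 1 (sv z) + cabs2 (sxi z) + cabs2 (spsi z)).

Variables (P : R -> R) (th1 th2 th3 th4 : R).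

Definition Pw' (w : R -> C) : R -> C := fun x => (P x)%:C%C * cder w x.

Definition Ffun (w v : R -> C) : C :=
  th1%:C%C * v 0 + th2%:C%C * cder v 0 + th3%:C%C * w 0 + th4%:C%C * cder w 0.

Definition Aop (z : St) : St :=
  MkSt (sv z) (cder (Pw' (sw z))) (- cder (sw z) L) (Ffun (sw z) (sv z)).

Definition DA (z : St) : Prop :=
  cHs 3 (sw z) /\ cHs 2 (sv z) /\ sxi z = sv z L /\ spsi z = sv z 0 /\
  cder (Pw' (sw z)) L = - cder (sw z) L /\
  cder (Pw' (sw z)) 0 = Ffun (sw z) (sv z).

End Defs.

(* T : [0,oo) -> (H -> H) is a C0-semigroup on (H, normH) with generator
   (A, D(A)).  Elements of H are identified when their distance is 0
   (i.e. when they agree on [0,L]), so all identities are stated up to norm. *)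
Definition IsC0Generated (R : realType) (inH : St R -> Prop) (normH : St R -> R)
    (D : St R -> Prop) (A : St R -> St R) (T : R -> St R -> St R) : Prop :=
  (forall t z, 0 <= t -> inH z -> inH (T t z)) /\
      (forall z, inH z -> normH (subSt (T 0 z) z) = 0) /\
      (forall t s z, 0 <= t -> 0 <= s -> inH z ->
          normH (subSt (T (t + s) z) (T t (T s z))) = 0) /\
      (forall t (c1 c2 : complex R) z1 z2, 0 <= t -> inH z1 -> inH z2 ->
          normH (subSt (T t (addSt (sclSt c1 z1) (sclSt c2 z2)))
                       (addSt (sclSt c1 (T t z1)) (sclSt c2 (T t z2)))) = 0) /\
      (forall t, 0 <= t -> exists M : R, forall z, inH z ->
          normH (T t z) <= M * normH z) /\
      (forall z, inH z -> normH (subSt (T t z) z) @[t --> 0^'+] --> 0) /\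
      (forall z, inH z ->
         (D z <-> exists y, inH y /\
            normH (subSt (sclSt (h^-1)%:C%C (subSt (T h z) z)) y)
              @[h --> 0^'+] --> 0) /\
         (D z -> normH (subSt (sclSt (h^-1)%:C%C (subSt (T h z) z)) (A z))
              @[h --> 0^'+] --> 0)).

(* Main.v *)
Require Import Defs.
From HB Require Import structures.
From mathcomp Require Import all_boot all_order all_algebra.
From mathcomp Require Import all_classical all_reals all_analysis.
From mathcomp Require Import measurable_realfun complex ring lra.
Import Order.TTheory GRing.Theory Num.Theory.
Import numFieldNormedType.Exports.
Local Open Scope classical_set_scope.
Local Open Scope ring_scope.
Set Implicit Arguments.
Unset Strict Implicit.
Unset Printing Implicit Defensive.

(* Real and imaginary parts decouple. For a real solution put u = v + b w,
   p = u_t = (P w')' + b v, q = u', y = b v(L) - w'(L). Then u solves the same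
   wave equation, with p(L) = y, and the energy
     V = (|p|^2 + |sqrt P q|^2 + P(L) y^2) / 2 + k3 u(0)^2 + k4 v(0)^2,
     k3 = P(0) |th3| / (2 th4),  k4 = P(0) b (a + b) / (2 th4),
   satisfies V' = - (P(0) b / th4) (v_t(0)^2 + a b v(0)^2). Adding to a large
   multiple of V the multiplier term \int m P p q with m increasing and negative,
   a multiple of u(0) (\int p + P(L) y), whose derivative dissipates u(0)^2, and a
   small multiple of w(0)^2 + |w'|^2, where w_t = u - b w, gives a functional W
   equivalent to the squared norm of H with W' <= - 2 om W along solutions starting
   in D(A). As only right derivatives of orbits are available, left continuity of
   orbits is obtained from Baire's theorem on the real line: strong right continuity
   makes the sets where the operator norm of T(t) exceeds n right-open, so T is
   bounded on some interval [c, d) as close to 0 as desired. Hence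
   (1 + om t) W(T(t) z) <= W(z) on D(A), and the claim follows on H by density of
   D(A). *)

(** * Square-integrable functions on [[0, L]] *)

(** The choice u = v + b w comes from the boundary condition at 0: the relations among the
    coefficients give F[w,v] = (theta_4/b) u'(0) + (theta_3/b) u(0) - a v(0). Hence q(0) is a linear
    combination of v_t(0), v(0) and u(0), while p(0) = v_t(0) + b v(0). In the flux P(0) p(0) q(0)
    the products v_t(0) v(0) and p(0) u(0) are exact time derivatives, which fixes k3 and k4 and
    leaves a definite quadratic form. At L one has y_t = -q(L), so P(L) y^2 / 2 cancels the flux
    there. The energy alone dissipates only values at 0; each further term spreads this dissipation
    to other components, at the price of terms that the earlier ones absorb. The semigroup is known
    only through its axioms, so nothing is differentiated in time: the functional is kept as a
    bilinear form, evaluated at a state and its image under A. The norm is a value picked by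
    [epsilon], so weak derivatives must be shown unique, through density of H^1, before any norm can
    be computed. *)

Section L2_toolbox.
Context {R : realType} (L : R).
Hypothesis L_gt0 : 0 < L.
Implicit Types (f g k : R -> R).

Local Notation mu := (@lebesgue_measure R).
Local Notation I := (I0L L).
Local Notation intg f := (mu.-integrable I (EFin \o (f : R -> R))).
Local Notation L2 := (L2 L).

Definition ip f g : R := \int[mu]_(x in I) (f x * g x).

Lemma measurable_I : measurable (I : set (measurableTypeR R)).
Proof. exact: measurable_itv. Qed.

Lemma mu_I_fin : (mu I < +oo)%E.
Proof. by rewrite lebesgue_measure_itv/= lte_fin L_gt0 -EFinD ltry. Qed.

Lemma intg_le f g : measurable_fun I f ->
  (forall x, I x -> `|f x| <= g x) -> intg g -> intg f.
Proof.
move=> mf fg; apply: le_integrable; first exact: measurable_I.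
  exact/measurable_EFinP.
move=> x Ix; rewrite /= lee_fin; apply: (le_trans (fg x Ix)); exact: ler_norm.
Qed.

Lemma intgD f g : intg f -> intg g -> intg (fun x => f x + g x).
Proof.
move=> hf hg; have := integrableD measurable_I hf hg.
by apply: eq_integrable => //; exact: measurable_I.
Qed.

Lemma intgZ c f : intg f -> intg (fun x => c * f x).
Proof.
move=> hf; have := integrableZl measurable_I c hf.
by apply: eq_integrable => //; exact: measurable_I.
Qed.

Lemma intg_cst c : intg (fun=> c).
Proof.
apply: measurable_bounded_integrable; [exact: measurable_I|exact: mu_I_fin|by []|].
by exists `|c|; split; [exact: num_real|move=> M cM x _; exact: ltW].
Qed.

Lemma L2_sq f : L2 f -> intg (fun x => f x ^+ 2).
Proof.
move=> [mf fi]; apply/integrableP; split.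
  by apply/measurable_EFinP; apply: measurable_funX.
by under eq_integral do rewrite /= ger0_norm ?sqr_ge0//.
Qed.

Lemma sq_L2 f : measurable_fun I f -> intg (fun x => f x ^+ 2) -> L2 f.
Proof.
move=> mf /integrableP[_]; under eq_integral do rewrite /= ger0_norm ?sqr_ge0//.
by split.
Qed.

Lemma L2_measurable f : L2 f -> measurable_fun I f. Proof. by case. Qed.

Lemma intgM f g : L2 f -> L2 g -> intg (fun x => f x * g x).
Proof.
move=> hf hg; apply: (@intg_le _ (fun x => f x ^+ 2 + g x ^+ 2)).
- by apply: measurable_funM; exact: L2_measurable.
- move=> x _; rewrite ler_norml; apply/andP; split; nra.
- by apply: intgD; exact: L2_sq.
Qed.

Lemma L2_lin c f g : L2 f -> L2 g -> L2 (fun x => f x + c * g x).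
Proof.
move=> hf hg; apply: sq_L2.
  apply: measurable_funD; first exact: L2_measurable.
  by apply: measurable_funM => //; exact: L2_measurable.
apply: (@intg_le _ (fun x => 2 * (f x ^+ 2) + 2 * c ^+ 2 * (g x ^+ 2))).
- apply: measurable_funX; apply: measurable_funD; first exact: L2_measurable.
  by apply: measurable_funM => //; exact: L2_measurable.
- move=> x _; rewrite ger0_norm ?sqr_ge0//.
  have := sqr_ge0 (f x - c * g x); nra.
- by apply: intgD; apply: intgZ; exact: L2_sq.
Qed.

Definition bmeas k := measurable_fun I k /\ exists M : R, forall x, I x -> `|k x| <= M.

Lemma L2_bmeasM k f : bmeas k -> L2 f -> L2 (fun x => k x * f x).
Proof.
move=> [mk [M kM]] hf; apply: sq_L2.
  by apply: measurable_funM => //; exact: L2_measurable.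
apply: (@intg_le _ (fun x => M ^+ 2 * (f x ^+ 2))).
- by apply: measurable_funX; apply: measurable_funM => //; exact: L2_measurable.
- move=> x /kM kx; rewrite ger0_norm ?sqr_ge0// exprMn.
  rewrite ler_wpM2r ?sqr_ge0// -(real_normK (num_real (k x))).
  by rewrite lerXn2r// nnegrE// (le_trans _ kx).
- by apply: intgZ; exact: L2_sq.
Qed.

Lemma bmeas_L2 k : bmeas k -> L2 k.
Proof.
move=> bk; have -> : k = fun x => k x * 1 by apply/funext => x; rewrite mulr1.
apply: L2_bmeasM => //; apply: sq_L2; first exact: measurable_cst.
exact: intg_cst.
Qed.

Lemma bmeas_cst c : bmeas (fun=> c).
Proof. by split; [exact: measurable_cst|exists `|c|]. Qed.

Lemma bmeasM k f : bmeas k -> bmeas f -> bmeas (fun x => k x * f x).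
Proof.
move=> [mk [M kM]] [mf [N fN]]; split; first exact: measurable_funM.
by exists (M * N) => x Ix; rewrite normrM ler_pM// ?kM ?fN.
Qed.

Lemma L2_intg f : L2 f -> intg f.
Proof.
move=> hf; have := intgM hf (bmeas_L2 (bmeas_cst 1)).
by under eq_fun do rewrite mulr1.
Qed.

Lemma L2Z c f : L2 f -> L2 (fun x => c * f x).
Proof. by move=> hf; apply: L2_bmeasM => //; exact: bmeas_cst. Qed.

Lemma L2_D f g : L2 f -> L2 g -> L2 (fun x => f x + g x).
Proof.
by move=> hf hg; have := L2_lin 1 hf hg; under eq_fun do rewrite mul1r.
Qed.

Lemma L2_B f g : L2 f -> L2 g -> L2 (fun x => f x - g x).
Proof.
by move=> hf hg; have := L2_lin (-1) hf hg; under eq_fun do rewrite mulN1r.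
Qed.

Lemma eq_ip f g f' g' : (forall x, I x -> f x * g x = f' x * g' x) ->
  ip f g = ip f' g'.
Proof. by move=> e; apply: eq_Rintegral => x /set_mem /e. Qed.

Lemma ipC f g : ip f g = ip g f.
Proof. by apply: eq_ip => x _; rewrite mulrC. Qed.

Lemma ip_linl c f g k : L2 f -> L2 g -> L2 k ->
  ip (fun x => f x + c * g x) k = ip f k + c * ip g k.
Proof.
move=> hf hg hk; rewrite /ip.
under eq_Rintegral do rewrite mulrDl -mulrA.
have mI := measurable_I.
rewrite (RintegralD mI (intgM hf hk) (intgZ c (intgM hg hk))).
by rewrite (RintegralZl c mI (intgM hg hk)).
Qed.

Lemma ip_linr c f g k : L2 f -> L2 g -> L2 k ->
  ip k (fun x => f x + c * g x) = ip k f + c * ip k g.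
Proof. by move=> hf hg hk; rewrite ipC ip_linl// 2!(ipC k). Qed.

Lemma ip_Zl c f g : L2 f -> L2 g -> ip (fun x => c * f x) g = c * ip f g.
Proof.
move=> hf hg; rewrite /ip; under eq_Rintegral do rewrite -mulrA.
by rewrite (RintegralZl c measurable_I (intgM hf hg)).
Qed.

Lemma ip_Zr c f g : L2 f -> L2 g -> ip f (fun x => c * g x) = c * ip f g.
Proof. by move=> hf hg; rewrite ipC ip_Zl// ipC. Qed.

Lemma ip0l f : ip (fun=> 0) f = 0.
Proof.
rewrite /ip; under eq_Rintegral do rewrite mul0r.
by rewrite Rintegral_cst ?mul0r//; exact: measurable_I.
Qed.

Lemma ip_ge0 f : 0 <= ip f f.
Proof. by apply: Rintegral_ge0 => x _; rewrite -expr2 sqr_ge0. Qed.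

Lemma sqL2E f : sqL2 L f = ip f f.
Proof. by apply: eq_Rintegral => x _; rewrite expr2. Qed.

Lemma le_ip f g f' g' : L2 f -> L2 g -> L2 f' -> L2 g' ->
  (forall x, I x -> f x * g x <= f' x * g' x) -> ip f g <= ip f' g'.
Proof.
by move=> *; apply: le_Rintegral => //; [exact: measurable_I|exact: intgM|exact: intgM].
Qed.

Lemma ip_CS f g : L2 f -> L2 g -> ip f g ^+ 2 <= ip f f * ip g g.
Proof.
move=> hf hg.
have H c : 0 <= ip f f + 2 * c * ip f g + c ^+ 2 * ip g g.
  have := ip_ge0 (fun x => f x + c * g x).
  rewrite ip_linl// ?ip_linr//; last exact: L2_lin.
  by rewrite (ipC g f); congr (_ <= _); ring.
have [gg0|gg0] := eqVneq (ip g g) 0; last first.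
  have gp : 0 < ip g g by rewrite lt_neqAle eq_sym gg0 ip_ge0.
  have := H (- ip f g / ip g g) => h.
  rewrite -subr_ge0.
  have -> : ip f f * ip g g - ip f g ^+ 2 = ip g g * (ip f f +
     2 * (- ip f g / ip g g) * ip f g + (- ip f g / ip g g) ^+ 2 * ip g g).
    by field.
  by rewrite mulr_ge0// ltW.
(* If [ip g g = 0], the quadratic is affine in [c] and nonnegative everywhere, so its slope
   vanishes. *)
suff -> : ip f g = 0 by rewrite gg0 mulr0 expr0n.
apply/eqP/negPn/negP => fg0.
have := H (- (ip f f + 1) / (2 * ip f g)); rewrite gg0 mulr0 addr0.
have -> : 2 * (- (ip f f + 1) / (2 * ip f g)) * ip f g = - (ip f f + 1) by field.
lra.
Qed.

Lemma ip_young (e : R) f g : 0 < e -> L2 f -> L2 g ->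
  2 * ip f g <= e * ip f f + e^-1 * ip g g.
Proof.
move=> e0 hf hg; have := ip_ge0 (fun x => f x + (- e^-1) * g x).
rewrite ip_linl// ?ip_linr//; last exact: L2_lin.
rewrite (ipC g f) => h; rewrite -subr_ge0.
have -> : e * ip f f + e^-1 * ip g g - 2 * ip f g = e * (ip f f +
   - e^-1 * ip f g + - e^-1 * (ip f g + - e^-1 * ip g g)).
  by field; rewrite gt_eqF.
by rewrite mulr_ge0// ltW.
Qed.

Lemma ip_absM k f g (M : R) : bmeas k -> (forall x, I x -> `|k x| <= M) ->
  L2 f -> L2 g -> 2 * `|ip (fun x => k x * f x) g| <= M * (ip f f + ip g g).
Proof.
move=> bk kM hf hg.
have M0 : 0 <= M.
  have I0 : I 0 by rewrite /I0L/= in_itv/= lexx ltW.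
  exact: le_trans (kM 0 I0).
have hkf := L2_bmeasM bk hf.
have mI := measurable_I.
have h1 : `|ip (fun x => k x * f x) g| <= \int[mu]_(x in I) `|k x * f x * g x|.
  by apply: le_normr_Rintegral => //; exact: intgM.
have h2 : \int[mu]_(x in I) `|k x * f x * g x| <=
  \int[mu]_(x in I) (M / 2 * (f x * f x + g x * g x)).
  apply: le_Rintegral => //.
  - by apply: integrable_norm => //; exact: intgM.
  - by apply: intgZ; apply: intgD; apply: intgM.
  - move=> x Ix; rewrite -mulrA normrM.
    have fg : `|f x * g x| <= (f x * f x + g x * g x) / 2.
      have := sqr_ge0 (f x - g x); have := sqr_ge0 (f x + g x).
      by move=> ? ?; rewrite ler_norml; apply/andP; split; nra.
    rewrite mulrAC -mulrA; apply: ler_pM => //; exact: kM.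
have h3 : \int[mu]_(x in I) (M / 2 * (f x * f x + g x * g x)) =
   M / 2 * (ip f f + ip g g).
  rewrite RintegralZl//; last by apply: intgD; apply: intgM.
  by rewrite RintegralD//; apply: intgM.
by move: M0 h1 h2 h3 => {kM mI bk hkf}; lra.
Qed.

End L2_toolbox.

(** Both sides integrate phi(s) psi(r) over the half-plane r <= s; this is the source of the product
    rule for primitives of discontinuous functions. *)
Lemma fubini_triangle {R : realType} (phi psi : R -> R) :
  let mu := @lebesgue_measure R in
  mu.-integrable setT (EFin \o phi) -> mu.-integrable setT (EFin \o psi) ->
  \int[mu]_s (phi s * \int[mu]_(r in `]-oo, s]) psi r) =
  \int[mu]_r (psi r * \int[mu]_(s in `[r, +oo[) phi s).
Proof.
move=> mu iphi ipsi.
have mphi : measurable_fun setT phi by apply/measurable_EFinP; apply: (measurable_int mu).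
have mpsi : measurable_fun setT psi by apply/measurable_EFinP; apply: (measurable_int mu).
pose K (z : R * R) := if z.2 <= z.1 then phi z.1 * psi z.2 else 0.
have mK : measurable_fun setT K.
  apply: measurable_fun_ifT => //.
  - exact: measurable_fun_ler.
  - by apply: measurable_funM; exact: measurableT_comp.
have iK : (mu \x mu)%E.-integrable setT (EFin \o K).
  apply/integrable12ltyP; first exact/measurable_EFinP.
  apply: (@le_lt_trans _ _
      (\int[mu]_s (`|phi s|%:E * \int[mu]_r `|psi r|%:E))%E).
    apply: ge0_le_integral => //.
    - by move=> s _; apply: integral_ge0 => r _.
    - apply: (measurable_fun_fubini_tonelli_F (m2 := mu)
        (fun z => `|(EFin \o K) z|%E)) => //.
      by apply: measurableT_comp => //; exact/measurable_EFinP.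
    - by apply: emeasurable_funM => //; apply/measurable_EFinP;
        apply: measurableT_comp.
    - move=> s _; rewrite -ge0_integralZl//; last first.
      + by apply/measurable_EFinP; apply: measurableT_comp.
      + apply: ge0_le_integral => //.
        * apply/measurable_EFinP; apply: measurableT_comp => //.
          by apply: measurable_fun_ifT => //=; [apply: measurable_fun_ler|apply: measurable_funM].
        * by apply/measurable_EFinP; apply: measurable_funM => //; apply: measurableT_comp.
        * move=> r _; rewrite /K/= lee_fin; case: ifP => _; rewrite ?normrM//.
          by rewrite normr0 mulr_ge0.
  have ifin : (\int[mu]_r `|psi r|%:E < +oo)%E by case/integrableP : ipsi.
  have jfin : (\int[mu]_r `|phi r|%:E < +oo)%E by case/integrableP : iphi.
  rewrite ge0_integralZr//; last 2 first.
    by apply/measurable_EFinP; apply: measurableT_comp.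
    by apply: integral_ge0 => r _.
  by rewrite lte_mul_pinfty// ?integral_ge0// ge0_fin_numE// integral_ge0.
rewrite /Rintegral; congr fine.
transitivity (\int[mu]_s \int[mu]_r (EFin \o K) (s, r))%E.
  apply: eq_integral => s _ /=.
  have ipsis : mu.-integrable `]-oo, s] (EFin \o psi) by exact: integrableS ipsi.
  rewrite EFinM fineK; last exact: integrable_fin_num.
  rewrite -(integralZl _ ipsis)// integral_mkcond.
  apply: eq_integral => r _; rewrite patchE /K/= mem_setE in_itv/=.
  by case: ifP.
rewrite (Fubini iK); apply: eq_integral => r _ /=.
have iphir : mu.-integrable `[r, +oo[ (EFin \o phi) by exact: integrableS iphi.
rewrite EFinM fineK; last exact: integrable_fin_num.
rewrite -(integralZl _ iphir)// [RHS]integral_mkcond.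
apply: eq_integral => s _; rewrite patchE /K/= mem_setE in_itv/= andbT.
by case: ifP => // _; rewrite -EFinM mulrC.
Qed.

(** * Primitives of integrable functions *)

Section primitives.
Context {R : realType} (L : R).
Hypothesis L_gt0 : 0 < L.
Implicit Types (f g k : R -> R).

Local Notation mu := (@lebesgue_measure R).
Local Notation I := (I0L L).
Local Notation intg f := (mu.-integrable I (EFin \o (f : R -> R))).
Local Notation L2 := (L2 L).
Local Notation prim := (prim L).

Lemma intg_sub g (A : set R) : measurable (A : set (measurableTypeR R)) ->
  A `<=` I -> intg g -> mu.-integrable A (EFin \o g).
Proof. by move=> mA AI; apply: integrableS => //; exact: measurable_I. Qed.

Lemma prim_diff f g (x y : R) : prim f g -> intg g -> 0 <= x -> x <= y -> y <= L ->
  f y - f x = \int[mu]_(t in `]x, y]) g t.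
Proof.
move=> fg ig x0 xy yL; rewrite (fg y) ?(le_trans x0 xy)// (fg x) ?x0 ?(le_trans xy)//.
rewrite opprD addrACA subrr add0r Rintegral_itvB//.
by apply: intg_sub ig => //; apply: subset_itvl; rewrite bnd_simp.
Qed.

Lemma quot_close (A c e h : R) : 0 < h -> `|A - c * h| <= e * h -> `|A / h - c| <= e.
Proof.
move=> h0 H; rewrite -(ler_pM2r h0) (le_trans _ H)//.
by rewrite -{2}(gtr0_norm h0) -normrM mulrBl divfK ?gt_eqF.
Qed.

Lemma avg_close g (c e x y : R) : x < y ->
  mu.-integrable `]x, y] (EFin \o g) ->
  (forall t, x <= t <= y -> `|g t - c| <= e) ->
  `|\int[mu]_(t in `]x, y]) g t - c * (y - x)| <= e * (y - x).
Proof.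
move=> xy ig H.
have mD : measurable (`]x, y] : set (measurableTypeR R)) by exact: measurable_itv.
have muD : fine (mu `]x, y]) = y - x by rewrite lebesgue_measure_itv/= lte_fin xy.
have icst (k : R) : mu.-integrable `]x, y] (EFin \o (fun=> k)).
  apply: measurable_bounded_integrable; [exact: mD| |exact: measurable_cst|].
    by rewrite /= lebesgue_measure_itv/= lte_fin xy -EFinD ltry.
  by exists `|k|; split; [exact: num_real|move=> M cM ? _; exact: ltW].
have -> : c * (y - x) = \int[mu]_(t in `]x, y]) c by rewrite Rintegral_cst// muD.
rewrite -(RintegralB mD ig (icst c)).
have iB : mu.-integrable `]x, y] (EFin \o (fun t => g t - c)).
  by have := integrableB mD ig (icst c); apply: eq_integrable.
apply: (le_trans (le_normr_Rintegral mD iB)).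
have -> : e * (y - x) = \int[mu]_(t in `]x, y]) e by rewrite Rintegral_cst// muD.
apply: le_Rintegral => //; first exact: integrable_norm.
by move=> t /=; rewrite in_itv/= => /andP[xt ty]; apply: H; rewrite ty ltW.
Qed.

Lemma prim_close f g (c e x y : R) : prim f g -> intg g ->
  0 <= x -> x < y -> y <= L ->
  (forall t, x <= t <= y -> `|g t - c| <= e) ->
  `|f y - f x - c * (y - x)| <= e * (y - x).
Proof.
move=> fg ig x0 xy yL H; rewrite (prim_diff fg ig x0 (ltW xy) yL).
apply: avg_close => //; apply: intg_sub ig; first exact: measurable_itv.
by apply: subset_itv; rewrite bnd_simp.
Qed.

Lemma prim_within f g : prim f g -> intg g -> {within I, continuous f}.
Proof.
move=> fg ig; have := parameterized_integral_continuous (ltW L_gt0) ig => H.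
apply: (@subspace_eq_continuous _ _ _
   (fun x => f 0 + parameterized_integral mu 0 x g)).
  by move=> x; rewrite inE /I0L/= in_itv/= => /fg e; exact/esym/e.
by move=> x; apply: (@cvgD _ _ (subspace I)); [exact: cvg_cst|exact: H].
Qed.

Lemma prim_bmeas f g : prim f g -> intg g -> bmeas L f.
Proof.
move=> fg ig; have cf := prim_within fg ig; split.
  by apply: subspace_continuous_measurable_fun => //; exact: measurable_I.
have := continuous_compact cf (@segment_compact R 0 L).
move=> /compact_bounded[M [_ HM]].
exists (M + 1) => x Ix; apply: HM; first by rewrite ltrDl.
by exists x.
Qed.

Lemma prim_L2 f g : prim f g -> L2 g -> L2 f.
Proof.
by move=> fg /(L2_intg L_gt0) ig; apply: bmeas_L2 => //; exact: prim_bmeas ig.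
Qed.

Lemma prim_lin c f g f' g' : intg g -> intg g' -> prim f g -> prim f' g' ->
  prim (fun x => f x + c * f' x) (fun x => g x + c * g' x).
Proof.
move=> ig ig' fg fg' x x0L.
have mD : measurable (`[0, x] : set (measurableTypeR R)) by exact: measurable_itv.
have DI : `[0, x] `<=` I.
  by apply: subset_itvl; rewrite bnd_simp; case/andP: x0L.
have i1 := intg_sub mD DI ig; have i2 := intg_sub mD DI ig'.
rewrite fg// fg'// RintegralD//; last by apply: (intg_sub mD DI); exact: intgZ.
rewrite RintegralZl//; ring.
Qed.

Lemma prim_eq f g f' g' : (forall x, I x -> f x = f' x) ->
  (forall x, I x -> g x = g' x) -> prim f g -> prim f' g'.
Proof.
move=> ff gg fg x x0L; have Ix : I x by rewrite /I0L/= in_itv.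
rewrite -ff// -ff; last by rewrite /I0L/= in_itv/= lexx ltW.
rewrite fg//; congr (_ + _); apply: eq_Rintegral => t.
rewrite inE/= in_itv/= => /andP[t0 tx]; apply: gg; rewrite /I0L/= in_itv/= t0.
by case/andP: x0L => _; exact: le_trans.
Qed.

Lemma prim_cst c : prim (fun=> c) (fun=> 0).
Proof.
move=> x _; rewrite Rintegral_cst ?mul0r ?addr0//; exact: measurable_itv.
Qed.

(** The derivatives are merely L^2, so no pointwise product rule is available. Integrating f'(s)
    g'(r) over the triangle 0 <= r <= s <= x in both orders equates the integrals of f' (g - g(0))
    and of (f(x) - f) g', and the claim follows by rearrangement. *)
Lemma prim_mul f g f' g' : prim f f' -> prim g g' -> L2 f' -> L2 g' ->
  prim (fun x => f x * g x) (fun x => f' x * g x + f x * g' x).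
Proof.
move=> ff gg Lf' Lg' x /andP[x0 xL].
have if' := L2_intg L_gt0 Lf'; have ig' := L2_intg L_gt0 Lg'.
have Lf := prim_L2 ff Lf'; have Lg := prim_L2 gg Lg'.
pose D : set R := `[0, x]%classic.
have mD : measurable (D : set (measurableTypeR R)) by exact: measurable_itv.
have DI : D `<=` I by apply: subset_itvl; rewrite bnd_simp.
have if'D := intg_sub mD DI if'; have ig'D := intg_sub mD DI ig'.
have ifgD : mu.-integrable D (EFin \o (fun t => f' t * g t)).
  by apply: (intg_sub mD DI); apply: intgM.
have ifgD' : mu.-integrable D (EFin \o (fun t => f t * g' t)).
  by apply: (intg_sub mD DI); apply: intgM.
pose phi := f' \_ D; pose psi := g' \_ D.
have iphi : mu.-integrable setT (EFin \o phi).
  by rewrite /phi -restrict_EFin; apply/integrable_restrict => //; rewrite setTI.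
have ipsi : mu.-integrable setT (EFin \o psi).
  by rewrite /psi -restrict_EFin; apply/integrable_restrict => //; rewrite setTI.
have := fubini_triangle iphi ipsi.
have -> : \int[mu]_s (phi s * \int[mu]_(r in `]-oo, s]) psi r) =
   \int[mu]_(s in D) (f' s * g s - g 0 * f' s).
  rewrite [RHS]Rintegral_mkcond; apply: eq_Rintegral => s _.
  rewrite /phi !patchE; case: ifPn => [|_]; last by rewrite mul0r.
  rewrite inE /D/= in_itv/= => /andP[s0 sx].
  rewrite /psi -Rintegral_mkcondr.
  have -> : `]-oo, s]%classic `&` D = `[0, s]%classic.
    apply/seteqP; split=> t /=; rewrite /D/= !in_itv/=.
      by move=> [-> /andP[->]].
    by move=> /andP[-> ts]; rewrite ts (le_trans ts).
  have := gg s; rewrite s0 (le_trans sx)// => /(_ isT) ->.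
  ring.
have -> : \int[mu]_r (psi r * \int[mu]_(s in `[r, +oo[) phi s) =
   \int[mu]_(r in D) (f x * g' r - f r * g' r).
  rewrite [RHS]Rintegral_mkcond; apply: eq_Rintegral => r _.
  rewrite /psi !patchE; case: ifPn => [|_]; last by rewrite mul0r.
  rewrite inE /D/= in_itv/= => /andP[r0 rx].
  rewrite /phi -Rintegral_mkcondr.
  have -> : `[r, +oo[%classic `&` D = `[r, x]%classic.
    apply/seteqP; split=> t /=; rewrite /D/= !in_itv/= ?andbT.
      by move=> [-> /andP[]].
    by move=> /andP[rt tx]; rewrite rt tx (le_trans r0).
  have irx : mu.-integrable `[r, x] (EFin \o f').
    by apply: intg_sub if' => //; apply: subset_itv; rewrite bnd_simp.
  rewrite -Rintegral_itv_obnd_cbnd; last first.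
    by apply: intg_sub if' => //; apply: subset_itv; rewrite bnd_simp.
  rewrite -(prim_diff ff if' r0 rx xL); ring.
have iZ (c : R) (h : R -> R) : mu.-integrable D (EFin \o h) ->
   mu.-integrable D (EFin \o (fun t => c * h t)).
  by move=> ih; have := integrableZl mD c ih; apply: eq_integrable.
rewrite RintegralB//; last exact: iZ.
rewrite RintegralB//; last exact: iZ.
rewrite RintegralZl// RintegralZl// RintegralD//.
have := ff x; rewrite x0 xL => /(_ isT); rewrite -/D => ->.
have := gg x; rewrite x0 xL => /(_ isT); rewrite -/D => ->.
move: (\int[mu]_(t in D) _) (\int[mu]_(t in D) _) (\int[mu]_(t in D) _)
  (\int[mu]_(t in D) _) (f 0) (g 0) => a1 a2 a3 a4 a5 a6; clear; lra.
Qed.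

Lemma L2_prim_mul f g f' g' : prim f f' -> prim g g' -> L2 f' -> L2 g' ->
  L2 (fun x => f' x * g x + f x * g' x).
Proof.
move=> ff gg Lf' Lg'; apply: L2_D => //.
  have -> : (fun x => f' x * g x) = (fun x => g x * f' x).
    by apply/funext => x; rewrite mulrC.
  by apply: L2_bmeasM Lf' => //; apply: prim_bmeas gg _; exact: L2_intg.
by apply: L2_bmeasM Lg' => //; apply: prim_bmeas ff _; exact: L2_intg.
Qed.

Lemma ip_parts f g f' g' : prim f f' -> prim g g' -> L2 f' -> L2 g' ->
  ip L f' g + ip L f g' = f L * g L - f 0 * g 0.
Proof.
move=> ff gg Lf' Lg'; have := prim_mul ff gg Lf' Lg' => /(_ L).
rewrite lexx ltW// => /(_ isT) ->.
rewrite RintegralD; first by rewrite /ip; ring.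
- exact: measurable_I.
- by apply: intgM => //; exact: prim_L2 gg Lg'.
- by apply: intgM => //; exact: prim_L2 ff Lf'.
Qed.

End primitives.

(** * Density of H^1 in L^2, with prescribed end values *)

Section derivatives.
Context {R : realType} (L : R).
Hypothesis L_gt0 : 0 < L.
Implicit Types (f g k : R -> R).

Local Notation mu := (@lebesgue_measure R).
Local Notation I := (I0L L).
Local Notation intg f := (mu.-integrable I (EFin \o (f : R -> R))).
Local Notation L2 := (L2 L).
Local Notation prim := (prim L).

Lemma within_eps g (x e : R) : {within I, continuous g} -> I x -> 0 < e ->
  exists2 d : R, 0 < d & forall t, I t -> `|t - x| < d -> `|g t - g x| <= e.
Proof.
move=> /subspace_continuousP/(_ x)/[apply] gx e0.
move/cvgrPdist_le : gx => /(_ e e0).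
rewrite near_withinE => -[d /= d0 H]; exists d => // t It tx.
by rewrite distrC; apply: H => //=; rewrite distrC.
Qed.

(** Connects the one-sided limits in [der] with weak derivatives: a continuous derivative is
    recovered at every point, from the right below L and from the left at L. *)
Lemma der_prim f g (x : R) : prim f g -> intg g -> {within I, continuous g} ->
  0 <= x <= L -> der L f x = g x.
Proof.
move=> fg ig cg /andP[x0 xL].
have Ix : I x by rewrite /I0L/= in_itv/= x0.
rewrite /der; case: ifPn => [xltL|].
  apply/cvg_lim; first exact: Rhausdorff.
  apply/cvgrPdist_le => e e0.
  have [d d0 H] := within_eps cg Ix e0.
  have mn0 : 0 < Num.min d (L - x) by rewrite lt_min d0 subr_gt0.
  near=> h.
  have h0 : 0 < h by near: h; exact: nbhs_right_gt.
  have : h < Num.min d (L - x) by near: h; exact: nbhs_right_lt.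
  rewrite lt_min => /andP[hd hL].
  have xh : x < x + h by rewrite ltrDl.
  have xhL : x + h <= L by rewrite -lerBrDl ltW.
  have := @prim_close R L f g (g x) e x (x + h) fg ig x0 xh xhL.
  have -> : x + h - x = h by ring.
  move=> HH; rewrite distrC; apply: quot_close => //.
  apply: HH => t /andP[xt txh]; apply: H.
    by rewrite /I0L/= in_itv/= (le_trans x0 xt) (le_trans txh).
  by rewrite ger0_norm ?subr_ge0// (le_lt_trans _ hd)// lerBlDl.
rewrite -leNgt => Lx; have {Lx xL} xL : x = L by apply/eqP; rewrite eq_le xL.
apply/cvg_lim; first exact: Rhausdorff.
apply/cvgrPdist_le => e e0.
have [d d0 H] := within_eps cg Ix e0.
have mn0 : 0 < Num.min d x by rewrite lt_min d0 xL.
near=> h.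
have h0 : 0 < h by near: h; exact: nbhs_right_gt.
have : h < Num.min d x by near: h; exact: nbhs_right_lt.
rewrite lt_min => /andP[hd hx].
have xh : x - h < x by rewrite ltrBlDr ltrDl.
have xh0 : 0 <= x - h by rewrite subr_ge0 ltW.
have := @prim_close R L f g (g x) e (x - h) x fg ig xh0 xh.
have -> : x - (x - h) = h by ring.
rewrite {1}xL lexx => /(_ isT) HH.
rewrite distrC; apply: quot_close => //; apply: HH => t /andP[xt txh]; apply: H.
  by rewrite /I0L/= in_itv/= (le_trans xh0 xt)/= -xL.
rewrite distrC ger0_norm ?subr_ge0//.
by rewrite (le_lt_trans _ hd)// lerBlDr -lerBlDl.
Unshelve. all: by end_near. Qed.

End derivatives.

Section density.
Context {R : realType} (L : R).
Hypothesis L_gt0 : 0 < L.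
Implicit Types (f g k : R -> R).

Local Notation mu := (@lebesgue_measure R).
Local Notation I := (I0L L).
Local Notation intg f := (mu.-integrable I (EFin \o (f : R -> R))).
Local Notation L2 := (L2 L).
Local Notation prim := (prim L).

Definition dist2 f g := ip L (fun x => f x - g x) (fun x => f x - g x).

(** Dominated convergence applied to the squares; one good index is all that the approximation
    arguments use. *)
Lemma L2_dct (f_ : nat -> R -> R) G :
  (forall n, measurable_fun I (f_ n)) -> L2 G ->
  (forall n x, I x -> `|f_ n x| <= G x) ->
  (forall x, I x -> f_ n x @[n --> \oo] --> 0) ->
  forall e : R, 0 < e -> exists n, ip L (f_ n) (f_ n) < e.
Proof.
move=> mf LG fG f0 e e0.
have mI := @measurable_I R L.
have H := @dominated_convergence _ _ R mu I mI
  (fun n x => (f_ n x * f_ n x)%:E) (cst 0%E) (fun x => (G x * G x)%:E).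
case: H.
- by move=> n; apply/measurable_EFinP; apply: measurable_funM; exact: mf.
- exact: measurable_cst.
- apply: aeW => x Ix; apply: cvg_EFin; first by apply: nearW => n.
  by rewrite -[0](mulr0 (0 : R)); apply: cvgM; exact: f0.
- exact: intgM.
- apply: aeW => x n Ix; rewrite lee_fin normrM ler_pM//; exact: fG.
move=> _ _; rewrite integral0 => /fine_cvgP[_ /cvgrPdist_lt/(_ e e0)[N _ HN]].
exists N; have := HN N (leqnn N); rewrite /= sub0r normrN => /(le_lt_trans _); apply.
exact: ler_norm.
Qed.

Lemma dist2_triangle f g k : L2 f -> L2 g -> L2 k ->
  dist2 f k <= 2 * dist2 f g + 2 * dist2 g k.
Proof.
move=> hf hg hk; have h1 := L2_B hf hg; have h2 := L2_B hg hk.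
rewrite /dist2; set u := (fun x => f x - g x); set v := (fun x => g x - k x).
have -> : (fun x => f x - k x) = (fun x => u x + 1 * v x).
  by apply/funext => x; rewrite /u /v; ring.
rewrite ip_linl// ?ip_linr//; last exact: L2_lin.
have := ip_young (@ltr01 R) h1 h2; rewrite (ipC L v u) -/u -/v invr1; lra.
Qed.

(** Membership in the L^2 closure of H^1, which will turn out to be all of L^2. *)
Definition H1lim k := L2 k /\ forall e, 0 < e ->
  exists f f', [/\ prim f f', L2 f' & dist2 k f < e].

(** Allows density to be proved in stages: bounded continuous functions, bounded measurable ones,
    then all of L^2. *)
Lemma H1lim_closed k : L2 k -> (forall e, 0 < e -> exists2 g, H1lim g & dist2 k g < e) ->
  H1lim k.
Proof.
move=> hk H; split => // e e0.
have e4 : 0 < e / 4 by rewrite divr_gt0.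
have [g [Lg Hg] kg] := H _ e4; have [f [f' [ff' Lf' gf]]] := Hg _ e4.
exists f, f'; split => //.
apply: (le_lt_trans (dist2_triangle hk Lg (prim_L2 L_gt0 ff' Lf'))).
by move: kg gf; clear; lra.
Qed.

Lemma continuous_bmeas g (n : R) : continuous g -> (forall x, `|g x| <= n) -> bmeas L g.
Proof.
move=> cg gn; split; last by exists n.
by apply: measurable_funTS; exact: continuous_measurable_fun.
Qed.

(** The approximants are the Steklov averages, the means of g over [x, x + h]. They are C^1, bounded
    by [n], and converge pointwise because g is continuous, so dominated convergence applies. *)
Lemma H1lim_continuous g (n : R) : continuous g -> (forall x, `|g x| <= n) ->
  H1lim g.
Proof.
move=> cg gn; have Lg := bmeas_L2 L_gt0 (continuous_bmeas cg gn).
split => // e e0.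
have ig (x y : R) : mu.-integrable `[x, y] (EFin \o g).
  apply: continuous_compact_integrable; first exact: segment_compact.
  exact: continuous_subspaceT.
have ig' (x y : R) : mu.-integrable `]x, y] (EFin \o g).
  apply: integrableS (ig x y) => //; exact: subset_itv_oc_cc.
(* The primitive starts at -1, so that every point of [0, L] is interior and two-sided derivatives
   exist there. *)
pose F (y : R) := \int[mu]_(t in `[-1, y]) g t.
have dF (x : R) : -1 < x -> is_derive x 1 F (g x).
  move=> x1; have [|//|dF F'] := @continuous_FTC1_closed R g (-1) x (x + 1) _ (ig _ _) x1.
    by rewrite ltrDl.
  by move=> ?; exact: cg.
  by rewrite derive1E in F'; exact: DeriveDef dF F'.
have FB (x h : R) : 0 <= x -> 0 < h -> F (x + h) - F x = \int[mu]_(t in `]x, x + h]) g t.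
  move=> x0 h0; rewrite /F Rintegral_itvB//; rewrite bnd_simp; lra.
pose G h x := h^-1 * (F (x + h) - F x).
pose g' h x := h^-1 * (g (x + h) - g x).
have dG (x h : R) : 0 < h -> -1 < x -> is_derive x 1 (G h) (g' h x).
  move=> h0 x1; have d1 := dF x x1.
  have d2 : is_derive x 1 (fun y => F (y + h)) (g (x + h)).
    have xh1 : -1 < x + h by lra.
    have := dF _ xh1 => d3.
    have d4 : is_derive x 1 (fun y : R => y + h) 1.
      by apply: is_derive_eq; rewrite addr0.
    have := @is_derive1_comp R F (fun y => y + h) x _ 1 d3 d4.
    by rewrite mulr1.
  have := is_deriveZ (h^-1) (is_deriveB d2 d1).
  done.
have cg' h : continuous (g' h).
  move=> x; apply: cvgM; first exact: cvg_cst.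
  apply: cvgB; last exact: cg.
  by apply: (cvg_comp (fun y => y + h) g); [apply: cvgD; [exact: cvg_id|exact: cvg_cst]|exact: cg].
have pG h : 0 < h -> prim (G h) (g' h).
  move=> h0 x /andP[x0 xL].
  have [->|xn0] := eqVneq x 0; first by rewrite set_itv1 Rintegral_set1 addr0.
  have {xn0}x0 : 0 < x by rewrite lt_neqAle eq_sym xn0.
  have cG (y : R) : 0 <= y -> {for y, continuous (G h)}.
    move=> y0; apply: differentiable_continuous; apply/derivable1_diffP.
    have y1 : -1 < y by lra.
    by case: (dG y h h0 y1).
  rewrite /Rintegral (@continuous_FTC2 R (g' h) (G h) 0 x x0)/=; first by ring.
  - exact: continuous_subspaceT.
  - split.
    + move=> y; rewrite in_itv/= => /andP[y0 _].
      have y1 : -1 < y by lra.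
      by case: (dG y h h0 y1).
    + by apply: cvg_at_right_filter; apply: cG.
    + by apply: cvg_at_left_filter; apply: cG; exact: ltW.
  - move=> y; rewrite in_itv/= => /andP[y0 _].
    have y1 : -1 < y by lra.
    by rewrite derive1E; case: (dG y h h0 y1).
have Lg' h : L2 (g' h).
  apply: bmeas_L2 => //; apply: (@continuous_bmeas _ (`|h^-1| * (n + n))) => // x.
  rewrite normrM ler_wpM2l// (le_trans (ler_normB _ _))// lerD//; exact: gn.
have avg (x h c d : R) : 0 <= x -> 0 < h ->
    (forall t, x <= t <= x + h -> `|g t - c| <= d) -> `|G h x - c| <= d.
  move=> x0 h0 H.
  have xh : x < x + h by rewrite ltrDl.
  have := avg_close xh (ig' _ _) H.
  rewrite -FB//; have -> : x + h - x = h by ring.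
  by move=> A; rewrite /G mulrC; exact: quot_close.
pose h_ (m : nat) : R := m.+1%:R^-1.
have h_gt0 m : 0 < h_ m by rewrite /h_ invr_gt0.
have [||||m Hm] := @L2_dct (fun m x => g x - G (h_ m) x) (fun=> n + n) _ _ _ _ e e0.
- move=> m; apply: measurable_funB; first exact: L2_measurable.
  exact: L2_measurable (prim_L2 L_gt0 (pG _ (h_gt0 m)) (Lg' _)).
- by apply: bmeas_L2 => //; exact: bmeas_cst.
- move=> m x; rewrite /I0L/= in_itv/= => /andP[x0 _].
  rewrite (le_trans (ler_normB _ _))// lerD//.
  rewrite -(subr0 (G _ _)); apply: avg => // t _; by rewrite subr0.
- move=> x; rewrite /I0L/= in_itv/= => /andP[x0 _].
  apply/cvgrPdist_le => d d0.
  have /cvgrPdist_le/(_ d d0)[r /= r0 Hr] := cg x.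
  near=> m.
  rewrite sub0r normrN distrC; apply: avg => // t /andP[xt txm].
  rewrite distrC; apply: Hr => /=; rewrite distrC ger0_norm ?subr_ge0//.
  rewrite ltrBlDl (le_lt_trans txm)// ltrD2l /h_.
  by near: m; exact: near_infty_natSinv_lt (PosNum r0).
by exists (G (h_ m)), (g' (h_ m)); split => //; exact: pG.
Unshelve. all: by end_near. Qed.

End density.

(** * Truncation *)

Section clip.
Context {R : realType}.
Implicit Types n t y : R.

(** Truncation of t to [-n, n] when n >= 0, written with absolute values so that continuity and the
    Lipschitz bound come from those of the norm. *)
Definition clip n t := (`|t + n| - `|t - n|) / 2.

Lemma clip_continuous n : continuous (clip n).
Proof.
move=> t; apply: cvgM; last exact: cvg_cst.
by apply: cvgB; apply: cvg_norm; [apply: cvgD|apply: cvgB];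
  do ?[exact: cvg_id|exact: cvg_cst].
Qed.

Lemma clip_le n t : 0 <= n -> `|clip n t| <= n.
Proof.
move=> n0; rewrite /clip ler_norml.
by case: (ger0P (t + n)); case: (ger0P (t - n)) => ? ?; apply/andP; split; lra.
Qed.

Lemma clip_id n t : `|t| <= n -> clip n t = t.
Proof.
rewrite ler_norml => /andP[? ?]; rewrite /clip ger0_norm ?ler0_norm; lra.
Qed.

Lemma clip_lip n t y : `|clip n t - clip n y| <= `|t - y|.
Proof.
have h1 := ler_dist_dist (t + n) (y + n); have h2 := ler_dist_dist (t - n) (y - n).
have e1 : t + n - (y + n) = t - y by ring.
have e2 : t - n - (y - n) = t - y by ring.
move: h1 h2; rewrite e1 e2 => h1 h2.
have -> : clip n t - clip n y =
  ((`|t + n| - `|y + n|) - (`|t - n| - `|y - n|)) / 2 by rewrite /clip; ring.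
rewrite normrM (ger0_norm (_ : 0 <= 2^-1)) ?invr_ge0//.
have := ler_normB (`|t + n| - `|y + n|) (`|t - n| - `|y - n|); lra.
Qed.

Lemma clip_res n t : 0 <= n -> `|t - clip n t| <= `|t|.
Proof.
move=> n0; rewrite /clip.
case: (ger0P (t + n)); case: (ger0P (t - n)); case: (ger0P t) => ? ? ?;
  rewrite ler_norml; apply/andP; split; lra.
Qed.

End clip.

Section density_L2.
Context {R : realType} (L : R).
Hypothesis L_gt0 : 0 < L.
Implicit Types (f g k : R -> R).

Local Notation mu := (@lebesgue_measure R).
Local Notation I := (I0L L).
Local Notation intg f := (mu.-integrable I (EFin \o (f : R -> R))).
Local Notation L2 := (L2 L).
Local Notation prim := (prim L).

(** For bounded k, L^1 approximation by continuous functions suffices: truncating the approximant at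
    [n] does not increase the distance and bounds the difference by [2 * n], so the squared L^2
    distance is at most [2 * n] times the L^1 distance. *)
Lemma H1lim_bounded k (n : R) : measurable_fun I k -> 0 < n ->
  (forall x, I x -> `|k x| <= n) -> H1lim L k.
Proof.
move=> mk n0 kn.
have Lk : L2 k by apply: bmeas_L2 => //; split => //; exists n.
apply: H1lim_closed => // e e0.
have ik := L2_intg L_gt0 Lk; have mI := @measurable_I R L.
have [g_ [cg ig g0]] := approximation_continuous_integrable mI (mu_I_fin L_gt0) ik.
have c0 : 0 < e / (2 * n) by rewrite divr_gt0// mulr_gt0.
have /fine_cvgP[_ /cvgrPdist_lt/(_ _ c0)[N _ HN]] := g0.
have := HN N (leqnn N); rewrite /= sub0r normrN => {HN} HN.
have ccg : continuous (fun x => clip n (g_ N x)).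
  by move=> x; apply: (cvg_comp (g_ N) (clip n)); [exact: cg|exact: clip_continuous].
have Hc := H1lim_continuous L_gt0 ccg (fun x => clip_le (g_ N x) (ltW n0)).
exists (fun x => clip n (g_ N x)) => //.
have LB := L2_B Lk Hc.1.
have iB : intg (fun x => k x - g_ N x).
  by have := integrableB mI ik (ig N); apply: eq_integrable.
have iN : intg (fun x => `|k x - g_ N x|) by apply: (integrable_norm iB); exact: mI.
have iZ : intg (fun x => 2 * n * `|k x - g_ N x|) by exact: intgZ.
apply: (@le_lt_trans _ _ (\int[mu]_(x in I) (2 * n * `|k x - g_ N x|))).
  apply: le_Rintegral => //; first exact: intgM.
  move=> x Ix; apply: (le_trans (ler_norm _)); rewrite normrM ler_pM//.
    rewrite (le_trans (ler_normB _ _))// mulr_natl mulr2n lerD ?kn//.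
    by apply: clip_le; exact: ltW.
  by rewrite -{1}(clip_id (kn x Ix)); exact: clip_lip.
rewrite (RintegralZl _ mI iN).
rewrite -ltr_pdivlMl ?mulr_gt0// mulrC; apply: le_lt_trans HN.
exact: ler_norm.
Qed.

Lemma H1lim_L2 k : L2 k -> H1lim L k.
Proof.
move=> Lk; apply: H1lim_closed => // e e0.
have mk := L2_measurable Lk.
have mc (n : R) : measurable_fun I (fun x => clip n (k x)).
  apply: (@measurableT_comp _ _ _ _ _ _ (clip n)) => //.
  by apply: continuous_measurable_fun; exact: clip_continuous.
(* The level [n.+1] is positive at every index, as [H1lim_bounded] demands. *)
have [||||n Hn] := @L2_dct R L (fun n x => k x - clip n.+1%:R (k x)) (fun x => `|k x|) _ _ _ _ e e0.
- by move=> n; apply: measurable_funB => //; exact: mc.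
- apply: sq_L2; first by apply: measurableT_comp.
  by under eq_fun do rewrite real_normK ?num_real//; exact: L2_sq.
- by by move=> n x Ix; exact: clip_res.
- move=> x Ix; apply: cvg_near_cst.
  near=> n; rewrite clip_id ?subrr//.
  apply: (@le_trans _ _ n%:R); last by rewrite ler_nat.
  by near: n; exact: nbhs_infty_ger.
exists (fun x => clip n.+1%:R (k x)) => //.
apply: (@H1lim_bounded _ n.+1%:R); [exact: mc|exact: ltr0Sn|].
by move=> x Ix; apply: clip_le.
Unshelve. all: by end_near. Qed.

Lemma prim_affineX (al be : R) (n : nat) :
  prim (fun x => (al + be * x) ^+ n.+1) (fun x => n.+1%:R * be * (al + be * x) ^+ n)
  /\ L2 (fun x => n.+1%:R * be * (al + be * x) ^+ n).
Proof.
have Lc c : L2 (fun=> c) by apply: bmeas_L2 => //; exact: bmeas_cst.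
have p1 : prim (fun x => al + be * x) (fun=> be).
  move=> x /andP[x0 xL]; rewrite Rintegral_cst; last exact: measurable_itv.
  rewrite /= lebesgue_measure_itv/= lte_fin.
  case: ltP => [_|x0']; first by rewrite oppr0 addr0/=; ring.
  by have -> : x = 0; [apply/eqP; rewrite eq_le x0 x0'|rewrite /=; ring].
elim: n => [|n [IH LIH]].
  split; last by under eq_fun do rewrite expr0 mulr1.
  by apply: prim_eq p1 => // x _; rewrite ?expr1// expr0; ring.
split.
  apply: prim_eq (prim_mul L_gt0 IH p1 LIH (Lc be)) => // x _.
    by rewrite [RHS]exprSr.
  by rewrite (exprS _ n) -[n.+2]addn1 natrD; ring.
have := L2_prim_mul L_gt0 IH p1 LIH (Lc be).
congr Defs.L2; apply/funext => x.
by rewrite (exprS _ n) -[n.+2]addn1 natrD; ring.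
Qed.

(* Powers of an affine function concentrate at one end of the interval, so end
   values can be corrected at an arbitrarily small L^2 cost. *)
Lemma ip_affineX (al be : R) (n : nat) : be != 0 ->
  ip L (fun x => (al + be * x) ^+ n) (fun x => (al + be * x) ^+ n) =
  ((al + be * L) ^+ (n + n).+1 - al ^+ (n + n).+1) / ((n + n).+1%:R * be).
Proof.
move=> be0; have [p Lp] := prim_affineX al be (n + n).
have nb0 : (n + n).+1%:R * be != 0 by rewrite mulf_neq0// pnatr_eq0.
apply: (mulIf nb0); rewrite divfK// mulrC.
have := p L; rewrite lexx ltW// mulr0 addr0 => /(_ isT) ->.
rewrite addrAC subrr add0r.
have Lq : L2 (fun x => (al + be * x) ^+ (n + n)).
  have := L2Z ((n + n).+1%:R * be)^-1 Lp.
  by congr Defs.L2; apply/funext => x; rewrite mulrA mulVf// mul1r.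
rewrite RintegralZl; [|exact: measurable_I|exact: L2_intg].
by congr (_ * _); apply: eq_Rintegral => x _; rewrite exprD.
Qed.

(** The freely prescribed end values are what allows the boundary conditions of the domain to be met
    when its density is proved. *)
Lemma H1_dense k (c0 cL e : R) : L2 k -> 0 < e ->
  exists f f', [/\ prim f f', L2 f', f 0 = c0, f L = cL & dist2 L k f < e].
Proof.
move=> Lk e0.
have e4 : 0 < e / 4 by rewrite divr_gt0.
have [_ /(_ _ e4)[g [g' [gg' Lg' kg]]]] := H1lim_L2 Lk.
have Lg := prim_L2 L_gt0 gg' Lg'.
set d0 := c0 - g 0; set dL := cL - g L.
have LV0 : L^-1 != 0 by rewrite invr_eq0 gt_eqF.
(* The corrector d0 (1 - x/L)^(n+1) + dL (x/L)^(n+1) will have squared norm at most K/2/(n+1), hence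
   below e/8 by the choice of n; and 2 e/4 + 2 e/8 < e. *)
pose K := 4 * L * (d0 ^+ 2 + dL ^+ 2) + 1.
have K0 : 0 < K.
  by rewrite ltr_wpDl// mulr_ge0 ?addr_ge0 ?sqr_ge0// mulr_ge0// ltW.
have [n Hn] : exists n : nat, K / (e / 4) < n.+1%:R.
  by exists (Num.trunc (K / (e / 4))); exact: truncnS_gt.
have {}Hn : K < n.+1%:R * (e / 4) by rewrite -ltr_pdivrMr.
pose A x := (1 + - L^-1 * x) ^+ n.+1; pose B x := (0 + L^-1 * x) ^+ n.+1.
have [pA LA'] := prim_affineX 1 (- L^-1) n.
have [pB LB'] := prim_affineX 0 L^-1 n.
have LA := prim_L2 L_gt0 pA LA'; have LB := prim_L2 L_gt0 pB LB'.
have LL : L^-1 * L = 1 by rewrite mulVf// gt_eqF.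
have N0 : (n.+1 + n.+1).+1%:R != 0 :> R by rewrite pnatr_eq0.
have AA : ip L A A = L / (n.+1 + n.+1).+1%:R.
  rewrite /A ip_affineX ?oppr_eq0// mulNr LL subrr expr0n expr1n/=.
  by move: N0; move: ((n.+1 + n.+1).+1%:R : R) => N N0; field; rewrite N0 gt_eqF.
have BB : ip L B B = L / (n.+1 + n.+1).+1%:R.
  rewrite /B ip_affineX// LL add0r expr0n expr1n/=.
  by move: N0; move: ((n.+1 + n.+1).+1%:R : R) => N N0; field; rewrite N0 gt_eqF.
pose f x := (g x + d0 * A x) + dL * B x.
have ig' := L2_intg L_gt0 Lg'; have iA' := L2_intg L_gt0 LA'; have iB' := L2_intg L_gt0 LB'.
have p1 := prim_lin d0 ig' iA' gg' pA.
have L1 := L2_lin d0 Lg' LA'.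
have p2 := prim_lin dL (L2_intg L_gt0 L1) iB' p1 pB.
have L2' := L2_lin dL L1 LB'.
exists f; eexists; split; [exact: p2|exact: L2'| | |].
- by rewrite /f /A /B !mulr0 !addr0 expr1n expr0n/= /d0; ring.
- by rewrite /f /A /B mulNr LL subrr add0r expr1n expr0n/= /dL; ring.
have Lf : L2 f := prim_L2 L_gt0 p2 L2'.
apply: (le_lt_trans (dist2_triangle Lk Lg Lf)).
have E : dist2 L g f <= 2 * (d0 ^+ 2 + dL ^+ 2) * (L / (n.+1 + n.+1).+1%:R).
  have LdA := L2Z (- d0) LA.
  have -> : dist2 L g f = ip L (fun x => - d0 * A x + (- dL) * B x)
      (fun x => - d0 * A x + (- dL) * B x).
    by apply: eq_ip => x _; rewrite /f; ring.
  have LAB := L2_lin (- dL) LdA LB.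
  have LB1 := L2Z (- dL) LB.
  have -> : ip L (fun x => - d0 * A x + - dL * B x) (fun x => - d0 * A x + - dL * B x)
     = d0 ^+ 2 * ip L A A + dL ^+ 2 * ip L B B + 2 * (d0 * dL * ip L A B).
    rewrite ip_linl// !ip_linr// !(ip_Zl, ip_Zr)// (ipC _ B A); ring.
  have := ip_young (@ltr01 R) LdA LB1.
  rewrite !(ip_Zl, ip_Zr)// AA BB invr1.
  move: (ip L A B) (L / _) => u v; nra.
have E2 : 2 * (d0 ^+ 2 + dL ^+ 2) * (L / (n.+1 + n.+1).+1%:R) <= K / 2 / n.+1%:R.
  apply: (@le_trans _ _ (2 * (d0 ^+ 2 + dL ^+ 2) * (L / n.+1%:R))).
    rewrite ler_wpM2l// ?mulr_ge0 ?addr_ge0 ?sqr_ge0// ler_wpM2l ?ltW//.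
    by rewrite ltf_pV2 ?posrE// ltr_nat ltnS leq_addr.
  rewrite !mulrA ler_pM2r ?invr_gt0// /K.
  have -> : 2 * (d0 ^+ 2 + dL ^+ 2) * L = (4 * L * (d0 ^+ 2 + dL ^+ 2)) / 2 by field.
  by rewrite ler_pM2r ?invr_gt0// lerDl.
have E3 : K / 2 / n.+1%:R < e / 8.
  rewrite ltr_pdivrMr//.
  have -> : e / 8 * n.+1%:R = n.+1%:R * (e / 4) / 2 by field.
  by rewrite ltr_pM2r ?invr_gt0.
by move: e0 kg (le_lt_trans (le_trans E E2) E3); clear; lra.
Qed.

End density_L2.

(** * Uniqueness of weak derivatives and trace estimates *)

Section weak_derivative_unique.
Context {R : realType} (L : R).
Hypothesis L_gt0 : 0 < L.
Implicit Types (f g h k : R -> R).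

Local Notation mu := (@lebesgue_measure R).
Local Notation I := (I0L L).
Local Notation L2 := (L2 L).
Local Notation prim := (prim L).

(** Integration by parts makes [k] orthogonal to H^1, which is dense; hence [k] is orthogonal to
    itself. *)
Lemma prim0_ip0 k : L2 k -> prim (fun=> 0) k -> ip L k k = 0.
Proof.
move=> Lk p0; apply/eqP; rewrite eq_le ip_ge0 andbT leNgt; apply/negP => kk.
have [f [f' [ff' Lf' _ _ kf]]] := H1_dense L_gt0 0 0 Lk kk.
have Lf := prim_L2 L_gt0 ff' Lf'.
have kf0 : ip L k f = 0.
  have := ip_parts L_gt0 p0 ff' Lk Lf'.
  by rewrite ip0l !mul0r subrr addr0.
have LB := L2_lin (-1) Lk Lf.
have := ip_CS Lk LB; rewrite ip_linr// kf0 mulr0 addr0.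
have -> : ip L (fun x => k x + -1 * f x) (fun x => k x + -1 * f x) = dist2 L k f.
  by apply: eq_ip => x _; ring.
by move: kk kf; clear => ? ? ?; nra.
Qed.

(** The difference [g - h] has a zero primitive, hence norm 0, hence is orthogonal to [g + h]. This
    makes the value picked by [epsilon] in [Hnorm2] independent of the chosen weak derivative. *)
Lemma prim_ip_unique f g h : prim f g -> prim f h -> L2 g -> L2 h ->
  ip L g g = ip L h h.
Proof.
move=> fg fh Lg Lh.
have LB := L2_lin (-1) Lg Lh.
have p0 : prim (fun=> 0) (fun x => g x + -1 * h x).
  apply: prim_eq (prim_lin (-1) (L2_intg L_gt0 Lg) (L2_intg L_gt0 Lh) fg fh) => // x _.
  by ring.
have B0 := prim0_ip0 LB p0.
have LS := L2_lin 1 Lg Lh.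
have := ip_CS LB LS; rewrite B0 mul0r => H.
have {H} : ip L (fun x => g x + -1 * h x) (fun x => g x + 1 * h x) = 0.
  by apply/eqP; rewrite -sqrf_eq0 eq_le H sqr_ge0.
rewrite ip_linl// !ip_linr// (ipC L h g) => H; lra.
Qed.

Lemma Hnorm2_1 f g : prim f g -> L2 g -> Hnorm2 L 1 f = ip L f f + ip L g g.
Proof.
move=> fg Lg; have Lf := prim_L2 L_gt0 fg Lg.
rewrite /Hnorm2; set s := ClassicalEpsilon.epsilon _ _.
have : HsVal L 1 f s.
  apply: ClassicalEpsilon.epsilon_spec; exists (ip L f f + ip L g g).
  by split => //; exists g, (ip L g g); rewrite !sqL2E.
move=> [_ [h [s' [fh [[Lh ->] ->]]]]].
by rewrite !sqL2E (prim_ip_unique fg fh).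
Qed.

Lemma Hnorm2_2 f g h : prim f g -> prim g h -> L2 h ->
  Hnorm2 L 2 f = ip L f f + (ip L g g + ip L h h).
Proof.
move=> fg gh Lh; have Lg := prim_L2 L_gt0 gh Lh; have Lf := prim_L2 L_gt0 fg Lg.
rewrite /Hnorm2; set s := ClassicalEpsilon.epsilon _ _.
have : HsVal L 2 f s.
  apply: ClassicalEpsilon.epsilon_spec; exists (ip L f f + (ip L g g + ip L h h)).
  split => //; exists g, (ip L g g + ip L h h); split => //; rewrite sqL2E.
  by split => //; split => //; exists h, (ip L h h); rewrite !sqL2E.
move=> [_ [g' [_ [fg' [[Lg' [h' [_ [gh' [[Lh' ->] ->]]]]] ->]]]]].
rewrite !sqL2E.
(* First derivatives here are themselves primitives, hence continuous, so both equal [der L f]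
   pointwise; for the second derivatives equality of norms is enough. *)
have gg' x : I x -> g' x = g x.
  rewrite /I0L/= in_itv/= => x0L.
  have c := prim_within L_gt0 gh (L2_intg L_gt0 Lh).
  have c' := prim_within L_gt0 gh' (L2_intg L_gt0 Lh').
  rewrite -(der_prim L_gt0 fg (L2_intg L_gt0 Lg) c x0L).
  by rewrite -(der_prim L_gt0 fg' (L2_intg L_gt0 Lg') c' x0L).
have gh'' : prim g h' by apply: prim_eq gh' => // x; exact: gg'.
rewrite (prim_ip_unique gh gh'')//; congr (_ + (_ + _)).
by apply: eq_ip => x Ix; rewrite gg'.
Qed.

Lemma prim_increment f g x y : prim f g -> L2 g -> I x -> I y ->
  (f y - f x) ^+ 2 <= L * ip L g g.
Proof.
move=> fg Lg.
wlog : x y / x <= y.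
  move=> W Ix Iy; have [xy|/ltW yx] := leP x y; first exact: W.
  by rewrite -sqrrN opprB; exact: W.
rewrite /I0L/= !in_itv/= => xy /andP[x0 _] /andP[_ yL].
have ig := L2_intg L_gt0 Lg; have mI := @measurable_I R L.
have ig' : mu.-integrable `]x, y] (EFin \o g).
  by apply: intg_sub ig => //; apply: subset_itv; rewrite bnd_simp.
have mg : measurable_fun I (fun t => `|g t|).
  by apply: measurableT_comp => //; exact: L2_measurable Lg.
have Lag : L2 (fun t => `|g t|).
  by apply: sq_L2 => //; under eq_fun do rewrite real_normK ?num_real//; exact: L2_sq.
have L1 : L2 (fun=> 1) by apply: bmeas_L2 => //; exact: bmeas_cst.
have H : `|f y - f x| <= ip L (fun t => `|g t|) (fun=> 1).
  rewrite (prim_diff fg ig x0 xy yL).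
  apply: (le_trans (le_normr_Rintegral _ ig')); first exact: measurable_itv.
  rewrite /ip; under [leRHS]eq_Rintegral do rewrite mulr1.
  rewrite Rintegral_mkcond [leRHS]Rintegral_mkcond.
  have iN : mu.-integrable `]x, y] (EFin \o (fun t => `|g t|)).
    by apply: (integrable_norm ig'); exact: measurable_itv.
  apply: le_Rintegral => //.
  - by rewrite -restrict_EFin; apply/integrable_restrict => //; rewrite setTI.
  - rewrite -restrict_EFin; apply/integrable_restrict => //; rewrite setTI.
    exact: L2_intg.
  - move=> t _; rewrite !patchE.
    case: ifPn => [|_]; last by case: ifP => _; [exact: normr_ge0|exact: lexx].
    rewrite inE/= in_itv/= => /andP[xt ty]; rewrite mem_set//.
    by rewrite /I0L/= in_itv/= (ltW (le_lt_trans x0 xt)) (le_trans ty yL).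
rewrite -real_normK ?num_real//.
apply: (@le_trans _ _ (ip L (fun t => `|g t|) (fun=> 1) ^+ 2)).
  by rewrite ler_pXn2r// nnegrE// (le_trans _ H).
apply: (le_trans (ip_CS Lag L1)).
have -> : ip L (fun t => `|g t|) (fun t => `|g t|) = ip L g g.
  by apply: eq_ip => t _; rewrite -!expr2 real_normK ?num_real.
have -> : ip L (fun=> 1) (fun=> 1) = L.
  rewrite /ip Rintegral_cst//= lebesgue_measure_itv/= lte_fin L_gt0.
  by rewrite -EFinD/=; ring.
by rewrite mulrC.
Qed.

(** Average over t the bound f(x)^2 <= 2 f(t)^2 + 2 L |g|^2, which follows from Cauchy-Schwarz for
    the increment. *)
Lemma prim_trace f g x : prim f g -> L2 g -> I x ->
  L * f x ^+ 2 <= 2 * ip L f f + 2 * L ^+ 2 * ip L g g.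
Proof.
move=> fg Lg Ix; have Lf := prim_L2 L_gt0 fg Lg; have mI := @measurable_I R L.
have c0 c : \int[mu]_(t in I) c = c * L.
  rewrite Rintegral_cst//= lebesgue_measure_itv/= lte_fin L_gt0.
  by rewrite -EFinD/= subr0.
have -> : L * f x ^+ 2 = \int[mu]_(t in I) (f x ^+ 2) by rewrite c0 mulrC.
have -> : 2 * ip L f f + 2 * L ^+ 2 * ip L g g =
   \int[mu]_(t in I) (2 * (f t * f t) + 2 * L * ip L g g).
  have i1 : mu.-integrable I (EFin \o (fun t => f t * f t)) by exact: intgM.
  rewrite RintegralD//; last first.
  - exact: intg_cst.
  - exact: intgZ.
  by rewrite RintegralZl// c0 /ip; ring.
apply: le_Rintegral => //.
- exact: intg_cst.
- by apply: intgD; [apply: intgZ; exact: intgM|exact: intg_cst].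
- move=> t It; have := prim_increment fg Lg It Ix.
  by have := sqr_ge0 (2 * f t - f x); move: (ip L g g) => u; nra.
Qed.

(** A Poincare inequality anchored at 0. *)
Lemma prim_ip_le f g : prim f g -> L2 g ->
  ip L f f <= 2 * L * f 0 ^+ 2 + 2 * L ^+ 2 * ip L g g.
Proof.
move=> fg Lg; have Lf := prim_L2 L_gt0 fg Lg; have mI := @measurable_I R L.
have I0 : I 0 by rewrite /I0L/= in_itv/= lexx ltW.
have c0 c : \int[mu]_(t in I) c = c * L.
  rewrite Rintegral_cst//= lebesgue_measure_itv/= lte_fin L_gt0.
  by rewrite -EFinD/= subr0.
have -> : 2 * L * f 0 ^+ 2 + 2 * L ^+ 2 * ip L g g =
  \int[mu]_(t in I) (2 * f 0 ^+ 2 + 2 * L * ip L g g) by rewrite c0; ring.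
apply: le_Rintegral => //.
- exact: intgM.
- exact: intg_cst.
- move=> t It; have := prim_increment fg Lg I0 It.
  by have := sqr_ge0 (f t - 2 * f 0); move: (ip L g g) => u; nra.
Qed.

End weak_derivative_unique.

(** * The Lyapunov form *)

(** The function is m = -exp(-lam x). The last two lower bounds concern the coefficients of q^2 and
    p^2 left in the bulk when the derivative of the multiplier term is integrated by parts;
    negativity at L gives the boundary term there the dissipative sign. *)
Lemma multiplier {R : realType} (L : R) (L_gt0 : 0 < L) (P P1 P2 : R -> R) (P0 : R) :
  prim L P P1 -> prim L P1 P2 -> L2 L P2 ->
  0 < P0 -> (forall x, I0L L x -> P0 <= P x) ->
  exists m m1 (c : R), [/\ 0 < c, prim L m m1 /\ L2 L m1, m 0 = -1, m L <= - c &
    forall x, I0L L x -> [/\ `|m x| <= 1, c <= m1 x * P x ^+ 2 &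
      c <= m1 x * P x + m x * P1 x]].
Proof.
move=> pP pP1 LP2 P0_gt0 P0P.
have [_ [K HK]] := prim_bmeas L_gt0 pP1 (L2_intg L_gt0 LP2).
have I0 : I0L L 0 by rewrite /I0L/= in_itv/= lexx ltW.
have K0 : 0 <= K by exact: le_trans (HK _ I0).
pose lam := 2 * K / P0 + 1.
have lam1 : 1 <= lam by rewrite lerDr mulr_ge0 ?invr_ge0 ?mulr_ge0// ltW.
have lamP : lam * P0 = 2 * K + P0 by rewrite /lam; field; rewrite gt_eqF.
pose E x := expR (- lam * x).
have E0 x : 0 < E x by exact: expR_gt0.
have E1 x : 0 <= x -> E x <= 1.
  by move=> x0; rewrite /E -expR0 ler_expR mulNr oppr_le0 mulr_ge0// (le_trans ler01).
have EL x : x <= L -> E L <= E x.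
  by move=> xL; rewrite /E ler_expR ler_nM2l// oppr_lt0 (lt_le_trans ltr01).
have dE (x : R) : is_derive x 1 (fun x => - E x) (lam * E x).
  have d1 : is_derive x 1 (fun y : R => - lam * y) (- lam).
    have := is_deriveZ (- lam) (is_derive_id x 1).
    by rewrite /GRing.scale/= mulr1.
  have d2 := is_derive1_comp (is_derive_expR (- lam * x)) d1.
  have := is_deriveN d2.
  by rewrite mulrN opprK mulrC.
have cE : continuous E.
  move=> x; apply: (cvg_comp (fun y => - lam * y) expR).
    by apply: cvgM; [exact: cvg_cst|exact: cvg_id].
  exact: continuous_expR.
have cE' : continuous (fun x => lam * E x).
  by move=> x; apply: cvgM; [exact: cvg_cst|exact: cE].
have pE : prim L (fun x => - E x) (fun x => lam * E x).
  move=> x /andP[x0 xL].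
  have [->|xn0] := eqVneq x 0; first by rewrite set_itv1 Rintegral_set1 addr0.
  have {xn0}x0 : 0 < x by rewrite lt_neqAle eq_sym xn0.
  rewrite /Rintegral (@continuous_FTC2 R (fun x => lam * E x) (fun x => - E x) 0 x x0)/=; first by ring.
  - exact: continuous_subspaceT.
  - split.
    + by move=> y _; case: (dE y).
    + by apply: cvg_at_right_filter; apply: cvgN; exact: cE.
    + by apply: cvg_at_left_filter; apply: cvgN; exact: cE.
  - by move=> y _; rewrite derive1E; case: (dE y).
(* The entries of the minimum serve, in order, the value [m L], the p^2 coefficient and the q^2
   coefficient; [E L] is the least value of [E] on the interval. *)
exists (fun x => - E x), (fun x => lam * E x), (E L * Num.min 1 (Num.min P0 (P0 ^+ 2))).
have mn0 : 0 < Num.min 1 (Num.min P0 (P0 ^+ 2)) by rewrite !lt_min ltr01 P0_gt0 exprn_gt0.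
have mn1 : Num.min 1 (Num.min P0 (P0 ^+ 2)) <= 1 by rewrite ge_min lexx.
have mn2 : Num.min 1 (Num.min P0 (P0 ^+ 2)) <= P0 by rewrite !ge_min lexx orbT.
have mn3 : Num.min 1 (Num.min P0 (P0 ^+ 2)) <= P0 ^+ 2 by rewrite !ge_min lexx !orbT.
split.
- by rewrite mulr_gt0.
- split => //; apply: bmeas_L2 => //; split.
    by apply: measurable_funTS; exact: continuous_measurable_fun.
  exists lam => x; rewrite /I0L/= in_itv/= => /andP[x0 xL].
  have l0 := le_trans ler01 lam1.
  rewrite ger0_norm; last by rewrite mulr_ge0// ltW.
  by rewrite -[leRHS]mulr1 ler_wpM2l// E1.
- by rewrite /E mulr0 expR0.
- by rewrite lerN2 -[leRHS]mulr1 ler_wpM2l// ltW.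
- move=> x Ix; have PP := P0P x Ix; have := HK x Ix; rewrite ler_norml => /andP[K1 K2].
  move: Ix; rewrite /I0L/= in_itv/= => /andP[x0 xL].
  split.
  + by rewrite normrN ger0_norm; [exact: E1|exact: ltW].
  + have h1 : P0 ^+ 2 <= P x ^+ 2 by rewrite lerXn2r// nnegrE ltW// (lt_le_trans P0_gt0).
    have h2 : E x <= lam * E x by rewrite -[leLHS]mul1r ler_wpM2r// ltW.
    apply: (@le_trans _ _ (E x * P0 ^+ 2)).
      by apply: ler_pM => //; [exact: ltW|exact: ltW|exact: EL].
    by apply: ler_pM => //; [exact: ltW|rewrite sqr_ge0].
  + have -> : lam * E x * P x + - E x * P1 x = E x * (lam * P x - P1 x) by ring.
    apply: ler_pM; [exact: ltW|exact: ltW|exact: EL|].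
    rewrite (le_trans mn2)//.
    have : lam * P0 <= lam * P x by rewrite ler_wpM2l// (le_trans ler01).
    rewrite lamP; move: K0 K2; clear; lra.
Qed.

(** * Scalar inequalities for the Lyapunov form *)

Section scalar_estimates.
Context {R : realType}.
Implicit Types L Pm p X i y : R.

Lemma momentum_arith L Pm p X i y : 0 <= L -> 0 <= X ->
  p ^+ 2 <= Pm ^+ 2 -> i ^+ 2 <= L * X ->
  (i + p * y) ^+ 2 <= 2 * (L + Pm ^+ 2) * (X + y ^+ 2).
Proof.
move=> L0 X0 PL H.
have h1 := sqr_ge0 (i - p * y).
have h2 : p ^+ 2 * y ^+ 2 <= Pm ^+ 2 * y ^+ 2 by rewrite ler_wpM2r// sqr_ge0.
have h3 : 0 <= L * y ^+ 2 by rewrite mulr_ge0 ?sqr_ge0// ltW.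
have h4 : 0 <= Pm ^+ 2 * X by apply: mulr_ge0 => //; exact: sqr_ge0.
move: H h1 h2 h3 h4; clear; nra.
Qed.

(** Key: [X], [Q], [S] are the squared norms of p, q, w'; [Qp] is the integral of P q^2, [cr] the
    multiplier term, [M] the momentum, [PL] is P(L), [b2] is b^-2, and [y], [u], [v] are the
    boundary observables. *)
Lemma lyap_upper_arith (N Lam sg Km Pm PL k3 k4 b2 X Q S Qp cr M y u v : R) :
  0 <= N -> 0 <= Lam -> 0 <= sg -> 0 <= Km -> 0 <= Pm -> PL <= Pm ->
  0 <= k3 -> 0 <= k4 -> 0 <= b2 -> 0 <= X -> 0 <= Q -> 0 <= S ->
  2 * cr <= Pm * (X + Q) -> Qp <= Pm * Q -> M ^+ 2 <= Km * (X + y ^+ 2) ->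
  N * (X / 2 + Qp / 2 + PL * y ^+ 2 / 2 + k3 * u ^+ 2 + k4 * v ^+ 2) + cr +
  Lam * (M * u) + sg * (b2 * (u - v) ^+ 2 + S) <=
  (N * (1 + Pm + k3 + k4) + Pm + Lam * (Km + 1) + sg * (2 * b2 + 1)) *
  (X + Q + S + y ^+ 2 + u ^+ 2 + v ^+ 2).
Proof.
move=> N0 Lam0 sg0 Km0 Pm0 PLm k30 k40 b20 X0 Q0 S0 c1 c2 c3.
set C1 := 1 + Pm + k3 + k4.
have y0 := sqr_ge0 y; have u0 := sqr_ge0 u; have v0 := sqr_ge0 v.
set Y := y ^+ 2 in c3 y0 *; set U := u ^+ 2 in u0 *; set V := v ^+ 2 in v0 *.
pose Sg := X + Q + S + Y + U + V.
have T1 : X / 2 + Qp / 2 + PL * Y / 2 + k3 * U + k4 * V <= C1 * Sg.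
  have : PL * Y <= Pm * Y by rewrite ler_wpM2r.
  have : 0 <= Pm * X by rewrite mulr_ge0.
  have : 0 <= Pm * Q by rewrite mulr_ge0.
  have : 0 <= Pm * Y by rewrite mulr_ge0.
  have : 0 <= Pm * (S + U + V) by rewrite mulr_ge0 ?addr_ge0.
  have : 0 <= k3 * (X + Q + S + Y + V) by rewrite mulr_ge0 ?addr_ge0.
  have : 0 <= k4 * (X + Q + S + Y + U) by rewrite mulr_ge0 ?addr_ge0.
  move: c2 X0 Q0 S0 y0 u0 v0; rewrite /C1 /Sg; clear; lra.
have T2 : cr <= Pm * Sg.
  have : 0 <= Pm * X by rewrite mulr_ge0.
  have : 0 <= Pm * Q by rewrite mulr_ge0.
  have : 0 <= Pm * (S + Y + U + V) by rewrite mulr_ge0 ?addr_ge0.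
  move: c1; rewrite /Sg; clear; lra.
have T3 : M * u <= (Km + 1) * Sg.
  have : 2 * (M * u) <= M ^+ 2 + U by have := sqr_ge0 (M - u); rewrite /U; clear; lra.
  have : 0 <= Km * (Q + S + U + V) by rewrite mulr_ge0 ?addr_ge0.
  have : 0 <= Km * (X + Y) by rewrite mulr_ge0 ?addr_ge0.
  move: c3 X0 Q0 S0 y0 u0 v0; rewrite /Sg; clear; lra.
have T4 : b2 * (u - v) ^+ 2 + S <= (2 * b2 + 1) * Sg.
  have : b2 * (u - v) ^+ 2 <= b2 * (2 * U + 2 * V).
    by rewrite ler_wpM2l//; have := sqr_ge0 (u + v); rewrite /U /V; clear; lra.
  have : 0 <= b2 * (X + Q + S + Y) by rewrite mulr_ge0 ?addr_ge0.
  move: X0 Q0 S0 y0 u0 v0; rewrite /Sg; clear; lra.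
have := ler_wpM2l N0 T1; have := ler_wpM2l Lam0 T3; have := ler_wpM2l sg0 T4.
move: T2; rewrite -/Sg; clearbody Sg; clear; lra.
Qed.

(** [kap] is a coercivity constant of the energy and [w0] stands for w(0)^2. The multiplier term
    costs at most Pm/2 (X + Q) and the momentum term at most Lam/2 (Km (X + y^2) + u^2), so the
    condition on [N * kap] leaves a margin of at least 1. *)
Lemma lyap_lower_arith (N Lam sg Km Pm PL P0 k3 k4 kap c w0 X Q S Qp cr M y u v : R) :
  0 <= N -> 0 <= Lam -> 0 <= sg -> 0 <= Km -> 0 <= Pm -> P0 <= PL ->
  0 <= X -> 0 <= Q -> 0 <= S ->
  kap <= 2^-1 -> kap <= P0 / 2 -> kap <= k3 -> kap <= k4 ->
  Pm + Lam * (Km + 1) + 1 <= N * kap ->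
  c <= sg -> c <= 1 -> 0 <= w0 ->
  - 2 * cr <= Pm * (X + Q) -> P0 * Q <= Qp -> M ^+ 2 <= Km * (X + y ^+ 2) ->
  c * (X + Q + S + y ^+ 2 + u ^+ 2 + v ^+ 2) <=
  N * (X / 2 + Qp / 2 + PL * y ^+ 2 / 2 + k3 * u ^+ 2 + k4 * v ^+ 2) + cr +
  Lam * (M * u) + sg * (w0 + S).
Proof.
move=> N0 Lam0 sg0 Km0 Pm0 PL0 X0 Q0 S0 k1 k2 k3' k4' HN s1 s2 s0 c1 c2 c3.
have y0 := sqr_ge0 y; have u0 := sqr_ge0 u; have v0 := sqr_ge0 v.
have T3 : - (2 * (M * u)) <= Km * (X + y ^+ 2) + u ^+ 2.
  by have := sqr_ge0 (M + u); move: c3; clear; lra.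
set Y := y ^+ 2 in c3 y0 T3 *; set U := u ^+ 2 in u0 T3 *; set V := v ^+ 2 in v0 *.
have E1 : kap * (X + Q + Y + U + V) <= X / 2 + Qp / 2 + PL * Y / 2 + k3 * U + k4 * V.
  have := ler_wpM2r X0 k1; have := ler_wpM2r Q0 k2; have := ler_wpM2r y0 k2.
  have := ler_wpM2r u0 k3'; have := ler_wpM2r v0 k4'; have := ler_wpM2r y0 PL0.
  move: c2; clear; lra.
have E2 := ler_wpM2l N0 E1.
have sum0 : 0 <= X + Q + Y + U + V by rewrite !addr_ge0.
have E3 := ler_wpM2r sum0 HN.
have E4 := ler_wpM2l Lam0 T3.
have E5 := ler_wpM2r S0 s1.
have E6 := ler_wpM2r sum0 s2.
have E7 : 0 <= sg * w0 by rewrite mulr_ge0.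
have E8 : 0 <= Pm * (X + Q) by rewrite mulr_ge0 ?addr_ge0.
have E9 : 0 <= Pm * (Y + U + V) by rewrite mulr_ge0 ?addr_ge0.
have E11 : 0 <= Lam * Km * (Q + U + V) by rewrite !mulr_ge0 ?addr_ge0.
have E12 : 0 <= Lam * Km * (X + Y) by rewrite !mulr_ge0 ?addr_ge0.
have E13 : 0 <= Lam * U by rewrite mulr_ge0.
have E14 : 0 <= Lam * (X + Q + Y + V) by rewrite mulr_ge0 ?addr_ge0.
move: c1 E2 E3 E4 E5 E6 E7 E8 E9 E11 E12 E13 E14.
move: (N * (X / 2 + Qp / 2 + PL * Y / 2 + k3 * U + k4 * V)) => Z.
clear; lra.
Qed.

End scalar_estimates.

(** The quantities of a real state in which the form is written: p, q, w' (field [ow], not w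
    itself), y, u(0) and v(0). The value w(0) is recovered as (ou - ov) / b. *)
Record obs (R : realType) := Obs
  { op : R -> R; oq : R -> R; ow : R -> R; oy : R; ou : R; ov : R }.

Section lyapunov_form.
Context {R : realType} (L : R).
Hypothesis L_gt0 : 0 < L.

Definition olin (c : R) (o o' : obs R) : obs R :=
  Obs (fun x => op o x + c * op o' x) (fun x => oq o x + c * oq o' x)
      (fun x => ow o x + c * ow o' x) (oy o + c * oy o') (ou o + c * ou o')
      (ov o + c * ov o').

Definition ogood (o : obs R) := [/\ L2 L (op o), L2 L (oq o) & L2 L (ow o)].

Definition osize (o : obs R) : R :=
  ip L (op o) (op o) + ip L (oq o) (oq o) + ip L (ow o) (ow o) +
  oy o ^+ 2 + ou o ^+ 2 + ov o ^+ 2.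

Lemma ogood_lin c o o' : ogood o -> ogood o' -> ogood (olin c o o').
Proof. by move=> [? ? ?] [? ? ?]; split; apply: L2_lin. Qed.

Lemma osize_ge0 o : 0 <= osize o.
Proof. by rewrite !addr_ge0// ?ip_ge0// sqr_ge0. Qed.

Variables (P m : R -> R) (b k3 k4 N Lam sg : R).

(** Along solutions its derivative is -P(0) q(0), because P(L) y_t = -P(L) q(L) cancels the flux at
    L. *)
Definition momentum (o : obs R) := ip L (fun=> 1) (op o) + P L * oy o.

(** The polarised functional: at a state and its generator image it gives half of the derivative
    along the flow, and bilinearity expands its value at z + h A z exactly. *)
Definition lyap (o o' : obs R) : R :=
  N * (ip L (op o) (op o') / 2 + ip L (fun x => P x * oq o x) (oq o') / 2
       + P L * oy o * oy o' / 2 + k3 * ou o * ou o' + k4 * ov o * ov o')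
  + (ip L (fun x => m x * P x * op o x) (oq o') +
     ip L (fun x => m x * P x * oq o x) (op o')) / 2
  + Lam * (momentum o * ou o' + momentum o' * ou o) / 2
  + sg * ((ou o - ov o) / b * ((ou o' - ov o') / b) + ip L (ow o) (ow o')).

Lemma ip_wlin c k f g h : bmeas L k -> L2 L f -> L2 L g -> L2 L h ->
  ip L (fun x => k x * (f x + c * g x)) h =
  ip L (fun x => k x * f x) h + c * ip L (fun x => k x * g x) h.
Proof.
move=> bk hf hg hh; rewrite -ip_linl//; [|exact: L2_bmeasM|exact: L2_bmeasM].
by apply: eq_ip => x _; ring.
Qed.

Lemma ip_wC k f g : ip L (fun x => k x * f x) g = ip L (fun x => k x * g x) f.
Proof. by apply: eq_ip => x _; ring. Qed.

Lemma lyapC o o' : lyap o o' = lyap o' o.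
Proof.
rewrite /lyap (ipC _ (op o) (op o')) (ip_wC P (oq o)) (ip_wC _ (op o)).
rewrite (ip_wC _ (oq o) (op o')) (ipC _ (ow o)); ring.
Qed.

Hypothesis bP : bmeas L P.
Hypothesis bm : bmeas L m.

Lemma lyap_linl c o o' e : ogood o -> ogood o' -> ogood e ->
  lyap (olin c o o') e = lyap o e + c * lyap o' e.
Proof.
move=> [? ? ?] [? ? ?] [? ? ?].
have bmP : bmeas L (fun x => m x * P x) by exact: bmeasM.
have L1 : L2 L (fun=> 1) by apply: bmeas_L2 => //; exact: bmeas_cst.
rewrite /lyap /momentum /= ip_linl// ip_wlin//.
rewrite (ip_wlin c bmP)// (ip_wlin c bmP)// ip_linr// ip_linl//; ring.
Qed.

Variables (P0 Pm : R).
Hypothesis P0_gt0 : 0 < P0.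
Hypothesis P0P : forall x, I0L L x -> P0 <= P x.
Hypothesis PPm : forall x, I0L L x -> `|P x| <= Pm.
Hypothesis m1 : forall x, I0L L x -> `|m x| <= 1.

Definition Km := 2 * (L + Pm ^+ 2).

Lemma momentum_sq o : ogood o ->
  momentum o ^+ 2 <= Km * (ip L (op o) (op o) + oy o ^+ 2).
Proof.
move=> [Lp _ _].
have L1 : L2 L (fun=> 1) by apply: bmeas_L2 => //; exact: bmeas_cst.
have IL : I0L L L by rewrite /I0L/= in_itv/= lexx ltW.
have PL : P L ^+ 2 <= Pm ^+ 2.
  by rewrite -(real_normK (num_real (P L))) ler_pXn2r// ?nnegrE ?PPm// (le_trans _ (PPm IL)).
have := ip_CS L1 Lp.
have -> : ip L (fun=> 1) (fun=> 1) = L.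
  rewrite /ip Rintegral_cst; last exact: measurable_I.
  by rewrite /= lebesgue_measure_itv/= lte_fin L_gt0 -EFinD/=; ring.
rewrite /momentum /Km; have := ip_ge0 L (op o).
move: (ip L (op o) (op o)) (ip L (fun=> 1) (op o)) (oy o) (P L) PL => X i y p PL X0 H.
by apply: momentum_arith => //; exact: ltW.
Qed.

Lemma cross_bound o : ogood o ->
  2 * `|ip L (fun x => m x * P x * op o x) (oq o)| <=
  Pm * (ip L (op o) (op o) + ip L (oq o) (oq o)).
Proof.
move=> [Lp Lq _]; apply: ip_absM => //; first exact: bmeasM.
move=> x Ix; rewrite normrM -[leRHS]mul1r ler_pM//; [exact: m1|exact: PPm].
Qed.

Lemma Pq_bounds o : ogood o ->
  P0 * ip L (oq o) (oq o) <= ip L (fun x => P x * oq o x) (oq o) <=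
  Pm * ip L (oq o) (oq o).
Proof.
move=> [_ Lq _]; have LPq := L2_bmeasM bP Lq.
apply/andP; split.
  rewrite -ip_Zl//; apply: le_ip => //; first exact: L2Z.
  move=> x Ix; rewrite -!mulrA -expr2; apply: ler_wpM2r; [exact: sqr_ge0|exact: P0P].
rewrite -ip_Zl//; apply: le_ip => //; first exact: L2Z.
move=> x Ix; rewrite -!mulrA -expr2; apply: ler_wpM2r; first exact: sqr_ge0.
by apply: le_trans (ler_norm _) _; exact: PPm.
Qed.

Lemma lyap_diag o : lyap o o =
  N * (ip L (op o) (op o) / 2 + ip L (fun x => P x * oq o x) (oq o) / 2
       + P L * oy o ^+ 2 / 2 + k3 * ou o ^+ 2 + k4 * ov o ^+ 2)
  + ip L (fun x => m x * P x * op o x) (oq o) + Lam * (momentum o * ou o)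
  + sg * (((ou o - ov o) / b) ^+ 2 + ip L (ow o) (ow o)).
Proof. by rewrite /lyap (ip_wC _ (oq o) (op o)); move: (b^-1) => iv; field. Qed.

Hypothesis b_gt0 : 0 < b.
Hypothesis k3_gt0 : 0 < k3.
Hypothesis k4_gt0 : 0 < k4.
Hypothesis N_gt0 : 0 < N.
Hypothesis Lam_ge0 : 0 <= Lam.
Hypothesis sg_gt0 : 0 < sg.

Lemma lyap_upper : exists2 C : R, 0 < C &
  forall o, ogood o -> lyap o o <= C * osize o.
Proof.
have IL : I0L L L by rewrite /I0L/= in_itv/= lexx ltW.
have Pm0 : 0 < Pm by rewrite (lt_le_trans P0_gt0)// (le_trans (P0P IL))// (le_trans (ler_norm _))// PPm.
have PLm : P L <= Pm by rewrite (le_trans (ler_norm _))// PPm.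
have Km0 : 0 < Km by rewrite mulr_gt0// addr_gt0// exprn_gt0.
pose C1 := 1 + Pm + k3 + k4.
have C10 : 0 < C1 by rewrite !addr_gt0.
pose b2 := (b^-1) ^+ 2.
have b20 : 0 < b2 by rewrite exprn_gt0// invr_gt0.
exists (N * C1 + Pm + Lam * (Km + 1) + sg * (2 * b2 + 1)).
  have A1 : 0 < N * C1 by rewrite mulr_gt0.
  have A2 : 0 <= Lam * (Km + 1) by rewrite mulr_ge0// addr_ge0// ltW.
  have A3 : 0 < sg * (2 * b2 + 1) by rewrite mulr_gt0// addr_gt0// mulr_gt0.
  by apply: addr_gt0 => //; apply: ltr_wpDr => //; exact: addr_gt0.
move=> o go; rewrite lyap_diag /osize.
have c1 := cross_bound go; have /andP[_ c2] := Pq_bounds go; have c3 := momentum_sq go.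
have -> : ((ou o - ov o) / b) ^+ 2 = b2 * (ou o - ov o) ^+ 2 by rewrite /b2; ring.
have X0 := ip_ge0 L (op o); have Q0 := ip_ge0 L (oq o); have S0 := ip_ge0 L (ow o).
move: (ip L (fun x => m x * P x * op o x) (oq o)) c1 => cr c1.
have {c1} c1 : 2 * cr <= Pm * (ip L (op o) (op o) + ip L (oq o) (oq o)).
  by apply: le_trans c1; rewrite ler_pM2l// ler_norm.
move: (momentum o) c3 => M c3.
move: (ip L (fun x => P x * oq o x) (oq o)) c2 => Qp c2.
move: (ip L (op o) (op o)) (ip L (oq o) (oq o)) (ip L (ow o) (ow o)) X0 Q0 S0 c1 c2 c3 => X Q S X0 Q0 S0 c1 c2 c3.
move: (oy o) (ou o) (ov o) c3 => y u v c3.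
by apply: lyap_upper_arith c1 c2 c3 => //; exact: ltW.
Qed.

Lemma lyap_lower :
  let kap := Num.min (2^-1) (Num.min (P0 / 2) (Num.min k3 k4)) in
  Pm + Lam * (Km + 1) + 1 <= N * kap ->
  exists2 c : R, 0 < c & forall o, ogood o -> c * osize o <= lyap o o.
Proof.
move=> kap HN.
have IL : I0L L L by rewrite /I0L/= in_itv/= lexx ltW.
have PL0 : P0 <= P L by exact: P0P.
have Pm0 : 0 < Pm by rewrite (lt_le_trans P0_gt0)// (le_trans PL0)// (le_trans (ler_norm _))// PPm.
have Km0 : 0 < Km by rewrite mulr_gt0// addr_gt0// exprn_gt0.
have k1 : kap <= 2^-1 by rewrite ge_min lexx.
have k2 : kap <= P0 / 2 by rewrite !ge_min lexx orbT.
have k3' : kap <= k3 by rewrite !ge_min lexx !orbT.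
have k4' : kap <= k4 by rewrite !ge_min lexx !orbT.
exists (Num.min sg 1); first by rewrite lt_min sg_gt0/=.
move=> o go; rewrite lyap_diag /osize.
have c1 := cross_bound go; have /andP[c2 _] := Pq_bounds go; have c3 := momentum_sq go.
have X0 := ip_ge0 L (op o); have Q0 := ip_ge0 L (oq o); have S0 := ip_ge0 L (ow o).
have s1 : Num.min sg 1 <= sg by rewrite ge_min lexx.
have s2 : Num.min sg 1 <= 1 by rewrite ge_min lexx orbT.
have s0 : 0 <= ((ou o - ov o) / b) ^+ 2 by rewrite sqr_ge0.
move: (ip L (fun x => m x * P x * op o x) (oq o)) c1 => cr c1.
have {c1} c1 : - 2 * cr <= Pm * (ip L (op o) (op o) + ip L (oq o) (oq o)).
  apply: le_trans c1; rewrite mulNr -mulrN ler_pM2l// -normrN; exact: ler_norm.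
move: (momentum o) c3 => M c3.
move: (ip L (fun x => P x * oq o x) (oq o)) c2 => Qp c2.
move: (ip L (op o) (op o)) (ip L (oq o) (oq o)) (ip L (ow o) (ow o)) X0 Q0 S0 c1 c2 c3 => X Q S X0 Q0 S0 c1 c2 c3.
move: (((ou o - ov o) / b) ^+ 2) s0 => w0 s0.
move: (oy o) (ou o) (ov o) c3 => y u v c3.
by apply: (lyap_lower_arith (Km := Km) (Pm := Pm) (P0 := P0) (kap := kap)) => //; exact: ltW.
Qed.

End lyapunov_form.

(** The left side is the derivative of the functional: energy, multiplier term [D2], momentum term,
    and the term in w(0)^2 + |w'|^2. Here [g] is v_t(0), [p0] is p(0), [r0] is P(0) q(0), [W] is the
    integral of w' q. The constants are chosen in the order [sg], [Lam], [N]: [sg] spends only half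
    of the dissipation of q^2, [Lam] then dominates every u^2 term, and [N], on which the others do
    not depend, absorbs what remains at 0. *)
Lemma diss_arith {R : realType} (a b al be Pz c5 Km sg Lam N M p0 r0 g u v W D2 X Q S Y : R) :
  0 < a -> 0 < b -> 0 < al -> 0 < be -> 0 < Pz -> 0 < c5 -> 0 < Km ->
  0 <= X -> 0 <= Q -> 0 <= S -> 0 <= Y ->
  p0 = g + b * v -> r0 = al * (g + a * v) + be * u ->
  sg = c5 * b / 2 -> Lam = 2 * (be ^+ 2 + sg / b + 1) / be ->
  2 * (1 + b / a) * (Pz / 2 + Lam ^+ 2 * Km / (2 * c5)) +
    2 * (1 + a / b) * (al ^+ 2 + Lam * al ^+ 2 / (2 * be)) + 1 <= N * al ->
  M ^+ 2 <= Km * (X + Y) ->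
  2 * W <= b * S + b^-1 * Q ->
  D2 <= (Pz * p0 ^+ 2 + r0 ^+ 2) / 2 - c5 * (X + Q + Y) ->
  - (N * al) * (g ^+ 2 + a * b * v ^+ 2) + D2 + Lam * (M * p0 - r0 * u) +
    sg * (2 * ((u - v) / b * v) + 2 * W - 2 * b * S) <=
  - (c5 / 2 * (X + Q + Y) + sg * b * S + u ^+ 2 + a * b * v ^+ 2).
Proof.
move=> a0 b0 al0 be0 Pz0 c50 Km0 X0 Q0 S0 Y0 p0E r0E sgE LamE HN HM HW HD.
have sg0 : 0 < sg by rewrite sgE divr_gt0// mulr_gt0.
have Lam0 : 0 < Lam.
  by rewrite LamE divr_gt0// mulr_gt0// addr_gt0// addr_gt0 ?divr_gt0// exprn_gt0.
pose G := g + a * v; pose T := g ^+ 2 + a * b * v ^+ 2.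
have T0 : 0 <= T by rewrite addr_ge0 ?sqr_ge0// mulr_ge0 ?sqr_ge0// mulr_ge0// ltW.
have W1 : sg * (2 * W - 2 * b * S) <= - (sg * b * S) + c5 / 2 * Q.
  have -> : c5 / 2 * Q = sg * (b^-1 * Q) by rewrite sgE; field; rewrite gt_eqF.
  rewrite -subr_ge0.
  have -> : - (sg * b * S) + sg * (b^-1 * Q) - sg * (2 * W - 2 * b * S) =
     sg * (b * S + b^-1 * Q - 2 * W) by ring.
  by apply: mulr_ge0; [exact: ltW|rewrite subr_ge0].
have W2 : sg * (2 * ((u - v) / b * v)) <= sg / b * u ^+ 2.
  have -> : sg * (2 * ((u - v) / b * v)) = sg / b * (2 * ((u - v) * v)) by ring.
  rewrite ler_pM2l ?divr_gt0//.
  have := sqr_ge0 (u - v); have := sqr_ge0 v; clear; nra.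
(* Young's inequality weighted so that M^2 spends half of the dissipation of X + Y and the rest
   falls on p0^2. *)
have W3 : Lam * (M * p0) <= c5 / 2 * (X + Y) + Lam ^+ 2 * Km / (2 * c5) * p0 ^+ 2.
  have h : c5 / (2 * Km) * M ^+ 2 <= c5 / 2 * (X + Y).
    have -> : c5 / 2 * (X + Y) = c5 / (2 * Km) * (Km * (X + Y)).
      by field; rewrite gt_eqF.
    by rewrite ler_pM2l// divr_gt0// mulr_gt0.
  apply: le_trans (lerD h (lexx _)).
  rewrite -subr_ge0.
  have -> : c5 / (2 * Km) * M ^+ 2 + Lam ^+ 2 * Km / (2 * c5) * p0 ^+ 2 - Lam * (M * p0)
    = c5 / (2 * Km) * (M - Lam * Km / c5 * p0) ^+ 2.
    by field; rewrite !gt_eqF.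
  by rewrite mulr_ge0 ?sqr_ge0// divr_ge0 ?mulr_ge0// ltW.
have W4 : r0 ^+ 2 / 2 <= al ^+ 2 * G ^+ 2 + be ^+ 2 * u ^+ 2.
  have := sqr_ge0 (al * G - be * u); rewrite r0E -/G; move: G => G'; clear; nra.
have W5 : - (Lam * (r0 * u)) <= - (be ^+ 2 + sg / b + 1) * u ^+ 2 +
    Lam * al ^+ 2 / (2 * be) * G ^+ 2.
  rewrite -subr_ge0.
  have e : be ^+ 2 + sg / b + 1 = Lam * be / 2 by rewrite LamE; field; rewrite !gt_eqF.
  rewrite e.
  have -> : - (Lam * be / 2) * u ^+ 2 + Lam * al ^+ 2 / (2 * be) * G ^+ 2 - - (Lam * (r0 * u))
    = Lam / (2 * be) * (al * G + be * u) ^+ 2.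
    by rewrite r0E -/G; field; rewrite gt_eqF.
  by rewrite mulr_ge0 ?sqr_ge0// divr_ge0 ?mulr_ge0// ltW.
(* Both p(0) = g + b v and G = g + a v are controlled by the form T dissipated by the energy. *)
have W6 : p0 ^+ 2 <= 2 * (1 + b / a) * T.
  rewrite -subr_ge0.
  have -> : 2 * (1 + b / a) * T - p0 ^+ 2 =
     (g - b * v) ^+ 2 + 2 * (b / a) * g ^+ 2 + 2 * (a * b) * v ^+ 2.
    by rewrite p0E /T; field; rewrite gt_eqF.
  by rewrite !addr_ge0 ?sqr_ge0// mulr_ge0 ?sqr_ge0// mulr_ge0// ?divr_ge0 ?mulr_ge0// ltW.
have W7 : G ^+ 2 <= 2 * (1 + a / b) * T.
  rewrite -subr_ge0.
  have -> : 2 * (1 + a / b) * T - G ^+ 2 =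
     (g - a * v) ^+ 2 + 2 * (a / b) * g ^+ 2 + 2 * (a * b) * v ^+ 2.
    by rewrite /G /T; field; rewrite gt_eqF.
  by rewrite !addr_ge0 ?sqr_ge0// mulr_ge0 ?sqr_ge0// mulr_ge0// ?divr_ge0 ?mulr_ge0// ltW.
set K1 := Pz / 2 + Lam ^+ 2 * Km / (2 * c5) in HN.
set K2 := al ^+ 2 + Lam * al ^+ 2 / (2 * be) in HN.
have K10 : 0 <= K1.
  by rewrite addr_ge0 ?divr_ge0 ?mulr_ge0 ?sqr_ge0// ltW.
have K20 : 0 <= K2.
  by rewrite addr_ge0 ?sqr_ge0// divr_ge0 ?mulr_ge0 ?sqr_ge0// ltW.
have V1 := ler_wpM2l K10 W6; have V2 := ler_wpM2l K20 W7.
have V3 := ler_wpM2r T0 HN.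
have V4 : a * b * v ^+ 2 <= T by rewrite lerDr sqr_ge0.
rewrite -/T.
have V5 : Pz * p0 ^+ 2 / 2 + Lam ^+ 2 * Km / (2 * c5) * p0 ^+ 2 = K1 * p0 ^+ 2.
  by rewrite /K1; ring.
have V6 : al ^+ 2 * G ^+ 2 + Lam * al ^+ 2 / (2 * be) * G ^+ 2 = K2 * G ^+ 2.
  by rewrite /K2; ring.
have V7 : N * al * T >= K1 * p0 ^+ 2 + K2 * G ^+ 2 + a * b * v ^+ 2.
  apply: le_trans V3.
  have -> : (2 * (1 + b / a) * K1 + 2 * (1 + a / b) * K2 + 1) * T =
     K1 * (2 * (1 + b / a) * T) + K2 * (2 * (1 + a / b) * T) + T by ring.
  by rewrite !lerD.
have -> : - (N * al) * T = - (N * al * T) by ring.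
clearbody T G K1 K2.
move: HD W1 W2 W3 W4 W5 V5 V6 V7.
clear; lra.
Qed.

(* [o] is read off a state in the domain of the generator and [o'] off its image:
   (p, r) solves p_t = r', r_t = P p' with the two dynamic boundary conditions. *)
Definition odot {R : realType} (L : R) (P : R -> R) (a b th3 th4 : R) (o o' : obs R) :=
  exists p' r r' g, [/\ prim L (op o) p' /\ L2 L p', prim L r r' /\ L2 L r',
    (forall x, I0L L x -> r x = P x * oq o x), oy o = op o L &
    [/\ op o 0 = g + b * ov o,
        oq o 0 = b / th4 * (g + a * ov o) - th3 / th4 * ou o &
        o' = Obs r' p' (fun x => oq o x + - b * ow o x) (- oq o L) (op o 0) g]].

(** * Dissipation along the generator *)

Section dissipation.
Context {R : realType} (L : R).
Hypothesis L_gt0 : 0 < L.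
Variables (P P1 P2 : R -> R) (P0 a b th3 th4 : R).
Hypothesis pP : prim L P P1.
Hypothesis pP1 : prim L P1 P2.
Hypothesis LP2 : L2 L P2.
Hypothesis P0_gt0 : 0 < P0.
Hypothesis P0P : forall x, I0L L x -> P0 <= P x.
Hypothesis a_gt0 : 0 < a.
Hypothesis b_gt0 : 0 < b.
Hypothesis th3_lt0 : th3 < 0.
Hypothesis th4_gt0 : 0 < th4.

(** With these weights the boundary condition at 0 reads P(0) q(0) = al (g + a v(0)) + be u(0),
    where g = v_t(0). *)
Let al := P 0 * b / th4.
Let be := - (P 0 * th3 / th4).

Lemma ip_flux n n1 p p' : prim L n n1 -> L2 L n1 -> prim L p p' -> L2 L p' ->
  2 * ip L (fun x => n x * p x) p' =
  n L * p L ^+ 2 - n 0 * p 0 ^+ 2 - ip L (fun x => n1 x * p x) p.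
Proof.
move=> pn Ln1 pp Lp'.
have Lp := prim_L2 L_gt0 pp Lp'.
have bn := prim_bmeas L_gt0 pn (L2_intg L_gt0 Ln1).
have bp := prim_bmeas L_gt0 pp (L2_intg L_gt0 Lp').
have := ip_parts L_gt0 (prim_mul L_gt0 pp pp Lp' Lp') pn
  (L2_prim_mul L_gt0 pp pp Lp' Lp') Ln1.
have Lnp : L2 L (fun x => n x * p x) by exact: L2_bmeasM.
have -> : ip L (fun x => p' x * p x + p x * p' x) n =
   ip L (fun x => n x * p x + 1 * (n x * p x)) p'.
  by apply: eq_ip => x _; ring.
rewrite ip_linl//.
have -> : ip L (fun x => p x * p x) n1 = ip L (fun x => n1 x * p x) p.
  by apply: eq_ip => x _; ring.
move: (ip L (fun x => n x * p x) p') (ip L (fun x => n1 x * p x) p) => A B H.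
have -> : 2 * A = n L * p L ^+ 2 - n 0 * p 0 ^+ 2 - B by move: H; rewrite !expr2; lra.
done.
Qed.

(** Everything later uses the form only through these properties; in the last one B o o' is half of
    the derivative along the flow. *)
Lemma lyap_exists : exists (B : obs R -> obs R -> R) (c C : R),
  [/\ 0 < c /\ 0 < C,
    (forall o o', B o o' = B o' o),
    (forall k o o' e, ogood L o -> ogood L o' -> ogood L e ->
       B (olin k o o') e = B o e + k * B o' e),
    (forall o, ogood L o -> c * osize L o <= B o o <= C * osize L o) &
    (forall o o', ogood L o -> odot L P a b th3 th4 o o' -> B o o' <= - c * osize L o)].
Proof.
have [m [m1 [c0 [c0_gt0 [pm Lm1] m_0 m_L Hm]]]] := multiplier L_gt0 pP pP1 LP2 P0_gt0 P0P.
have IL : I0L L L by rewrite /I0L/= in_itv/= lexx ltW.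
have I0 : I0L L 0 by rewrite /I0L/= in_itv/= lexx ltW.
have PL0 : 0 < P L by exact: lt_le_trans (P0P IL).
have Pz0 : 0 < P 0 by exact: lt_le_trans (P0P I0).
have LP1 := prim_L2 L_gt0 pP1 LP2.
have bP := prim_bmeas L_gt0 pP (L2_intg L_gt0 LP1).
have bm := prim_bmeas L_gt0 pm (L2_intg L_gt0 Lm1).
have [Pm PPm] := bP.2.
have mm1 x : I0L L x -> `|m x| <= 1 by move=> /Hm[].
have al0 : 0 < al by rewrite divr_gt0// mulr_gt0.
have be0 : 0 < be by rewrite oppr_gt0 pmulr_llt0 ?invr_gt0// pmulr_rlt0.
have Pm0 : 0 < Pm.
  by rewrite (lt_le_trans PL0)// (le_trans (ler_norm _))// PPm.
have Km0 : 0 < Km L Pm by rewrite mulr_gt0// addr_gt0// exprn_gt0.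
(* The rate is c0/2 for p^2 and q^2 but c0/2 P(L) >= c0/2 P0 for y^2, whence the minimum. *)
pose c5 := c0 / 2 * Num.min 1 P0.
have c50 : 0 < c5 by rewrite mulr_gt0 ?divr_gt0// lt_min ltr01 P0_gt0.
have c02 : 0 <= c0 / 2 by rewrite ltW// divr_gt0.
have c5a : c5 <= c0 / 2.
  by rewrite /c5 -[leRHS]mulr1 ler_wpM2l// ge_min lexx.
have c5b : c5 <= c0 / 2 * P0.
  by rewrite /c5 ler_wpM2l// ge_min lexx orbT.
pose sg := c5 * b / 2.
have sg0 : 0 < sg by rewrite divr_gt0// mulr_gt0.
pose Lam := 2 * (be ^+ 2 + sg / b + 1) / be.
have be2 : 0 < be ^+ 2 by rewrite exprn_gt0.
have sgb : 0 < sg / b by rewrite divr_gt0.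
have Lam0 : 0 < Lam by rewrite divr_gt0// mulr_gt0// !addr_gt0.
(* These values make 2 k3 u(0) p(0) and 2 k4 v(0) v_t(0) cancel the cross terms of -P(0) p(0)
   q(0). *)
pose k3 := be / 2; pose k4 := al * (a + b) / 2.
have k30 : 0 < k3 by rewrite divr_gt0.
have k40 : 0 < k4 by rewrite divr_gt0// mulr_gt0// addr_gt0.
pose kap := Num.min (2^-1) (Num.min (P0 / 2) (Num.min k3 k4)).
have kap0 : 0 < kap by rewrite !lt_min invr_gt0 ltr0n divr_gt0//= k30.
pose Z1 := 2 * (1 + b / a) * (P 0 / 2 + Lam ^+ 2 * Km L Pm / (2 * c5)) +
    2 * (1 + a / b) * (al ^+ 2 + Lam * al ^+ 2 / (2 * be)) + 1.
pose Z2 := Pm + Lam * (Km L Pm + 1) + 1.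
have Z20 : 0 < Z2 by rewrite !addr_gt0// mulr_gt0// addr_gt0.
have Z10 : 0 < Z1.
  have z1 : 0 < 1 + b / a by rewrite addr_gt0// divr_gt0.
  have z2 : 0 < 1 + a / b by rewrite addr_gt0// divr_gt0.
  have z3 : 0 < P 0 / 2 by rewrite divr_gt0.
  have z4 : 0 < Lam ^+ 2 * Km L Pm / (2 * c5).
    by apply: divr_gt0; [apply: mulr_gt0 => //; exact: exprn_gt0|exact: mulr_gt0].
  have z5 : 0 < al ^+ 2 by rewrite exprn_gt0.
  have z6 : 0 < Lam * al ^+ 2 / (2 * be) by apply: divr_gt0; exact: mulr_gt0.
  by rewrite /Z1 addr_gt0// addr_gt0// mulr_gt0 ?addr_gt0// mulr_gt0.
(* The first summand secures dissipation, the second coercivity. *)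
pose N := Z1 / al + Z2 / kap.
have N1 : Z1 <= N * al.
  by rewrite mulrDl divfK ?gt_eqF// lerDl ltW// mulr_gt0// divr_gt0.
have N2 : Z2 <= N * kap.
  by rewrite mulrDl divfK ?gt_eqF// lerDr ltW// mulr_gt0// divr_gt0.
have N0 : 0 < N by rewrite addr_gt0// divr_gt0.
have [C C0 HC] := lyap_upper L_gt0 bP bm P0_gt0 P0P PPm mm1 b_gt0 k30 k40 N0 (ltW Lam0) sg0.
have [c c_gt0 Hc] := lyap_lower L_gt0 b bP bm P0_gt0 P0P PPm mm1 N0 (ltW Lam0) sg0 N2.
pose d := Num.min (c5 / 2) (Num.min (sg * b) (Num.min 1 (a * b))).
have d0 : 0 < d by rewrite !lt_min ltr01 divr_gt0//= (mulr_gt0 sg0 b_gt0) (mulr_gt0 a_gt0 b_gt0).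
exists (lyap L P m b k3 k4 N Lam sg), (Num.min c (d / 2)), C; split.
- by rewrite lt_min c_gt0 C0 divr_gt0.
- by move=> o o'; exact: lyapC.
- by move=> *; exact: lyap_linl.
- move=> o go; rewrite HC// andbT (le_trans _ (Hc o go))// ler_wpM2r ?osize_ge0//.
  by rewrite ge_min lexx.
move=> o o' go [p' [r [r' [g [[pp Lp'] [pr Lr'] rE yE [p0E q0E ->]]]]]].
have [Lp Lq Lw] := go.
have Lr := prim_L2 L_gt0 pr Lr'.
have L1 : L2 L (fun=> 1) by apply: bmeas_L2 => //; exact: bmeas_cst.
have bmP : bmeas L (fun x => m x * P x) by exact: bmeasM.
have LPq := L2_bmeasM bP Lq.
have rL := rE L IL; have r0 := rE 0 I0.
(* Energy balance: the bulk terms reduce to the fluxes at the two ends. *)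
have F1 : ip L (op o) r' + ip L (fun x => P x * oq o x) p' =
   op o L * r L - op o 0 * r 0.
  have := ip_parts L_gt0 pp pr Lp' Lr'; rewrite addrC => <-; congr (_ + _).
  by apply: eq_ip => x Ix; rewrite rE// mulrC.
have F2 : ip L (fun=> 1) r' = r L - r 0.
  have := pr L; rewrite lexx ltW// => /(_ isT) ->; rewrite addrAC subrr add0r.
  by apply: eq_Rintegral => x _; rewrite mul1r.
have pn := prim_mul L_gt0 pm pP Lm1 LP1.
have Ln1 := L2_prim_mul L_gt0 pm pP Lm1 LP1.
have F3 := ip_flux pn Ln1 pp Lp'.
have F4 := ip_flux pm Lm1 pr Lr'.
have F4' : ip L (fun x => m x * P x * oq o x) r' = ip L (fun x => m x * r x) r'.
  by apply: eq_ip => x Ix; rewrite rE// mulrA.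
have G3 : c0 * ip L (op o) (op o) <=
    ip L (fun x => (m1 x * P x + m x * P1 x) * op o x) (op o).
  have Lnp : L2 L (fun x => (m1 x * P x + m x * P1 x) * op o x).
    have -> : (fun x => (m1 x * P x + m x * P1 x) * op o x) =
              (fun x => op o x * (m1 x * P x + m x * P1 x)).
      by apply/funext => x; rewrite mulrC.
    by apply: L2_bmeasM Ln1; exact: prim_bmeas pp (L2_intg L_gt0 Lp').
  rewrite -ip_Zl//; apply: le_ip => //; first exact: L2Z.
  move=> x Ix; rewrite -!mulrA -expr2; apply: ler_wpM2r; first exact: sqr_ge0.
  by have [_ _] := Hm x Ix.
have G4 : c0 * ip L (oq o) (oq o) <= ip L (fun x => m1 x * r x) r.
  have Lmr : L2 L (fun x => m1 x * r x).
    have -> : (fun x => m1 x * r x) = (fun x => r x * m1 x).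
      by apply/funext => x; rewrite mulrC.
    by apply: L2_bmeasM Lm1; exact: prim_bmeas pr (L2_intg L_gt0 Lr').
  rewrite -ip_Zl//; apply: le_ip => //; first exact: L2Z.
  move=> x Ix; rewrite rE//.
  have -> : m1 x * (P x * oq o x) * (P x * oq o x) = m1 x * P x ^+ 2 * oq o x ^+ 2 by ring.
  rewrite -mulrA -expr2; apply: ler_wpM2r; first exact: sqr_ge0.
  by have [_] := Hm x Ix.
have F5 := momentum_sq L_gt0 PPm go.
have F6 : momentum L P (Obs r' p' (fun x => oq o x + - b * ow o x) (- oq o L) (op o 0) g) = - r 0.
  by rewrite /momentum/= F2 rL; ring.
have F7 : ip L (ow o) (fun x => oq o x + - b * ow o x) =
  ip L (ow o) (oq o) - b * ip L (ow o) (ow o) by rewrite ip_linr// mulNr.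
have W := ip_young b_gt0 Lw Lq.
rewrite /lyap F6 /= F7 F4'.
have vE : (op o 0 - g) / b = ov o by rewrite p0E; field; rewrite gt_eqF.
rewrite vE.
have r0E : r 0 = al * (g + a * ov o) + be * ou o.
  by rewrite r0 q0E /al /be; field; rewrite gt_eqF.
have X0 := ip_ge0 L (op o); have Q0 := ip_ge0 L (oq o); have S0 := ip_ge0 L (ow o).
have y0 := sqr_ge0 (oy o).
pose D2 := ip L (fun x => m x * P x * op o x) p' + ip L (fun x => m x * r x) r'.
have HD : D2 <= (P 0 * op o 0 ^+ 2 + r 0 ^+ 2) / 2 -
    c5 * (ip L (op o) (op o) + ip L (oq o) (oq o) + oy o ^+ 2).
  have E : 2 * D2 = m L * (P L * oy o ^+ 2) + m L * r L ^+ 2 + P 0 * op o 0 ^+ 2 + r 0 ^+ 2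
    - ip L (fun x => (m1 x * P x + m x * P1 x) * op o x) (op o) - ip L (fun x => m1 x * r x) r.
    by rewrite /D2 mulrDr F3 F4 m_0 yE; ring.
  have E1 : m L * (P L * oy o ^+ 2) <= - (2 * c5) * oy o ^+ 2.
    rewrite mulrA; apply: ler_wpM2r => //.
    have : m L * P L <= - c0 * P L by rewrite ler_wpM2r// ltW.
    have : c0 * P0 <= c0 * P L by rewrite ler_wpM2l ?P0P// ltW.
    by move: c5b; lra.
  have E2 : m L * r L ^+ 2 <= 0.
    by rewrite mulr_le0_ge0 ?sqr_ge0// (le_trans m_L)// oppr_le0 ltW.
  have E3 := ler_wpM2r X0 c5a; have E4 := ler_wpM2r Q0 c5a.
  by move: E E1 E2 E3 E4 G3 G4; lra.
have := diss_arith a_gt0 b_gt0 al0 be0 Pz0 c50 Km0 X0 Q0 S0 y0 p0E r0E erefl erefl N1 F5 W HD.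
set T := (- (N * al) * _ + _ + _ + _) => HT.
(* [T] is the full derivative and the polarised form is half of it: the flux at L cancels against
   the y term, and the cross terms at 0 against those of k3 and k4. *)
have -> : N * (ip L (op o) r' / 2 + ip L (fun x => P x * oq o x) p' / 2 +
   P L * oy o * - oq o L / 2 + k3 * ou o * op o 0 + k4 * ov o * g) +
  (ip L (fun x => m x * P x * op o x) p' + ip L (fun x => m x * r x) r') / 2 +
  Lam * (momentum L P o * op o 0 + - r 0 * ou o) / 2 +
  sg * ((ou o - ov o) / b * ov o + (ip L (ow o) (oq o) - b * ip L (ow o) (ow o))) = T / 2.
  have -> : ip L (op o) r' = op o L * r L - op o 0 * r 0 - ip L (fun x => P x * oq o x) p'.
    by rewrite -F1; ring.
  rewrite /T /D2 yE rL r0E p0E /k3 /k4 /Lam /sg.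
  by move: (ip _ _ _) (ip _ _ _) (ip _ _ _) (ip _ _ _) (ip _ _ _) => i1 i2 i3 i4 i5; field; rewrite !gt_eqF.
have d1 : d <= c5 / 2 by rewrite ge_min lexx.
have d2 : d <= sg * b by rewrite !ge_min lexx orbT.
have d3 : d <= 1 by rewrite !ge_min lexx !orbT.
have d4 : d <= a * b by rewrite !ge_min lexx !orbT.
have XQY : 0 <= ip L (op o) (op o) + ip L (oq o) (oq o) + oy o ^+ 2 by rewrite !addr_ge0.
have M1 := ler_wpM2r XQY d1; have M2 := ler_wpM2r S0 d2.
have M3 := ler_wpM2r (sqr_ge0 (ou o)) d3; have M4 := ler_wpM2r (sqr_ge0 (ov o)) d4.
have M5 : Num.min c (d / 2) * osize L o <= d / 2 * osize L o.
  by rewrite ler_wpM2r ?osize_ge0// ge_min lexx orbT.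
move: M5 HT M1 M2 M3 M4; rewrite /osize /sg; clearbody T d.
move: (ip L (op o) (op o)) (ip L (oq o) (oq o)) (ip L (ow o) (ow o)) => X Q S.
move: (oy o ^+ 2) (ou o ^+ 2) (ov o ^+ 2) => Y U V.
lra.
Qed.

End dissipation.

(** * Real states *)

Lemma le_summands {R : realType} (x1 x2 x3 x4 x5 x6 x7 : R) :
  0 <= x1 -> 0 <= x2 -> 0 <= x3 -> 0 <= x4 -> 0 <= x5 -> 0 <= x6 -> 0 <= x7 ->
  let n := x1 + (x2 + x3) + (x4 + x5) + x6 + x7 in
  [/\ x1 <= n, x2 <= n, x3 <= n & [/\ x4 <= n, x5 <= n, x6 <= n & x7 <= n]].
Proof. by move=> ? ? ? ? ? ? ? n; rewrite {}/n; split; [lra|lra|lra|split; lra]. Qed.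

Section real_states.
Context {R : realType} (L : R).
Hypothesis L_gt0 : 0 < L.
Implicit Types (f g w v : R -> R).

Local Notation mu := (@lebesgue_measure R).
Local Notation prim := (prim L).
Local Notation L2 := (L2 L).
Local Notation ip := (ip L).
Local Notation I := (I0L L).

Let I0 : I 0. Proof. by rewrite /I0L/= in_itv/= lexx ltW. Qed.
Let IL : I L. Proof. by rewrite /I0L/= in_itv/= lexx ltW. Qed.

Definition jet w v w1 w2 v1 :=
  [/\ prim w w1, prim w1 w2, L2 w2, prim v v1 & L2 v1].

Definition rnorm2 w v := Hnorm2 L 2 w + Hnorm2 L 1 v + v L ^+ 2 + v 0 ^+ 2.

Lemma rnorm2_jet w v w1 w2 v1 : jet w v w1 w2 v1 ->
  rnorm2 w v = ip w w + (ip w1 w1 + ip w2 w2) + (ip v v + ip v1 v1) + v L ^+ 2 + v 0 ^+ 2.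
Proof.
by move=> [p1 p2 Lw2 p3 Lv1]; rewrite /rnorm2 (Hnorm2_2 L_gt0 p1 p2 Lw2) (Hnorm2_1 L_gt0 p3 Lv1).
Qed.

Definition rspace w v := Hs L 2 w /\ Hs L 1 v.

Lemma rspaceP w v : rspace w v <-> exists w1 w2 v1, jet w v w1 w2 v1.
Proof.
split=> [[[_ [w1 [p1 [_ [w2 [p2 Lw2]]]]]] [_ [v1 [p3 Lv1]]]]|].
  by exists w1, w2, v1.
move=> [w1 [w2 [v1 [p1 p2 Lw2 p3 Lv1]]]].
have Lw1 := prim_L2 L_gt0 p2 Lw2; have Lw := prim_L2 L_gt0 p1 Lw1.
have Lv := prim_L2 L_gt0 p3 Lv1.
split; first by split => //; exists w1; split => //; split => //; exists w2.
by split => //; exists v1.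
Qed.

Lemma jet_lin c w v w1 w2 v1 w' v' w1' w2' v1' :
  jet w v w1 w2 v1 -> jet w' v' w1' w2' v1' ->
  jet (fun x => w x + c * w' x) (fun x => v x + c * v' x)
      (fun x => w1 x + c * w1' x) (fun x => w2 x + c * w2' x)
      (fun x => v1 x + c * v1' x).
Proof.
move=> [p1 p2 Lw2 p3 Lv1] [p1' p2' Lw2' p3' Lv1'].
have Lw1 := prim_L2 L_gt0 p2 Lw2; have Lw1' := prim_L2 L_gt0 p2' Lw2'.
by split; [apply: prim_lin|apply: prim_lin|apply: L2_lin|apply: prim_lin|apply: L2_lin] => //;
  exact: L2_intg.
Qed.

Lemma jet0 : jet (fun=> 0) (fun=> 0) (fun=> 0) (fun=> 0) (fun=> 0).
Proof.
have L0 : L2 (fun=> 0) by apply: bmeas_L2 => //; exact: bmeas_cst.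
by split => //; exact: prim_cst.
Qed.

Lemma rnorm2_ge0 w v : rspace w v -> 0 <= rnorm2 w v.
Proof.
move=> /rspaceP[w1 [w2 [v1 j]]]; rewrite (rnorm2_jet j).
by rewrite !addr_ge0 ?ip_ge0 ?sqr_ge0.
Qed.

Lemma rnorm2_scale c w v : rspace w v ->
  rnorm2 (fun x => c * w x) (fun x => c * v x) = c ^+ 2 * rnorm2 w v.
Proof.
move=> /rspaceP[w1 [w2 [v1 j]]]; rewrite (rnorm2_jet j).
have := jet_lin c jet0 j.
have e f : (fun x => 0 + c * f x) = (fun x => c * f x).
  by apply/funext => x; rewrite add0r.
rewrite !e => j'; rewrite (rnorm2_jet j').
case: j => p1 p2 Lw2 p3 Lv1.
have Lw1 := prim_L2 L_gt0 p2 Lw2; have Lw := prim_L2 L_gt0 p1 Lw1.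
have Lv := prim_L2 L_gt0 p3 Lv1.
have E f : L2 f -> ip (fun x => c * f x) (fun x => c * f x) = c ^+ 2 * ip f f.
  move=> Lf; rewrite ip_Zl//; last exact: L2Z.
  by rewrite ip_Zr//; ring.
by rewrite !E//; ring.
Qed.

Lemma rnorm2_add w v w' v' : rspace w v -> rspace w' v' ->
  rnorm2 (fun x => w x + 1 * w' x) (fun x => v x + 1 * v' x) <= 2 * rnorm2 w v + 2 * rnorm2 w' v'.
Proof.
move=> /rspaceP[w1 [w2 [v1 j]]] /rspaceP[w1' [w2' [v1' j']]].
rewrite (rnorm2_jet j) (rnorm2_jet j') (rnorm2_jet (jet_lin 1 j j')).
case: j => p1 p2 Lw2 p3 Lv1; case: j' => p1' p2' Lw2' p3' Lv1'.
have Lw1 := prim_L2 L_gt0 p2 Lw2; have Lw := prim_L2 L_gt0 p1 Lw1.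
have Lv := prim_L2 L_gt0 p3 Lv1.
have Lw1'' := prim_L2 L_gt0 p2' Lw2'; have Lw' := prim_L2 L_gt0 p1' Lw1''.
have Lv' := prim_L2 L_gt0 p3' Lv1'.
have E f g : L2 f -> L2 g -> ip (fun x => f x + 1 * g x) (fun x => f x + 1 * g x)
    <= 2 * ip f f + 2 * ip g g.
  move=> Lf Lg; rewrite ip_linl// ?ip_linr//; last exact: L2_lin.
  by have := ip_young (@ltr01 R) Lf Lg; rewrite (ipC L g f) invr1; lra.
have S (x y : R) : (x + 1 * y) ^+ 2 <= 2 * x ^+ 2 + 2 * y ^+ 2.
  by have := sqr_ge0 (x - y); nra.
have := E _ _ Lw Lw'; have := E _ _ Lw1 Lw1''; have := E _ _ Lw2 Lw2'.
have := E _ _ Lv Lv'; have := E _ _ Lv1 Lv1'; have := S (v L) (v' L); have := S (v 0) (v' 0).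
lra.
Qed.

Lemma rspace_lin c w v w' v' : rspace w v -> rspace w' v' ->
  rspace (fun x => w x + c * w' x) (fun x => v x + c * v' x).
Proof.
move=> /rspaceP[w1 [w2 [v1 j]]] /rspaceP[w1' [w2' [v1' j']]]; apply/rspaceP.
by do 3 eexists; exact: jet_lin j j'.
Qed.

Lemma prim_mk g c : L2 g -> exists2 f, prim f g & f 0 = c.
Proof.
move=> Lg; exists (fun x => c + \int[mu]_(t in `[0, x]) g t).
  by move=> x _; rewrite set_itv1 Rintegral_set1 addr0.
by rewrite set_itv1 Rintegral_set1 addr0.
Qed.

Variables (P P1 P2 : R -> R) (P0 a b th1 th2 th3 th4 : R).
Hypothesis pP : prim P P1.
Hypothesis pP1 : prim P1 P2.
Hypothesis LP2 : L2 P2.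
Hypothesis P0_gt0 : 0 < P0.
Hypothesis P0P : forall x, 0 <= x <= L -> P0 <= P x.
Hypothesis b_gt0 : 0 < b.
Hypothesis th4_gt0 : 0 < th4.
Hypothesis th1E : th1 = th3 / b - a.
Hypothesis th2E : th2 = th4 / b.

Let LP1 : L2 P1. Proof. exact: prim_L2 pP1 LP2. Qed.
Let bP : bmeas L P. Proof. exact: prim_bmeas pP (L2_intg L_gt0 LP1). Qed.
Let bP1 : bmeas L P1. Proof. exact: prim_bmeas pP1 (L2_intg L_gt0 LP2). Qed.

Definition obsof w v w1 w2 v1 : obs R :=
  Obs (fun x => P1 x * w1 x + P x * w2 x + b * v x) (fun x => v1 x + b * w1 x)
      w1 (b * v L - w1 L) (v 0 + b * w 0) (v 0).

(** A relation rather than a function, because weak derivatives are determined only up to null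
    sets. *)
Definition isobs w v o := exists w1 w2 v1, jet w v w1 w2 v1 /\ o = obsof w v w1 w2 v1.

Lemma isobs_good w v o : isobs w v o -> ogood L o.
Proof.
move=> [w1 [w2 [v1 [[p1 p2 Lw2 p3 Lv1] ->]]]].
have Lw1 := prim_L2 L_gt0 p2 Lw2; have Lv := prim_L2 L_gt0 p3 Lv1.
split => //=; last by apply: L2_lin.
by apply: L2_lin => //; apply: L2_D; exact: L2_bmeasM.
Qed.

Lemma isobs_lin c w v w' v' o o' : isobs w v o -> isobs w' v' o' ->
  isobs (fun x => w x + c * w' x) (fun x => v x + c * v' x) (olin c o o').
Proof.
move=> [w1 [w2 [v1 [j ->]]]] [w1' [w2' [v1' [j' ->]]]].
do 3 eexists; split; first exact: jet_lin j j'.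
by rewrite /olin /obsof /=; congr Obs; try (apply/funext => x); ring.
Qed.

Lemma isobs_ex w v : rspace w v -> exists o, isobs w v o.
Proof. by move=> /rspaceP[w1 [w2 [v1 j]]]; exists (obsof w v w1 w2 v1), w1, w2, v1. Qed.

Lemma ip_sum2 f g c : L2 f -> L2 g ->
  ip (fun x => f x + c * g x) (fun x => f x + c * g x) <=
  2 * ip f f + 2 * c ^+ 2 * ip g g.
Proof.
move=> Lf Lg; have Lcg := L2Z c Lg.
have := ip_young (@ltr01 R) Lf Lcg; rewrite invr1 !(ip_Zl, ip_Zr)//.
rewrite ip_linl// ?ip_linr//; last exact: L2_lin.
by rewrite (ipC L g f); move: (ip f f) (ip g g) (ip f g) => x y z; lra.
Qed.

Lemma ip_bmeasM k (M : R) f : bmeas L k -> (forall x, I x -> `|k x| <= M) -> L2 f ->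
  ip (fun x => k x * f x) (fun x => k x * f x) <= M ^+ 2 * ip f f.
Proof.
move=> bk kM Lf; have Lkf := L2_bmeasM bk Lf.
rewrite -ip_Zl//; apply: le_ip => //; first exact: L2Z.
move=> x Ix; have -> : k x * f x * (k x * f x) = k x ^+ 2 * f x ^+ 2 by ring.
rewrite -mulrA -expr2; apply: ler_wpM2r; first exact: sqr_ge0.
rewrite -(real_normK (num_real (k x))) ler_pXn2r// ?nnegrE ?kM//.
by apply: le_trans (kM x Ix).
Qed.

(** The traces w'(L) and w(0) do not occur in the norm; [prim_trace] bounds them. *)
Lemma osize_le_rnorm2 : exists2 C : R, 0 < C & forall w v o, isobs w v o -> osize L o <= C * rnorm2 w v.
Proof.
have [KP HP] := bP.2; have [K1 H1] := bP1.2.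
pose LI := L^-1.
have LI0 : 0 < LI by rewrite invr_gt0.
pose k1 := K1 ^+ 2; pose k2 := KP ^+ 2; pose bb := b ^+ 2.
have k10 : 0 <= k1 by exact: sqr_ge0.
have k20 : 0 <= k2 by exact: sqr_ge0.
have bb0 : 0 <= bb by exact: sqr_ge0.
have bLI0 : 0 <= bb * LI by rewrite mulr_ge0// ltW.
have bL0 : 0 <= bb * L by rewrite mulr_ge0// ltW.
exists (4 * k1 + 4 * k2 + 6 * bb + 4 * LI + 4 * L + 4 * (bb * LI) + 4 * (bb * L) + 6).
  by move: LI0 L_gt0; lra.
move=> w v o [w1 [w2 [v1 [j ->]]]]; rewrite (rnorm2_jet j).
case: j => p1 p2 Lw2 p3 Lv1.
have Lw1 := prim_L2 L_gt0 p2 Lw2; have Lw := prim_L2 L_gt0 p1 Lw1.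
have Lv := prim_L2 L_gt0 p3 Lv1.
rewrite /osize /=.
have LA : L2 (fun x => P1 x * w1 x) by exact: L2_bmeasM.
have LB : L2 (fun x => P x * w2 x) by exact: L2_bmeasM.
have A1 := ip_bmeasM bP1 H1 Lw1; have A2 := ip_bmeasM bP HP Lw2.
have A3 := ip_sum2 1 LA LB.
have A3' : ip (fun x => P1 x * w1 x + P x * w2 x) (fun x => P1 x * w1 x + P x * w2 x) <=
   2 * (K1 ^+ 2 * ip w1 w1) + 2 * (KP ^+ 2 * ip w2 w2).
  have e : (fun x => P1 x * w1 x + 1 * (P x * w2 x)) = (fun x => P1 x * w1 x + P x * w2 x).
    by apply/funext => x; rewrite mul1r.
  by move: A3; rewrite e; lra.
have A4 := ip_sum2 b (L2_D LA LB) Lv.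
have A5 := ip_sum2 b Lv1 Lw1.
have A6 := prim_trace L_gt0 p2 Lw2 IL.
have A7 := prim_trace L_gt0 p1 Lw1 I0.
have A6' : w1 L ^+ 2 <= 2 * LI * ip w1 w1 + 2 * L * ip w2 w2.
  rewrite -(ler_pM2l L_gt0); apply: (le_trans A6).
  by rewrite le_eqVlt; apply/orP; left; apply/eqP; rewrite /LI; field; rewrite gt_eqF.
have A7' : w 0 ^+ 2 <= 2 * LI * ip w w + 2 * L * ip w1 w1.
  rewrite -(ler_pM2l L_gt0); apply: (le_trans A7).
  by rewrite le_eqVlt; apply/orP; left; apply/eqP; rewrite /LI; field; rewrite gt_eqF.
have A7b := ler_wpM2l bb0 A7'.
have A8 : (b * v L - w1 L) ^+ 2 <= 2 * bb * v L ^+ 2 + 2 * w1 L ^+ 2.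
  by have := sqr_ge0 (b * v L + w1 L); rewrite /bb; nra.
have A9 : (v 0 + b * w 0) ^+ 2 <= 2 * v 0 ^+ 2 + 2 * (bb * w 0 ^+ 2).
  by have := sqr_ge0 (v 0 - b * w 0); rewrite /bb; nra.
rewrite -/k1 -/k2 -/bb in A3' A4 A5.
have z1 := ip_ge0 L w; have z2 := ip_ge0 L w1; have z3 := ip_ge0 L w2.
have z4 := ip_ge0 L v; have z5 := ip_ge0 L v1.
have z6 := sqr_ge0 (v L); have z7 := sqr_ge0 (v 0).
move: A4 A5 A3' A6' A7b A8 A9 z1 z2 z3 z4 z5 z6 z7.
set n := ip w w + _ + _ + _ + _.
move=> A4 A5 A3' A6' A7b A8 A9 z1 z2 z3 z4 z5 z6 z7.
have [m1 m2 m3 [m4 m5 m6 m7]] := le_summands z1 z2 z3 z4 z5 z6 z7.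
rewrite -/n in m1 m2 m3 m4 m5 m6 m7.
have := ler_wpM2l k10 m2; have := ler_wpM2l k20 m3.
have := ler_wpM2l bb0 m4; have := ler_wpM2l bb0 m2; have := ler_wpM2l bb0 m6.
have := ler_wpM2l (ltW LI0) m2; have := ler_wpM2l (ltW L_gt0) m3.
have := ler_wpM2l bLI0 m1; have := ler_wpM2l bL0 m2.
clearbody n k1 k2 bb LI.
lra.
Qed.

(** The state is recovered from its observables: w from w(0) = (u(0) - v(0)) / b and w', then v' = q
    - b w', then v and v(L) from v(0) and v', and finally w'' = (p - b v - P' w') / P, where the
    lower bound on P enters. *)
Lemma rnorm2_le_osize : exists2 C : R, 0 < C & forall w v o, isobs w v o -> rnorm2 w v <= C * osize L o.
Proof.
have [KP HP] := bP.2; have [K1 H1] := bP1.2.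
pose bb := b ^+ 2; pose B2 := (b^-1) ^+ 2; pose k1 := K1 ^+ 2; pose Q0 := (P0 ^+ 2)^-1.
have k10 : 0 <= k1 by exact: sqr_ge0.
have bb0 : 0 <= bb by exact: sqr_ge0.
have B20 : 0 <= B2 by exact: sqr_ge0.
have L2_0 : 0 <= L ^+ 2 by exact: sqr_ge0.
have P20 : 0 < P0 ^+ 2 by rewrite exprn_gt0.
have Q00 : 0 < Q0 by rewrite invr_gt0.
pose cw := 8 * L * B2 + 2 * L ^+ 2.
pose cv1 := 2 + 2 * bb.
pose cv := 2 * L + 2 * L ^+ 2 * cv1.
pose cvL := 2 + 2 * L * cv1.
pose cw2 := Q0 * (4 * k1 + 4 + 4 * bb * cv).
have cw0 : 0 <= cw.
  apply: addr_ge0; last by rewrite mulr_ge0.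
  by rewrite mulr_ge0// mulr_ge0// ltW.
have cv10 : 0 <= cv1 by rewrite addr_ge0// mulr_ge0.
have cv0 : 0 <= cv.
  by apply: addr_ge0; [rewrite mulr_ge0// ltW|rewrite mulr_ge0// mulr_ge0].
have cvL0 : 0 <= cvL by apply: addr_ge0 => //; rewrite mulr_ge0// mulr_ge0// ltW.
have bcv0 : 0 <= 4 * bb * cv by rewrite mulr_ge0// mulr_ge0.
have cw20 : 0 <= cw2.
  by apply: mulr_ge0; [exact: ltW|rewrite !addr_ge0// mulr_ge0].
exists (cw + 1 + cw2 + cv + cv1 + cvL + 2); first by lra.
move=> w v o [w1 [w2 [v1 [j ->]]]]; rewrite (rnorm2_jet j).
case: j => p1 p2 Lw2 p3 Lv1.
have Lw1 := prim_L2 L_gt0 p2 Lw2; have Lw := prim_L2 L_gt0 p1 Lw1.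
have Lv := prim_L2 L_gt0 p3 Lv1.
set o' := obsof _ _ _ _ _.
have go : ogood L o' by apply: (@isobs_good w v); exists w1, w2, v1.
have [Lp Lq _] := go.
set S := osize L o'.
have s1 := ip_ge0 L (op o'); have s2 := ip_ge0 L (oq o'); have s3 := ip_ge0 L (ow o').
have s4 := sqr_ge0 (oy o'); have s5 := sqr_ge0 (ou o'); have s6 := sqr_ge0 (ov o').
have S1 : ip (op o') (op o') <= S by rewrite /S /osize; lra.
have S2 : ip (oq o') (oq o') <= S by rewrite /S /osize; lra.
have S3 : ip w1 w1 <= S by rewrite /S /osize -[ip w1 w1]/(ip (ow o') (ow o')); lra.
have S5 : (v 0 + b * w 0) ^+ 2 <= S by rewrite /S /osize -[v 0 + b * w 0]/(ou o'); lra.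
have S6 : v 0 ^+ 2 <= S by rewrite /S /osize -[v 0]/(ov o'); lra.
have S0 : 0 <= S by exact: osize_ge0.
have W0 : w 0 ^+ 2 <= 4 * B2 * S.
  have -> : w 0 ^+ 2 = B2 * ((v 0 + b * w 0) - v 0) ^+ 2.
    by rewrite /B2; field; rewrite gt_eqF.
  have -> : 4 * B2 * S = B2 * (4 * S) by ring.
  apply: ler_wpM2l => //.
  by have := sqr_ge0 ((v 0 + b * w 0) + v 0); move: (v 0 + b * w 0) S5 => u; nra.
have D1 : ip w w <= cw * S.
  apply: (le_trans (prim_ip_le L_gt0 p1 Lw1)).
  have := ler_wpM2l (ltW L_gt0) W0; have := ler_wpM2l L2_0 S3.
  by rewrite /cw; lra.
have V1 : ip v1 v1 <= cv1 * S.
  have -> : ip v1 v1 = ip (fun x => oq o' x + - b * w1 x) (fun x => oq o' x + - b * w1 x).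
    by apply: eq_ip => x _ /=; ring.
  apply: (le_trans (ip_sum2 _ Lq Lw1)); rewrite sqrrN -/bb /cv1.
  by have := ler_wpM2l bb0 S3; move: S2; lra.
have V0 : ip v v <= cv * S.
  apply: (le_trans (prim_ip_le L_gt0 p3 Lv1)).
  have := ler_wpM2l (ltW L_gt0) S6; have := ler_wpM2l L2_0 V1.
  by rewrite /cv; lra.
have VL : v L ^+ 2 <= cvL * S.
  have := prim_increment L_gt0 p3 Lv1 I0 IL; have := ler_wpM2l (ltW L_gt0) V1.
  have := sqr_ge0 (v L - 2 * v 0); move: S6; rewrite /cvL.
  by move: (ip v1 v1) (v L) (v 0) => i x y; nra.
have D2 : ip w2 w2 <= cw2 * S.
  have LPw2 := L2_bmeasM bP Lw2.
  have E1 : P0 ^+ 2 * ip w2 w2 <= ip (fun x => P x * w2 x) (fun x => P x * w2 x).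
    rewrite -ip_Zl//; apply: le_ip => //; first exact: L2Z.
    move=> x Ix; have -> : P x * w2 x * (P x * w2 x) = P x ^+ 2 * w2 x ^+ 2 by ring.
    rewrite -mulrA -expr2; apply: ler_wpM2r; first exact: sqr_ge0.
    have PP : P0 <= P x by apply: P0P; move: Ix; rewrite /I0L/= in_itv.
    by rewrite ler_pXn2r// nnegrE ltW// (lt_le_trans P0_gt0).
  have LA : L2 (fun x => P1 x * w1 x) by exact: L2_bmeasM.
  have Lpb := L2_lin (- b) Lp Lv.
  have E2 := ip_sum2 (-1) Lpb LA.
  have E3 := ip_sum2 (- b) Lp Lv.
  have E4 := ip_bmeasM bP1 H1 Lw1.
  have E5 : ip (fun x => P x * w2 x) (fun x => P x * w2 x) =
    ip (fun x => op o' x + - b * v x + -1 * (P1 x * w1 x))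
       (fun x => op o' x + - b * v x + -1 * (P1 x * w1 x)).
    by apply: eq_ip => x _ /=; ring.
  have E6 : P0 ^+ 2 * ip w2 w2 <= (4 * k1 + 4 + 4 * bb * cv) * S.
    apply: (le_trans E1); rewrite E5; apply: (le_trans E2).
    have := ler_wpM2l k10 S3; have := ler_wpM2l bb0 V0; have := mulr_ge0 k10 S0.
    by move: E3 E4 S1; rewrite !sqrrN expr1n -/bb -/k1; lra.
  rewrite -(ler_pM2l P20); apply: (le_trans E6).
  by rewrite /cw2 /Q0 !mulrA divff ?mul1r// gt_eqF.
move: D1 D2 V0 V1 VL S3 S6; clearbody S cw cv1 cv cvL cw2; lra.
Qed.

End real_states.

(** * The generator on real states *)

Section real_generator.
Context {R : realType} (L : R).
Hypothesis L_gt0 : 0 < L.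
Implicit Types (f g w v : R -> R).

Local Notation mu := (@lebesgue_measure R).
Local Notation prim := (prim L).
Local Notation L2 := (L2 L).
Local Notation ip := (ip L).
Local Notation I := (I0L L).

Let I0 : I 0. Proof. by rewrite /I0L/= in_itv/= lexx ltW. Qed.
Let IL : I L. Proof. by rewrite /I0L/= in_itv/= lexx ltW. Qed.

Variables (P P1 P2 : R -> R) (P0 a b th1 th2 th3 th4 : R).
Hypothesis pP : prim P P1.
Hypothesis pP1 : prim P1 P2.
Hypothesis LP2 : L2 P2.
Hypothesis P0_gt0 : 0 < P0.
Hypothesis P0P : forall x, 0 <= x <= L -> P0 <= P x.
Hypothesis a_gt0 : 0 < a.
Hypothesis b_gt0 : 0 < b.
Hypothesis th3_lt0 : th3 < 0.
Hypothesis th4_gt0 : 0 < th4.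
Hypothesis th1E : th1 = th3 / b - a.
Hypothesis th2E : th2 = th4 / b.

Let LP1 : L2 P1. Proof. exact: prim_L2 pP1 LP2. Qed.

Definition flux w := fun x => P x * der L w x.

Definition rdomain w v := [/\ Hs L 3 w, Hs L 2 v, der L (flux w) L = - der L w L &
  der L (flux w) 0 = th1 * v 0 + th2 * der L v 0 + th3 * w 0 + th4 * der L w 0].

Lemma der_prim_L2 f g h x : prim f g -> prim g h -> L2 h -> I x -> der L f x = g x.
Proof.
move=> fg gh Lh; rewrite /I0L/= in_itv/= => Ix.
have Lg := prim_L2 L_gt0 gh Lh.
apply: (der_prim L_gt0 fg (L2_intg L_gt0 Lg)) => //.
exact: prim_within gh (L2_intg L_gt0 Lh).
Qed.

(** Three weak derivatives of w make (P w')' an H^1 function, so its values at the two ends make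
    sense. *)
Lemma der_flux w w1 w2 w3 : prim w w1 -> prim w1 w2 -> prim w2 w3 -> L2 w3 ->
  let g1 := fun x => (P2 x * w1 x + P1 x * w2 x) + (P1 x * w2 x + P x * w3 x) in
  [/\ prim (flux w) (fun x => P1 x * w1 x + P x * w2 x),
      prim (fun x => P1 x * w1 x + P x * w2 x) g1, L2 g1 &
      forall x, I x -> der L (flux w) x = P1 x * w1 x + P x * w2 x].
Proof.
move=> p1 p2 p3 Lw3 g1.
have Lw2 := prim_L2 L_gt0 p3 Lw3; have Lw1 := prim_L2 L_gt0 p2 Lw2.
have f1 : prim (flux w) (fun x => P1 x * w1 x + P x * w2 x).
  apply: prim_eq (prim_mul L_gt0 pP p2 LP1 Lw2) => // x Ix.
  by rewrite /flux (der_prim_L2 p1 p2 Lw2).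
have h1 := L2_prim_mul L_gt0 pP1 p2 LP2 Lw2.
have h2 := L2_prim_mul L_gt0 pP p3 LP1 Lw3.
have Lg1 : L2 g1 by exact: L2_D.
have f2 : prim (fun x => P1 x * w1 x + P x * w2 x) g1.
  have := prim_lin 1 (L2_intg L_gt0 h1) (L2_intg L_gt0 h2)
    (prim_mul L_gt0 pP1 p2 LP2 Lw2) (prim_mul L_gt0 pP p3 LP1 Lw3).
  by apply: prim_eq => // x _; rewrite mul1r.
by split => // x Ix; exact: der_prim_L2 f1 f2 Lg1 Ix.
Qed.

Lemma Hs3_jet w : Hs L 3 w -> exists w1 w2 w3, [/\ prim w w1, prim w1 w2, prim w2 w3 & L2 w3].
Proof.
by move=> [_ [w1 [p1 [_ [w2 [p2 [_ [w3 [p3 Lw3]]]]]]]]]; exists w1, w2, w3.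
Qed.

Lemma Hs2_jet v : Hs L 2 v -> exists v1 v2, [/\ prim v v1, prim v1 v2 & L2 v2].
Proof. by move=> [_ [v1 [p1 [_ [v2 [p2 Lv2]]]]]]; exists v1, v2. Qed.

Lemma rdomain_odot w v : rdomain w v -> exists o o',
  [/\ isobs L P P1 b w v o, isobs L P P1 b v (der L (flux w)) o' &
      odot L P a b th3 th4 o o'].
Proof.
move=> [/Hs3_jet[w1 [w2 [w3 [p1 p2 p3 Lw3]]]] /Hs2_jet[v1 [v2 [q1 q2 Lv2]]] BL B0].
have Lw2 := prim_L2 L_gt0 p3 Lw3; have Lw1 := prim_L2 L_gt0 p2 Lw2.
have Lv1 := prim_L2 L_gt0 q2 Lv2.
have [f1 f2 Lg1 dG] := der_flux p1 p2 p3 Lw3.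
move: f2 Lg1; set g1 := fun x => (_ + _) + (_ + _) => f2 Lg1.
set dG' := der L (flux w) in BL B0 dG *.
have pdG : prim dG' g1 by apply: prim_eq f2 => // x Ix; rewrite dG.
have dwL : der L w L = w1 L by exact: der_prim_L2 p1 p2 Lw2 IL.
have dw0 : der L w 0 = w1 0 by exact: der_prim_L2 p1 p2 Lw2 I0.
have dv0 : der L v 0 = v1 0 by exact: der_prim_L2 q1 q2 Lv2 I0.
exists (obsof L P P1 b w v w1 w2 v1), (obsof L P P1 b v dG' v1 v2 g1).
split; [by exists w1, w2, v1|by exists v1, v2, g1|].
pose r x := P x * (v1 x + b * w1 x).
exists (fun x => g1 x + b * v1 x), r, (fun x => P1 x * v1 x + P x * v2 x + b * dG' x), (dG' 0).
split.
- split; last exact: L2_lin.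
  have := prim_lin b (L2_intg L_gt0 Lg1) (L2_intg L_gt0 Lv1) f2 q1.
  by apply: prim_eq.
- have LdG := prim_L2 L_gt0 pdG Lg1.
  have LvW := L2_lin b Lv2 Lw2.
  have pq := prim_lin b (L2_intg L_gt0 Lv2) (L2_intg L_gt0 Lw2) q2 p2.
  have h := L2_prim_mul L_gt0 pP q2 LP1 Lv2.
  split; last exact: L2_lin.
  apply: prim_eq (prim_mul L_gt0 pP pq LP1 LvW) => // x Ix.
  by rewrite dG//; ring.
- by [].
(* The domain condition at L identifies p(L) with y. *)
- by rewrite /= -dG// BL dwL; ring.
split.
- by rewrite /= dG.
(* The domain condition at 0, grouped in terms of u(0) and q(0), is solved for q(0). *)
- have -> : dG' 0 = th1 * v 0 + th2 * v1 0 + th3 * w 0 + th4 * w1 0 by rewrite B0 dv0 dw0.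
  by rewrite /= th1E th2E; field; rewrite !gt_eqF.
- rewrite /obsof; congr Obs.
  + by apply/funext => x /=; ring.
  + by rewrite /= BL dwL; ring.
  + by rewrite /= dG.
Qed.

Lemma rdomain_rspace w v : rdomain w v -> rspace L w v.
Proof.
by move=> /rdomain_odot[ o [ o' [[w1 [w2 [v1 [j _]]]] _ _]]]; apply/(rspaceP L_gt0); exists w1, w2, v1.
Qed.

Lemma rdomain_image w v : rdomain w v -> rspace L v (der L (flux w)).
Proof.
by move=> /rdomain_odot[ o [ o' [_ [w1 [w2 [v1 [j _]]]] _]]]; apply/(rspaceP L_gt0); exists w1, w2, v1.
Qed.

(** [W] is the form on the diagonal, read off any choice of observables. A Young-type inequality
    stands in for bilinearity, and dissipation is recorded as a bound on W(z + h A z) with an h^2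
    remainder. *)
Lemma real_lyapunov : exists (W : (R -> R) -> (R -> R) -> R) (c C om : R),
  [/\ [/\ 0 < c, 0 < C & 0 < om],
   (forall w v, rspace L w v -> c * rnorm2 L w v <= W w v <= C * rnorm2 L w v),
   (forall e w v w' v', 0 < e -> rspace L w v -> rspace L w' v' ->
     W (fun x => w x + 1 * w' x) (fun x => v x + 1 * v' x) <=
       (1 + e) * W w v + (1 + e^-1) * W w' v') &
   (forall w v, rdomain w v -> exists2 K : R, 0 <= K & forall h, 0 <= h ->
     W (fun x => w x + h * v x) (fun x => v x + h * der L (flux w) x) <=
       (1 - 2 * om * h) * W w v + h ^+ 2 * K)].
Proof.
have P0P' x : I x -> P0 <= P x by rewrite /I0L/= in_itv/=; exact: P0P.
have [B [c0 [C0 [[c0_gt0 C0_gt0] Bsym Blin Bbnd Bdiss]]]] :=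
  lyap_exists L_gt0 pP pP1 LP2 P0_gt0 P0P' a_gt0 b_gt0 th3_lt0 th4_gt0.
have [C1 C1_gt0 HC1] := osize_le_rnorm2 L_gt0 b pP pP1 LP2.
have [C2 C2_gt0 HC2] := rnorm2_le_osize L_gt0 pP pP1 LP2 P0_gt0 P0P b_gt0.
have good w v o : isobs L P P1 b w v o -> ogood L o.
  by move=> ob; exact: (isobs_good L_gt0 pP pP1 LP2 ob).
have Bge0 o : ogood L o -> 0 <= B o o.
  move=> go; have /andP[+ _] := Bbnd o go; apply: le_trans.
  by rewrite mulr_ge0 ?osize_ge0// ltW.
have Bexp k o o' : ogood L o -> ogood L o' ->
    B (olin k o o') (olin k o o') = B o o + 2 * k * B o o' + k ^+ 2 * B o' o'.
  move=> go go'; have gl := ogood_lin k go go'.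
  by rewrite Blin// (Bsym o (olin k o o')) (Bsym o' (olin k o o')) !Blin// (Bsym o' o); ring.
pose pick w v := ClassicalEpsilon.epsilon
  (inhabits (Obs (fun=> 0) (fun=> 0) (fun=> 0) 0 0 0)) (isobs L P P1 b w v).
pose W w v := B (pick w v) (pick w v).
(* Two choices of observables for one state differ by some [d] of size 0, so B(d,d) = 0; since [B]
   is semidefinite, B(o,d) = 0 too, and [W] does not depend on the choice. *)
have WE w v o : isobs L P P1 b w v o -> W w v = B o o.
  move=> ob; rewrite /W; set o' := pick w v.
  have ob' : isobs L P P1 b w v o' by apply: ClassicalEpsilon.epsilon_spec; exists o.
  have go := good _ _ _ ob; have go' := good _ _ _ ob'.
  have obd := isobs_lin L_gt0 (-1) ob' ob.
  set d := olin (-1) o' o in obd.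
  have gd := good _ _ _ obd.
  have z f : (fun x => f x + -1 * f x) = (fun=> 0 : R) by apply/funext => x; ring.
  have d0 : osize L d <= 0.
    have := HC1 _ _ _ obd; rewrite !z (rnorm2_jet L_gt0 (jet0 L_gt0)).
    by rewrite ip0l expr0n/= !addr0 mulr0.
  have Bd0 : B d d = 0.
    apply/eqP; rewrite eq_le Bge0// andbT.
    have /andP[_] := Bbnd d gd; move=> /le_trans; apply.
    by rewrite pmulr_rle0.
  have Bdo : B o d = 0.
    have H k : 0 <= B o o + 2 * k * B o d.
      have := Bge0 _ (ogood_lin k go gd); rewrite Bexp// Bd0; lra.
    apply/eqP; apply: contraT => n0.
    have := H (- (B o o + 1) / (2 * B o d)).
    have -> : 2 * (- (B o o + 1) / (2 * B o d)) * B o d = - (B o o + 1) by field.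
    by rewrite leNgt; case/negP; lra.
  have e : o' = olin 1 o d.
    rewrite /d /olin /=; case: (o') => ? ? ? ? ? ?; case: (o) => ? ? ? ? ? ? /=.
    by congr Obs; try (apply/funext => x); ring.
  by rewrite e Bexp// Bdo Bd0 !mulr0 !addr0.
exists W, (c0 / C2), (C0 * C1), (c0 / C0); split.
- by split; [exact: divr_gt0|exact: mulr_gt0|exact: divr_gt0].
- move=> w v Hwv; have [ o ob] := isobs_ex L_gt0 P P1 b Hwv.
  have go := good _ _ _ ob; have /andP[B1 B2] := Bbnd o go.
  rewrite (WE _ _ _ ob); apply/andP; split.
    apply: le_trans B1; rewrite -mulrA ler_pM2l// ler_pdivrMl//.
    exact: HC2 ob.
  by apply: (le_trans B2); rewrite -mulrA ler_pM2l//; exact: HC1 ob.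
- move=> e w v w' v' e0 Hwv Hwv'.
  have [ o ob] := isobs_ex L_gt0 P P1 b Hwv; have [ o' ob'] := isobs_ex L_gt0 P P1 b Hwv'.
  have go := good _ _ _ ob; have go' := good _ _ _ ob'.
  rewrite (WE _ _ _ ob) (WE _ _ _ ob') (WE _ _ _ (isobs_lin L_gt0 1 ob ob')).
  rewrite Bexp//.
  (* Positivity of [B] at o - o'/e, multiplied by e, is the required inequality. *)
  have := Bge0 _ (ogood_lin (- e^-1) go go'); rewrite Bexp// => H.
  rewrite -subr_ge0.
  have -> : (1 + e) * B o o + (1 + e^-1) * B o' o' - (B o o + 2 * 1 * B o o' + 1 ^+ 2 * B o' o') =
    e * (B o o + 2 * - e^-1 * B o o' + (- e^-1) ^+ 2 * B o' o').
    by field; rewrite gt_eqF.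
  by rewrite mulr_ge0// ltW.
- move=> w v /rdomain_odot[ o [ o' [ob ob' od]]].
  have go := good _ _ _ ob; have go' := good _ _ _ ob'.
  exists (B o' o'); first exact: Bge0.
  move=> h h0; rewrite (WE _ _ _ ob) (WE _ _ _ (isobs_lin L_gt0 h ob ob')) Bexp//.
  rewrite lerD2r.
  have D1 := Bdiss o o' go od.
  have /andP[_ D2] := Bbnd o go.
  have D3 : B o o' <= - (c0 / C0) * B o o.
    apply: (le_trans D1); rewrite !mulNr lerN2 -mulrA ler_pM2l// ler_pdivrMl//.
  have h2 : 0 <= 2 * h by rewrite mulr_ge0.
  have := ler_wpM2l h2 D3; move: (c0 / C0) => k; lra.
Qed.

(** Approximate the highest derivatives w'' and v' in L^2 by H^1 functions and integrate back. Both
    boundary conditions only prescribe end values of these approximants, which cost nothing in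
    L^2. *)
Lemma rdomain_dense w v (e : R) : rspace L w v -> 0 < e -> exists w' v',
  rdomain w' v' /\ rnorm2 L (fun x => w x + -1 * w' x) (fun x => v x + -1 * v' x) < e.
Proof.
move=> /(rspaceP L_gt0)[w1 [w2 [v1 j]]] e0.
have [p1 p2 Lw2 p3 Lv1] := j.
have Lw1 := prim_L2 L_gt0 p2 Lw2.
have L2_0 : 0 <= L ^+ 2 by exact: sqr_ge0.
pose K := 4 * L ^+ 2 * L ^+ 2 + L ^+ 2 + 2 * L ^+ 2 + L + 1.
have K0 : 0 < K.
  rewrite /K; have := mulr_ge0 L2_0 L2_0; move: L2_0 L_gt0; lra.
have e1 : 0 < e / (2 * K) by rewrite divr_gt0// mulr_gt0.
have PL : P L != 0.
  by rewrite gt_eqF// (lt_le_trans P0_gt0)// P0P// lexx ltW.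
(* The value at L solves P'(L) w'(L) + P(L) y2(L) = -w'(L); the value at 0 is free. *)
have [y2 [y3 [r3 Ly3 y20 y2L dw]]] :=
  H1_dense L_gt0 0 (- (1 + P1 L) * w1 L / P L) Lw2 e1.
have Ly2 := prim_L2 L_gt0 r3 Ly3.
(* Anchored at L, so that y1(L) = w'(L), as presupposed in the end value of [y2]. *)
have [y1 r2 y10] := prim_mk (w1 L - \int[mu]_(t in `[0, L]) y2 t) Ly2.
have Ly1 := prim_L2 L_gt0 r2 Ly2.
have y1L : y1 L = w1 L.
  by have := r2 L; rewrite lexx ltW// => /(_ isT) ->; rewrite y10; ring.
have [y r1 y00] := prim_mk (w 0) Ly1.
pose g0 := P1 0 * y1 0 + P 0 * y2 0.
have th2_gt0 : 0 < th2 by rewrite th2E divr_gt0.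
(* The condition at 0 involves y1(0), known only now, and is solved for u1(0) by dividing by th2 >
   0. *)
have [u1 [u2 [s2 Lu2 u10 _ dv]]] :=
  H1_dense L_gt0 ((g0 - th1 * v 0 - th3 * w 0 - th4 * y1 0) / th2) 0 Lv1 e1.
have Lu1 := prim_L2 L_gt0 s2 Lu2.
have [u s1 u0] := prim_mk (v 0) Lu1.
have Ly := prim_L2 L_gt0 r1 Ly1; have Lu := prim_L2 L_gt0 s1 Lu1.
have [_ _ _ dG] := der_flux r1 r2 r3 Ly3.
exists y, u; split.
  split.
  - split => //; exists y1; split => //; split => //; exists y2; split => //.
    by split => //; exists y3.
  - by split => //; exists u1; split => //; split => //; exists u2.
  - rewrite dG// (der_prim_L2 r1 r2 Ly2 IL) y1L y2L; field.
    exact: PL.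
  - rewrite dG// (der_prim_L2 r1 r2 Ly2 I0) (der_prim_L2 s1 s2 Lu2 I0) y00 u0 u10 -/g0.
    by field; rewrite gt_eqF.
have j' : jet L y u y1 y2 u1 by split.
have jd := jet_lin L_gt0 (-1) j j'.
rewrite (rnorm2_jet L_gt0 jd).
have [d1 d2 Ld2 d3 Ld] := jd.
have Ld1 := prim_L2 L_gt0 d2 Ld2.
have E2 : ip (fun x => w2 x + -1 * y2 x) (fun x => w2 x + -1 * y2 x) = dist2 L w2 y2.
  by apply: eq_ip => x _; ring.
have E4 : ip (fun x => v1 x + -1 * u1 x) (fun x => v1 x + -1 * u1 x) = dist2 L v1 u1.
  by apply: eq_ip => x _; ring.
have E1 : ip (fun x => w1 x + -1 * y1 x) (fun x => w1 x + -1 * y1 x) <= L ^+ 2 * dist2 L w2 y2.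
  have -> : L ^+ 2 * dist2 L w2 y2 = \int[mu]_(x in I) (L * dist2 L w2 y2).
    rewrite Rintegral_cst; last exact: measurable_I.
    by rewrite /= lebesgue_measure_itv/= lte_fin L_gt0 oppr0 addr0/=; ring.
  apply: le_Rintegral; [exact: measurable_I|exact: intgM|exact: intg_cst|].
  move=> x Ix; have := prim_increment L_gt0 d2 Ld2 IL Ix.
  by rewrite E2 y1L; lra.
have E0 := prim_ip_le L_gt0 d1 Ld1.
have E3 := prim_ip_le L_gt0 d3 Ld.
have E5 := prim_increment L_gt0 d3 Ld I0 IL.
rewrite E2 E4 u0; move: E0 E1 E3 E5; rewrite E4 y00 u0.
have -> : w 0 + -1 * w 0 = 0 by ring.
have -> : v 0 + -1 * v 0 = 0 by ring.
have kE : e / (2 * K) * (2 * K) = e by rewrite divfK// gt_eqF// mulr_gt0.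
have dw0 : 0 <= dist2 L w2 y2 by exact: ip_ge0.
have dv0 : 0 <= dist2 L v1 u1 by exact: ip_ge0.
move: (ip _ _) (ip _ _) (ip _ _) ((v L + -1 * u L)) => i0 i1 i3 vL.
move: (dist2 L w2 y2) (dist2 L v1 u1) (e / (2 * K)) dw dv dw0 dv0 kE => X Y ee dw dv X0 Y0 kE.
rewrite expr0n/= !subr0 mulr0 add0r addr0 => H0 H1 H3 H5.
have H1' := ler_wpM2l L2_0 H1.
have T1 : K * X + K * Y < e.
  have k1 : K * X < K * ee by rewrite ltr_pM2l.
  have k2 : K * Y < K * ee by rewrite ltr_pM2l.
  by move: k1 k2 kE; clearbody K; lra.
apply: le_lt_trans T1.
have := mulr_ge0 L2_0 X0; have := mulr_ge0 L2_0 Y0; have := mulr_ge0 (ltW L_gt0) X0.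
have := mulr_ge0 (ltW L_gt0) Y0; have := mulr_ge0 L2_0 (mulr_ge0 L2_0 Y0).
have := mulr_ge0 L2_0 (mulr_ge0 L2_0 X0).
rewrite /K; move: H0 H1 H1' H3 H5 X0 Y0; lra.
Qed.

End real_generator.

(** * Semigroups with a strict Lyapunov functional *)

(** Continuous induction on the supremum of the times up to which g <= g(0). The second hypothesis
    carries the bound to the supremum, the first one past it; its form with a factor and an additive
    error suits the Young-type inequality for W. *)
Lemma local_decrease_global {R : realType} (g : R -> R) :
  (forall t, 0 <= t -> exists2 d : R, 0 < d & forall h, 0 < h < d -> g (t + h) <= g t) ->
  (forall tau e : R, 0 < tau -> 0 < e -> exists2 d : R, 0 < d &
     forall s, 0 <= s -> tau - d < s < tau -> g tau <= (1 + e) * g s + e) ->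
  0 <= g 0 ->
  forall t, 0 <= t -> g t <= g 0.
Proof.
move=> gr gl g0 t1 t10.
pose S := [set t : R | 0 <= t <= t1 /\ forall s, 0 <= s <= t -> g s <= g 0].
have S0 : S 0.
  split; first by rewrite lexx t10.
  by move=> s /andP[s0 s0']; have -> : s = 0 by apply/eqP; rewrite eq_le s0 s0'.
have supS : has_sup S by split; [exists 0|exists t1 => t [/andP[]]].
set sg := sup S.
have sg0 : 0 <= sg by apply: ub_le_sup => //; case: supS.
have sg1 : sg <= t1 by apply: ge_sup; [exists 0|move=> t [/andP[]]].
have below s : 0 <= s -> s < sg -> g s <= g 0.
  move=> s0 ssg; have e0 : 0 < sg - s by rewrite subr_gt0.
  have [t [_ Ht] st] := sup_adherent e0 supS.
  apply: Ht; rewrite s0 ltW//; move: st; rewrite -/sg; lra.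
have at_sg : g sg <= g 0.
  have [->//|sgn0] := eqVneq sg 0.
  have {sgn0}sgp : 0 < sg by rewrite lt_neqAle eq_sym sgn0.
  apply/ler_addgt0Pr => e e0.
  (* With k = e / (g(0) + 1), (1 + k) g(0) + k = g(0) + e. *)
  have e'0 : 0 < e / (g 0 + 1) by rewrite divr_gt0// ltr_wpDl.
  have [d d0 Hd] := gl sg (e / (g 0 + 1)) sgp e'0.
  pose s := Num.max 0 (sg - d / 2).
  have s0 : 0 <= s by rewrite le_max lexx.
  have ssg : s < sg by rewrite gt_max sgp ltrBlDr ltrDl divr_gt0.
  have sd : sg - d < s by rewrite lt_max; apply/orP; right; lra.
  have := Hd s s0; rewrite sd ssg => /(_ isT) H.
  have := below s s0 ssg => H2.
  have E : e = e / (g 0 + 1) * (g 0 + 1) by rewrite divfK// gt_eqF// ltr_wpDl.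
  rewrite E; move: (e / (g 0 + 1)) e'0 H => k k0 H; clear E.
  have := ler_wpM2l (ltW k0) H2; lra.
have [e|ne] := eqVneq sg t1; first by rewrite -e.
have sgt : sg < t1 by rewrite lt_neqAle ne sg1.
have [d d0 Hd] := gr sg sg0.
pose u := Num.min t1 (sg + d / 2).
have usg : sg < u by rewrite lt_min sgt ltrDl divr_gt0.
have ud : u <= sg + d / 2 by rewrite ge_min lexx orbT.
suff Su : S u by have := ub_le_sup supS.2 Su; rewrite -/sg leNgt usg.
split; first by rewrite (le_trans sg0 (ltW usg)) ge_min lexx.
move=> s /andP[s0 su].
have [ssg|sgs|->//] := ltgtP s sg; first exact: below.
have -> : s = sg + (s - sg) by ring.
apply: le_trans at_sg; apply: Hd; apply/andP; split; lra.
Qed.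

Section semigroup_decay.
Context {R : realType} {X : Type}.
Local Notation E := (X -> R).
Implicit Types (x y z : E) (t s h : R).

Definition axpy (c : R) x y : E := fun i => x i + c * y i.
Definition scal (c : R) x : E := fun i => c * x i.

Variables (H D : E -> Prop) (A : E -> E) (N W : E -> R) (T : R -> E -> E).
Variables (cW CW w : R).

Hypothesis H_lin : forall c x y, H x -> H y -> H (axpy c x y).
Hypothesis N_ge0 : forall x, H x -> 0 <= N x.
Hypothesis N_add : forall x y, H x -> H y -> N (axpy 1 x y) <= 2 * N x + 2 * N y.
Hypothesis N_scale : forall c x, H x -> N (scal c x) = c ^+ 2 * N x.

Hypothesis T_H : forall t z, 0 <= t -> H z -> H (T t z).
Hypothesis T_0 : forall z, H z -> N (axpy (-1) (T 0 z) z) = 0.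
Hypothesis T_D : forall t s z, 0 <= t -> 0 <= s -> H z ->
  N (axpy (-1) (T (t + s) z) (T t (T s z))) = 0.
Hypothesis T_lin : forall t c1 c2 z1 z2, 0 <= t -> H z1 -> H z2 ->
  N (axpy (-1) (T t (axpy 1 (scal c1 z1) (scal c2 z2))) (axpy 1 (scal c1 (T t z1)) (scal c2 (T t z2)))) = 0.
Hypothesis T_bd : forall t, 0 <= t -> exists M : R, forall z, H z -> N (T t z) <= M * N z.
Hypothesis T_cont : forall z (e : R), H z -> 0 < e ->
  exists2 d : R, 0 < d & forall h, 0 < h < d -> N (axpy (-1) (T h z) z) < e.
Hypothesis D_H : forall z, D z -> H z.
Hypothesis A_H : forall z, D z -> H (A z).
Hypothesis T_gen : forall z (e : R), D z -> 0 < e ->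
  exists2 d : R, 0 < d & forall h, 0 < h < d ->
    N (axpy (-1) (scal h^-1 (axpy (-1) (T h z) z)) (A z)) < e.
Hypothesis T_dom : forall z y, H z -> H y ->
  (forall e : R, 0 < e -> exists2 d : R, 0 < d & forall h, 0 < h < d ->
    N (axpy (-1) (scal h^-1 (axpy (-1) (T h z) z)) y) < e) -> D z.
Hypothesis D_dense : forall z (e : R), H z -> 0 < e ->
  exists2 z', D z' & N (axpy (-1) z z') < e.

Hypothesis cW_gt0 : 0 < cW.
Hypothesis CW_gt0 : 0 < CW.
Hypothesis w_gt0 : 0 < w.
Hypothesis W_N : forall z, H z -> cW * N z <= W z <= CW * N z.
Hypothesis W_add : forall (e : R) x y, 0 < e -> H x -> H y ->
  W (axpy 1 x y) <= (1 + e) * W x + (1 + e^-1) * W y.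
Hypothesis W_diss : forall z, D z -> exists2 K : R, 0 <= K &
  forall h, 0 <= h -> W (axpy h z (A z)) <= (1 - 2 * w * h) * W z + h ^+ 2 * K.

Let H_s c x : H x -> H (scal c x).
Proof.
move=> Hx; have -> : scal c x = axpy (c - 1) x x by apply/funext => i; rewrite /scal /axpy; ring.
exact: H_lin.
Qed.

(** The semigroup laws hold only up to elements of norm 0; such errors are stable under linear
    combinations and are carried along explicitly. *)
Let nul x := H x /\ N x = 0.

Let nul_lin c x y : nul x -> nul y -> nul (axpy c x y).
Proof.
move=> [Hx Nx] [Hy Ny]; split; first exact: H_lin.
apply/eqP; rewrite eq_le N_ge0 ?andbT; last exact: H_lin.
have -> : axpy c x y = axpy 1 x (scal c y) by apply/funext => i; rewrite /scal /axpy; ring.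
apply: (le_trans (N_add Hx (H_s c Hy))).
by rewrite N_scale// Nx Ny !mulr0 addr0.
Qed.

Let nul_s c x : nul x -> nul (scal c x).
Proof. by move=> [Hx Nx]; split; [exact: H_s|rewrite N_scale// Nx mulr0]. Qed.

Let N_addnul x n : H x -> nul n -> N (axpy 1 x n) <= 2 * N x.
Proof. by move=> Hx [Hn Nn]; apply: (le_trans (N_add Hx Hn)); rewrite Nn mulr0 addr0. Qed.

Let N_le_sub x y : H x -> H y -> N x <= 2 * N y + 2 * N (axpy (-1) x y).
Proof.
move=> Hx Hy; have -> : N x = N (axpy 1 y (axpy (-1) x y)).
  by congr N; apply/funext => i; rewrite /axpy; ring.
by apply: N_add => //; exact: H_lin.
Qed.

Let N_sub_nul x y : H x -> H y -> N (axpy (-1) x y) = 0 -> N x <= 2 * N y.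
Proof. by move=> Hx Hy e; have := N_le_sub Hx Hy; rewrite e mulr0 addr0. Qed.

Let nul_D t s z : 0 <= t -> 0 <= s -> H z -> nul (axpy (-1) (T (t + s) z) (T t (T s z))).
Proof.
move=> t0 s0 Hz; split; last exact: T_D.
by apply: H_lin; apply: T_H => //; [exact: addr_ge0|exact: T_H].
Qed.

Let nul_T t c1 c2 z1 z2 : 0 <= t -> H z1 -> H z2 ->
  nul (axpy (-1) (T t (axpy 1 (scal c1 z1) (scal c2 z2))) (axpy 1 (scal c1 (T t z1)) (scal c2 (T t z2)))).
Proof.
move=> t0 H1 H2; split; last exact: T_lin.
by apply: H_lin; [apply: T_H => //; apply: H_lin; exact: H_s|apply: H_lin; apply: H_s; exact: T_H].
Qed.

Let W_ge0 z : H z -> 0 <= W z.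
Proof.
move=> Hz; have /andP[+ _] := W_N Hz; apply: le_trans.
by rewrite mulr_ge0 ?N_ge0// ltW.
Qed.

Let T_inc t s z : 0 <= t -> 0 < s -> H z ->
  N (axpy (-1) (T (s + t) z) (T t z)) <= 2 * N (axpy (-1) (T s (T t z)) (T t z)).
Proof.
move=> t0 s0 Hz; have Htz := T_H t0 Hz; have s0' := ltW s0.
have -> : axpy (-1) (T (s + t) z) (T t z) =
   axpy 1 (axpy (-1) (T s (T t z)) (T t z)) (axpy (-1) (T (s + t) z) (T s (T t z))).
  by apply/funext => i; rewrite /axpy; ring.
apply: N_addnul; last exact: nul_D.
by apply: H_lin => //; exact: T_H.
Qed.

Lemma bounded_somewhere (al : R) : 0 < al -> exists c d M : R,
  [/\ 0 < c, c < d, d <= al, 0 <= M &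
    forall s z, c <= s < d -> H z -> N (T s z) <= M * N z].
Proof.
move=> al0; apply: contrapT => nb.
have unb (c d M : R) : 0 < c -> c < d -> d <= al -> 0 <= M ->
    exists s z, [/\ c <= s < d, H z & M * N z < N (T s z)].
  move=> c0 cd dal M0; apply: contrapT => nn; apply: nb.
  exists c, d, M; split => // s z csd Hz; rewrite leNgt; apply/negP => lt.
  by apply: nn; exists s, z.
pose V (n : nat) := [set t : R | exists2 z, H z & n%:R * N z < N (T t z)].
(* Adding the outside of [0, al] makes [F n] dense in the whole line, where Baire's theorem is
   applied. *)
pose F (n : nat) : set R := interior (V n) `|` ([set t | t < 0] `|` [set t | al < t]).
have odF n : open (F n) /\ dense (F n).
  split.
    by apply: openU; [exact: open_interior|apply: openU; [exact: open_lt|exact: open_gt]].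
  move=> O [t Ot] oO.
  have [t0|t0] := ltP t 0; first by exists t; split => //; right; left.
  have [tal|tal] := ltP al t; first by exists t; split => //; right; right.
  have /nbhs_ballP[r /= r0 rO] : nbhs t O by exact: open_nbhs_nbhs.
  have [t_al|] := ltP t al; last first.
    move=> alt; exists (t + r / 2); split; last by right; right => /=; lra.
    by apply: rO; rewrite /ball/= opprD addNKr normrN gtr0_norm; lra.
  pose d := Num.min al (t + r).
  have td : t < d by rewrite lt_min t_al ltrDl.
  (* The midpoint keeps [c] positive even when t = 0. *)
  pose c := (t + d) / 2.
  have c0 : 0 < c by rewrite /c; lra.
  have cd : c < d by rewrite /c; lra.
  have dal : d <= al by rewrite ge_min lexx.
  have dr : d <= t + r by rewrite ge_min lexx orbT.
  (* Just after s, N (T s z) <= 2 N (T u z) + 2 N z, so exceeding (2 n + 2) N z at s forces more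
     than n N z at u. *)
  have M0 : 0 <= 2 * n%:R + 2 :> R by rewrite addr_ge0// mulr_ge0.
  have [s [z [/andP[cs sd] Hz Hs]]] := unb c d _ c0 cd dal M0.
  have s0 : 0 <= s by exact: le_trans (ltW c0) cs.
  have Nz : 0 < N z.
    rewrite lt_neqAle N_ge0// andbT; apply/eqP => N0.
    have [M HM] := T_bd s0; have := HM z Hz.
    by rewrite -N0 mulr0 => /(lt_le_trans Hs); rewrite -N0 mulr0 ltxx.
  have e0 : 0 < N z / 2 by rewrite divr_gt0.
  have [dl dl0 Hdl] := T_cont (T_H s0 Hz) e0.
  pose h0 := Num.min dl (d - s).
  have h00 : 0 < h0 by rewrite lt_min dl0 subr_gt0.
  have inV u : s < u < s + h0 -> V n u.
    move=> /andP[su uh]; have h0' : 0 < u - s by rewrite subr_gt0.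
    have hdl : u - s < dl by move: uh; rewrite -ltrBlDl lt_min => /andP[].
    have := Hdl (u - s); rewrite h0' hdl => /(_ isT) B1.
    have := T_inc s0 h0' Hz; rewrite subrK => B2.
    exists z => //.
    have u0 : 0 <= u by rewrite (le_trans s0)// ltW.
    have := N_le_sub (T_H s0 Hz) (T_H u0 Hz).
    have -> : N (axpy (-1) (T s z) (T u z)) = N (axpy (-1) (T u z) (T s z)).
      have -> : axpy (-1) (T s z) (T u z) = scal (-1) (axpy (-1) (T u z) (T s z)).
        by apply/funext => i; rewrite /axpy /scal; ring.
      rewrite N_scale ?sqrrN ?expr1n ?mul1r//.
      by apply: H_lin; exact: T_H.
    move: Hs B1 B2; lra.
  exists (s + h0 / 2); split.
    apply: rO; rewrite /ball/= ltr_norml.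
    have : h0 <= d - s by rewrite ge_min lexx orbT.
    move: cs sd td dr; rewrite /c => ? ? ? ? ?; apply/andP; split; lra.
  left; exists (h0 / 2) => /=; first by rewrite divr_gt0.
  move=> u /=; rewrite ltr_norml => /andP[? ?]; apply: inV; apply/andP; split; lra.
have oI : open `]0, al[%classic by exact: itv_open.
have [|t [tI Ft]] := @Baire R R^o F odF `]0, al[%classic _ oI.
  by exists (al / 2); rewrite /= in_itv/=; apply/andP; split; lra.
move: tI; rewrite /= in_itv/= => /andP[t0 tal].
have [M HM] := T_bd (ltW t0).
have [n Mn] : exists n : nat, M < n.+1%:R by exists (Num.trunc M); exact: truncnS_gt.
have := Ft n.+1 I; move=> [/interior_subset[z Hz Hn]|[/=|/=]]; [|lra|lra].
have := HM z Hz; rewrite leNgt => /negP; apply; apply: le_lt_trans Hn.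
by rewrite ler_wpM2r ?N_ge0// ltW.
Qed.


(** Translate the window [c, d) by tau - d: for s just below tau, T(s) = T(tau - d) T(s - (tau -
    d)). *)
Lemma bounded_left (tau : R) : 0 < tau -> exists d M : R,
  [/\ 0 < d, d <= tau, 0 <= M &
    forall s z, tau - d < s < tau -> H z -> N (T s z) <= M * N z].
Proof.
move=> tau0; have [c [d [M [c0 cd dtau M0 HM]]]] := bounded_somewhere tau0.
have td0 : 0 <= tau - d by rewrite subr_ge0.
have [M' HM'] := T_bd td0.
exists (d - c), (2 * (`|M'| * M)); split.
- by rewrite subr_gt0.
- by rewrite (le_trans _ dtau)// gerBl ltW.
- by rewrite mulr_ge0 ?mulr_ge0.
move=> s z /andP[s1 s2] Hz.
have sc : c <= s - (tau - d) < d by apply/andP; split; lra.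
have s0 : 0 <= s - (tau - d) by case/andP: sc => /(le_trans (ltW c0)).
have HT1 := T_H s0 Hz.
have := N_sub_nul (T_H (addr_ge0 td0 s0) Hz) (T_H td0 HT1) (T_D td0 s0 Hz).
have -> : tau - d + (s - (tau - d)) = s by ring.
move=> /le_trans; apply; rewrite -mulrA ler_pM2l//.
apply: (le_trans (HM' _ HT1)); rewrite -mulrA.
apply: (@le_trans _ _ (`|M'| * N (T (s - (tau - d)) z))).
  by rewrite ler_wpM2r ?N_ge0// ler_norm.
by rewrite ler_wpM2l//; exact: HM.
Qed.

(** T(tau) z - T(s) z = T(s) (T(tau - s) z - z), where T(s) is bounded uniformly for s near tau from
    the left. *)
Lemma orbit_left_continuous (tau e : R) z : 0 < tau -> 0 < e -> H z ->
  exists d : R, [/\ 0 < d, d <= tau &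
    forall s, tau - d < s < tau -> N (axpy (-1) (T tau z) (T s z)) < e].
Proof.
move=> tau0 e0 Hz; have [d [M [d0 dtau M0 HM]]] := bounded_left tau0.
have e'0 : 0 < e / (4 * M + 1) by rewrite divr_gt0// ltr_wpDl// mulr_ge0.
have [d' d'0 Hd'] := T_cont Hz e'0.
exists (Num.min d d'); split; first by rewrite lt_min d0.
  by rewrite ge_min dtau.
move=> s /andP[s1 s2].
have sd : tau - d < s by apply: le_lt_trans s1; rewrite lerB// ge_min lexx.
have sd' : tau - d' < s by apply: le_lt_trans s1; rewrite lerB// ge_min lexx orbT.
have s0 : 0 <= s by lra.
have h0 : 0 < tau - s by rewrite subr_gt0.
set h := tau - s in h0 *.
have HTh := T_H (ltW h0) Hz.
have small : N (axpy (-1) (T h z) z) < e / (4 * M + 1).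
  by apply: Hd'; rewrite h0 /h/=; lra.
have stau : s + h = tau by rewrite /h; ring.
(* Spelled with [scal] to match the linearity law; the difference of the orbits is T(s) y up to null
   errors. *)
pose y := axpy 1 (scal 1 (T h z)) (scal (-1) z).
have yE : y = axpy (-1) (T h z) z by apply/funext => i; rewrite /y /axpy /scal; ring.
have Hy : H y by rewrite yE; exact: H_lin.
have Ny : N (T s y) <= M * N y by apply: HM => //; rewrite sd.
have -> : axpy (-1) (T tau z) (T s z) = axpy 1 (T s y)
   (axpy (-1) (axpy (-1) (T (s + h) z) (T s (T h z)))
      (axpy (-1) (T s y) (axpy 1 (scal 1 (T s (T h z))) (scal (-1) (T s z))))).
  by rewrite stau; apply/funext => i; rewrite /axpy /scal; ring.
apply: (@le_lt_trans _ _ (2 * N (T s y))).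
  apply: N_addnul; first exact: T_H.
  by apply: nul_lin; [exact: nul_D (ltW h0) Hz|exact: nul_T].
have : N y < e / (4 * M + 1) by rewrite yE.
rewrite ltr_pdivlMr; last by rewrite ltr_wpDl// mulr_ge0.
have Nu := N_ge0 Hy; have := mulr_ge0 M0 Nu; move: Ny Nu; move: (N y) (N (T s y)) => u v; lra.
Qed.

(** Up to null errors the difference quotient of T(t) z is T(t) applied to that of z, hence
    converges to T(t) A z, and [T_dom] applies. *)
Lemma T_preserves_D t z : 0 <= t -> D z -> D (T t z).
Proof.
move=> t0 Dz; have Hz := D_H Dz; have HAz := A_H Dz.
have [M HM] := T_bd t0.
apply: (@T_dom _ (T t (A z))); [exact: T_H|exact: T_H|move=> e e0].
have e'0 : 0 < e / (2 * `|M| + 1) by rewrite divr_gt0// ltr_wpDl// mulr_ge0.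
have [d d0 Hd] := T_gen Dz e'0; exists d => // h /andP[h0 hd].
have := Hd h; rewrite h0 hd => /(_ isT) small.
have Hh := T_H (ltW h0) Hz.
pose q := axpy 1 (scal h^-1 (T h z)) (scal (- h^-1) z).
have Hq : H q by apply: H_lin; apply: H_s.
pose y := axpy 1 (scal 1 q) (scal (-1) (A z)).
have yE : y = axpy (-1) (scal h^-1 (axpy (-1) (T h z) z)) (A z).
  by apply/funext => i; rewrite /y /q /axpy /scal; ring.
have Hy : H y by apply: H_lin; apply: H_s.
have n1 := nul_T 1 (-1) t0 Hq HAz.
have rnorm2 := nul_T h^-1 (- h^-1) t0 Hh Hz.
have n3 := nul_D t0 (ltW h0) Hz.
have n4 := nul_D (ltW h0) t0 Hz.
have -> : axpy (-1) (scal h^-1 (axpy (-1) (T h (T t z)) (T t z))) (T t (A z)) =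
  axpy 1 (T t y)
   (axpy (-1) (axpy (-1) (scal h^-1 (axpy (-1) (axpy (-1) (T (t + h) z) (T t (T h z))) (axpy (-1) (T (h + t) z) (T h (T t z)))))
      (axpy (-1) (T t y) (axpy 1 (scal 1 (T t q)) (scal (-1) (T t (A z))))))
    (axpy (-1) (T t q) (axpy 1 (scal h^-1 (T t (T h z))) (scal (- h^-1) (T t z))))).
  by rewrite (addrC h t); apply/funext => i; rewrite /axpy /scal; ring.
apply: (@le_lt_trans _ _ (2 * N (T t y))).
  apply: N_addnul; first exact: T_H.
  by apply: nul_lin => //; apply: nul_lin => //; apply: nul_s; exact: nul_lin.
have : N y < e / (2 * `|M| + 1) by rewrite yE.
rewrite ltr_pdivlMr; last by rewrite ltr_wpDl// mulr_ge0.
have := N_ge0 Hy; have := HM y Hy; have := ler_norm M; have := normr_ge0 M.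
move: (N y) (N (T t y)) `|M| => u v m ? ? ? ?.
have : M * u <= m * u by rewrite ler_wpM2r.
lra.
Qed.

(** The weight in [W_add] can be taken arbitrarily small because its second term vanishes. *)
Lemma W_nul x n : H x -> nul n -> W (axpy 1 x n) <= W x.
Proof.
move=> Hx [Hn Nn]; have Wn : W n = 0.
  by apply/eqP; rewrite eq_le W_ge0//; have /andP[_] := W_N Hn; rewrite Nn mulr0 => ->.
apply/ler_addgt0Pr => e e0.
have k0 : 0 < e / (W x + 1) by rewrite divr_gt0// ltr_wpDl// W_ge0.
have kE : e / (W x + 1) * (W x + 1) = e by rewrite divfK// gt_eqF// ltr_wpDl// W_ge0.
have := W_add k0 Hx Hn; rewrite Wn mulr0 addr0.
by move: (e / (W x + 1)) k0 kE => k k0 kE; lra.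
Qed.

(** Write T(h) x = x + h A x + h r with r tending to 0. Half of the rate 2 w is given up to pay for
    r and for the h^2 term. *)
Lemma W_step t z : 0 <= t -> D z -> exists2 d : R, 0 < d &
  forall h, 0 < h < d -> W (T (t + h) z) <= (1 - w * h) * W (T t z).
Proof.
move=> t0 Dz; have Hz := D_H Dz.
set x := T t z; have Dx : D x := T_preserves_D t0 Dz; have Hx := D_H Dx.
have HA := A_H Dx.
have step h : 0 < h -> W (T (t + h) z) <= W (T h x).
  move=> h0.
  have -> : T (t + h) z = axpy 1 (T h x) (axpy (-1) (T (h + t) z) (T h x)).
    by rewrite (addrC h t); apply/funext => i; rewrite /axpy; ring.
  by apply: W_nul; [apply: T_H => //; exact: ltW|apply: nul_D => //; exact: ltW].
(* A separate case, since the tolerances below are proportional to W x; here x is null and T(h)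
   keeps it null. *)
have [Wx0|Wxn0] := eqVneq (W x) 0.
  exists 1 => // h /andP[h0 _]; apply: (le_trans (step h h0)).
  rewrite Wx0 mulr0.
  have Nx0 : N x = 0.
    apply/eqP; rewrite eq_le N_ge0// andbT.
    by have /andP[+ _] := W_N Hx; rewrite Wx0 pmulr_rle0.
  have [M HM] := T_bd (ltW h0).
  have HT := T_H (ltW h0) Hx.
  have /andP[_] := W_N HT; move=> /le_trans; apply.
  have : N (T h x) <= 0 by have := HM x Hx; rewrite Nx0 mulr0.
  by rewrite pmulr_rle0.
have Wx : 0 < W x by rewrite lt_neqAle eq_sym Wxn0 W_ge0.
have [K K0 HK] := W_diss Dx.
(* With Young weight w h / 2 the remainder has factor at most 3 / (w h) and carries h^2, so N r <
   [e1] makes it cost at most 3/8 w h W(x). *)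
pose e1 := w ^+ 2 * W x / (8 * CW).
have e10 : 0 < e1 by rewrite divr_gt0 ?mulr_gt0 ?exprn_gt0.
have [d d0 Hd] := T_gen Dx e10.
(* For h < [e2], h K <= w W(x) / 8. The total factor becomes 1 - w h - 15/16 (w h)^2. *)
pose e2 := w * W x / (8 * (K + 1)).
have e20 : 0 < e2 by rewrite divr_gt0 ?mulr_gt0// ltr_wpDl.
exists (Num.min d (Num.min (w^-1) e2)).
  by rewrite !lt_min d0 invr_gt0 w_gt0.
move=> h; rewrite !lt_min => /andP[h0 /and3P[hd hw he]].
apply: (le_trans (step h h0)).
have := Hd h; rewrite h0 hd => /(_ isT).
set r := axpy (-1) _ _ => Nr.
have Hr : H r by apply: H_lin => //; apply: H_s; apply: H_lin => //; apply: T_H => //; exact: ltW.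
have -> : T h x = axpy 1 (axpy h x (A x)) (scal h r).
  by apply/funext => i; rewrite /r /axpy /scal; field; rewrite gt_eqF.
have k0 : 0 < w * h / 2 by rewrite divr_gt0// mulr_gt0.
apply: (le_trans (W_add k0 (H_lin h Hx HA) (H_s h Hr))).
have B1 := HK h (ltW h0).
have /andP[_ B2] := W_N (H_s h Hr); rewrite N_scale// in B2.
have hw1 : w * h < 1 by rewrite mulrC -ltr_pdivlMr// mul1r.
have B3 : h * K <= w * W x / 8.
  have -> : w * W x / 8 = e2 * (K + 1).
    by rewrite /e2; field; rewrite gt_eqF// ltr_wpDl.
  by apply: ler_pM => //; [exact: ltW|exact: ltW|rewrite lerDl].
have B4 : (1 + (w * h / 2)^-1) * W (scal h r) <= 3 / w * h * (CW * N r).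
  have -> : 3 / w * h * (CW * N r) = 3 / (w * h) * (CW * (h ^+ 2 * N r)).
    by field; rewrite !gt_eqF.
  apply: ler_pM => //.
  - by rewrite addr_ge0// invr_ge0 ltW.
  - by apply: W_ge0; exact: H_s.
  have -> : 3 / (w * h) = (w * h)^-1 + (w * h / 2)^-1 by field; rewrite !gt_eqF.
  by rewrite lerD2r// -[leLHS]invr1 lef_pV2 ?posrE ?ltW// mulr_gt0.
have B5 : 3 / w * h * (CW * N r) <= 3 / 8 * (w * h) * W x.
  have : CW * N r <= w ^+ 2 * W x / 8.
    have -> : w ^+ 2 * W x / 8 = CW * e1 by rewrite /e1; field; rewrite gt_eqF.
    by rewrite ler_pM2l// ltW.
  have wh : 0 < 3 / w * h by rewrite mulr_gt0// divr_gt0.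
  have -> : 3 / 8 * (w * h) * W x = 3 / w * h * (w ^+ 2 * W x / 8).
    by field; rewrite gt_eqF.
  by move=> /(ler_wpM2l (ltW wh)).
have B6 : (1 + w * h / 2) * W (axpy h x (A x)) <= (1 + w * h / 2) * ((1 - 2 * w * h) * W x + h * (w * W x / 8)).
  rewrite ler_wpM2l//; first by rewrite addr_ge0// ltW.
  apply: (le_trans B1); rewrite lerD2l expr2 -mulrA ler_wpM2l//; exact: ltW.
apply: (le_trans (lerD B6 (le_trans B4 B5))).
rewrite -subr_ge0.
have -> : (1 - w * h) * W x - ((1 + w * h / 2) * ((1 - 2 * w * h) * W x + h * (w * W x / 8)) +
   3 / 8 * (w * h) * W x) = (w * h) * W x * (15 / 16 * (w * h)) by field.
by rewrite !mulr_ge0// ?divr_ge0 ?mulr_ge0 ?W_ge0// ltW.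
Qed.

(** The linear weight fits the local step, since (1 + w (t + h)) (1 - w h) <= 1 + w t, and its
    growth is enough for convergence to 0. *)
Lemma W_decay t z : 0 <= t -> D z -> (1 + w * t) * W (T t z) <= W (T 0 z).
Proof.
move=> t0 Dz; have Hz := D_H Dz.
pose g t := (1 + w * t) * W (T t z).
have Wt s : 0 <= s -> 0 <= W (T s z) by move=> s0; apply: W_ge0; exact: T_H.
have -> : W (T 0 z) = g 0 by rewrite /g mulr0 addr0 mul1r.
have : g t <= g 0; last by [].
apply: (local_decrease_global _ _ _ t0).
- move=> {t0}t t0; have [d d0 Hd] := W_step t0 Dz; exists d => // h hd.
  have h0 : 0 < h by case/andP: hd.
  have wth : 0 <= 1 + w * (t + h) by rewrite addr_ge0// mulr_ge0// ?addr_ge0// ltW.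
  rewrite /g; apply: (le_trans (ler_wpM2l wth (Hd h hd))).
  rewrite mulrA; apply: ler_wpM2r; first exact: Wt.
  rewrite -subr_ge0.
  have -> : 1 + w * t - (1 + w * (t + h)) * (1 - w * h) = (w * h) * (w * (t + h)) by ring.
  by rewrite mulr_ge0// mulr_ge0 ?addr_ge0// ltW.
- move=> tau e tau0 e0.
  (* Chosen so that (1 + w s + e1) (1 + e1) <= (1 + e) (1 + w s) for all s >= 0. *)
  pose e1 := Num.min (e / 4) 1.
  have e10 : 0 < e1 by rewrite lt_min divr_gt0/=.
  have e1a : e1 <= e / 4 by rewrite ge_min lexx.
  have e1b : e1 <= 1 by rewrite ge_min lexx orbT.
  pose K := (1 + w * tau) * (1 + e1^-1) * CW.
  have wt0 : 0 < 1 + w * tau by rewrite addr_gt0// mulr_gt0.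
  have K0 : 0 < K by rewrite !mulr_gt0// addr_gt0// invr_gt0.
  have eK : 0 < e / K by rewrite divr_gt0.
  have [d [d0 dtau Hd]] := orbit_left_continuous tau0 eK Hz.
  have ew : 0 < e1 / w by rewrite divr_gt0.
  exists (Num.min d (e1 / w)); first by rewrite lt_min d0.
  move=> s s0 /andP[s1 s2].
  have sd : tau - d < s by apply: le_lt_trans s1; rewrite lerB// ge_min lexx.
  have sw : tau - e1 / w < s by apply: le_lt_trans s1; rewrite lerB// ge_min lexx orbT.
  have Nd : N (axpy (-1) (T tau z) (T s z)) < e / K by apply: Hd; rewrite sd.
  have Hs := T_H s0 Hz; have Ht := T_H (ltW tau0) Hz.
  have HB := H_lin (-1) Ht Hs.
  rewrite /g.
  have -> : T tau z = axpy 1 (T s z) (axpy (-1) (T tau z) (T s z)).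
    by apply/funext => i; rewrite /axpy; ring.
  have B1 := W_add e10 Hs HB.
  have /andP[_ B2] := W_N HB.
  have B3 := ler_wpM2l (ltW wt0) B1.
  have B4 : (1 + w * tau) * ((1 + e1^-1) * W (axpy (-1) (T tau z) (T s z))) <= e.
    have -> : e = (1 + w * tau) * ((1 + e1^-1) * (CW * (e / K))).
      by rewrite /K; field; rewrite !gt_eqF// addr_gt0// ?mulr_gt0.
    rewrite ler_pM2l// ler_pM2l; last by rewrite addr_gt0// invr_gt0.
    by apply: (le_trans B2); rewrite ler_pM2l// ltW.
  have B5 : (1 + w * tau) * ((1 + e1) * W (T s z)) <= (1 + e) * ((1 + w * s) * W (T s z)).
    rewrite !mulrA; apply: ler_wpM2r; first exact: Wt.
    have ws : w * tau <= w * s + e1.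
      have -> : w * s + e1 = w * (s + e1 / w) by field; rewrite gt_eqF.
      by rewrite ler_pM2l//; move: sw; lra.
    have ws0 : 0 <= w * s by rewrite mulr_ge0// ltW.
    move: (w * tau) (w * s) ws ws0 => y x yx x0.
    apply: (@le_trans _ _ ((1 + x + e1) * (1 + e1))).
      apply: ler_wpM2r; first by rewrite addr_ge0// ltW.
      by move: yx; lra.
    have : e1 * e1 <= e1 by rewrite -[leRHS]mulr1 ler_wpM2l// ltW.
    have : e1 * x <= e / 4 * x by rewrite ler_wpM2r.
    have : 0 <= e * x by rewrite mulr_ge0// ltW.
    by move: e1a; lra.
  by move: B3 B4 B5; rewrite mulrDr; lra.
- by rewrite /g mulr0 addr0 mul1r; exact: Wt.
Qed.

(** The operator bound [M] at time t multiplies only the approximation error, so density yields a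
    constant independent of t. The 8 is 2 * 2 * 2: T(0) z against z, and two splittings through the
    approximant. *)
Lemma N_decay t z : 0 <= t -> H z -> (1 + w * t) * N (T t z) <= 8 * (CW / cW) * N z.
Proof.
move=> t0 Hz; have wt0 : 0 < 1 + w * t by rewrite ltr_wpDr// mulr_ge0// ltW.
have onD z' : D z' -> (1 + w * t) * N (T t z') <= 2 * (CW / cW) * N z'.
  move=> Dz'; have Hz' := D_H Dz'.
  have /andP[B1 _] := W_N (T_H t0 Hz'); have B2 := W_decay t0 Dz'.
  have /andP[_ B3] := W_N (T_H (lexx 0) Hz').
  have B4 := N_sub_nul (T_H (lexx 0) Hz') Hz' (T_0 Hz').
  rewrite -(ler_pM2l cW_gt0).
  have -> : cW * (2 * (CW / cW) * N z') = CW * (2 * N z') by field; rewrite gt_eqF.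
  apply: le_trans (ler_wpM2l (ltW CW_gt0) B4).
  apply: le_trans B3; apply: le_trans B2.
  by rewrite mulrCA ler_pM2l.
have [M HM] := T_bd t0.
apply/ler_addgt0Pr => e e0.
pose C := 8 * (CW / cW) + 4 * (1 + w * t) * `|M| + 1.
have k0 : 0 < CW / cW by rewrite divr_gt0.
have C0 : 0 < C.
  rewrite ltr_wpDl// addr_ge0//; first by rewrite mulr_ge0// ltW.
  by apply: mulr_ge0 => //; apply: mulr_ge0 => //; exact: ltW.
have eC : 0 < e / C by rewrite divr_gt0.
have [z' Dz' zz'] := D_dense Hz eC.
have Hz' := D_H Dz'.
pose y := axpy 1 (scal 1 z) (scal (-1) z').
have yE : y = axpy (-1) z z' by apply/funext => i; rewrite /y /axpy /scal; ring.
have Hy : H y by rewrite yE; exact: H_lin.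
have B1 : N (T t z) <= 2 * N (T t z') + 4 * N (T t y).
  have : N (axpy (-1) (T t z) (T t z')) <= 2 * N (T t y).
    have -> : axpy (-1) (T t z) (T t z') = axpy 1 (T t y)
        (scal (-1) (axpy (-1) (T t y) (axpy 1 (scal 1 (T t z)) (scal (-1) (T t z'))))).
      by apply/funext => i; rewrite /axpy /scal; ring.
    by apply: N_addnul; [exact: T_H|apply: nul_s; exact: nul_T].
  by have := N_le_sub (T_H t0 Hz) (T_H t0 Hz'); lra.
have B2 : N (T t y) <= `|M| * (e / C).
  apply: (le_trans (HM y Hy)); apply: (@le_trans _ _ (`|M| * N y)).
    by rewrite ler_wpM2r ?N_ge0// ler_norm.
  by rewrite ler_wpM2l// yE ltW.
have B3 : N z' <= 2 * N z + 2 * (e / C).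
  have := N_le_sub Hz' Hz.
  have -> : N (axpy (-1) z' z) = N (axpy (-1) z z').
    have -> : axpy (-1) z' z = scal (-1) (axpy (-1) z z').
      by apply/funext => i; rewrite /axpy /scal; ring.
    by rewrite N_scale ?sqrrN ?expr1n ?mul1r//; exact: H_lin.
  by move: zz'; lra.
have B4 := onD z' Dz'.
have E : e = C * (e / C) by rewrite mulrC divfK// gt_eqF.
have B5 := ler_wpM2l (ltW wt0) B1.
have B6 := ler_wpM2l (ltW wt0) B2.
have B7 := ler_wpM2l (ltW k0) B3.
rewrite E; move: (e / C) eC B6 B7 => ec eC B6 B7.
have Nz := N_ge0 Hz; have kNz : 0 <= CW / cW * N z by rewrite mulr_ge0// ltW.
have kec : 0 <= CW / cW * ec by rewrite mulr_ge0// ltW.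
rewrite /C; move: (CW / cW) (1 + w * t) `|M| B4 B5 B6 B7 kNz kec => k v m B4 B5 B6 B7 kNz kec.
lra.
Qed.

Theorem semigroup_vanishes z (e : R) : H z -> 0 < e ->
  exists2 t0 : R, 0 <= t0 & forall t, t0 <= t -> N (T t z) < e.
Proof.
move=> Hz e0; pose K := 8 * (CW / cW) * N z.
have K0 : 0 <= K.
  by apply: mulr_ge0; [apply: mulr_ge0 => //; apply: divr_ge0; exact: ltW|exact: N_ge0].
exists (K / (w * e)); first by apply: divr_ge0 => //; apply: mulr_ge0; exact: ltW.
move=> t Kt; have t0 : 0 <= t.
  by apply: le_trans Kt; apply: divr_ge0 => //; apply: mulr_ge0; exact: ltW.
have := N_decay t0 Hz; rewrite -/K => B.
have wt0 : 0 < 1 + w * t by rewrite ltr_wpDr// mulr_ge0// ltW.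
rewrite -(ltr_pM2l wt0); apply: (le_lt_trans B).
move: Kt; rewrite ler_pdivrMr ?mulr_gt0// => Kt.
apply: (le_lt_trans Kt).
have -> : t * (w * e) = (w * t) * e by ring.
by rewrite ltr_pM2r// ltrDr.
Qed.

End semigroup_decay.

(** * Complex states *)

Section limits.
Context {R : realType}.
Implicit Types u : R -> R.

Lemma cvg0_rightP u : u h @[h --> 0^'+] --> 0 <->
  forall e : R, 0 < e -> exists2 d : R, 0 < d & forall h, 0 < h < d -> `|u h| < e.
Proof.
split=> [/cvgrPdist_lt H e /H[d /= d0 Hd]|H].
  exists d => // h /andP[h0 hd]; have := Hd h.
  by rewrite /= !sub0r !normrN gtr0_norm//; apply.
apply/cvgrPdist_lt => e /H[d d0 Hd].
exists d => //= h hd h0; rewrite sub0r normrN; apply: Hd; rewrite h0/=.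
by move: hd; rewrite /ball_/= sub0r normrN gtr0_norm.
Qed.

Lemma cvg0_pinfty u : (forall e : R, 0 < e -> exists2 t0 : R, 0 <= t0 & forall t, t0 <= t -> `|u t| < e) ->
  u t @[t --> +oo] --> 0.
Proof.
move=> H; apply/cvgrPdist_lt => e /H[t0 _ Ht].
near=> t; rewrite sub0r normrN; apply: Ht.
near: t; exists t0; split; [exact: num_real|by move=> ? /ltW].
Unshelve. all: by end_near. Qed.

End limits.

(* A complex state is encoded by its four real component functions; the indices
   are (real part?, w-component?, x). *)
Section encoding.
Context {R : realType} (L : R).
Hypothesis L_gt0 : 0 < L.

Local Notation X := (bool * bool * R)%type.
Implicit Types (z : St R) (f : X -> R).

Definition enc z : X -> R := fun i =>
  (if i.1.1 then @complex.Re R else @complex.Im R) ((if i.1.2 then sw z else sv z) i.2).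

(** In H the last two components are traces of v, so they need no code of their own. *)
Definition dec f : St R :=
  let g k x := Complex (f (true, k, x)) (f (false, k, x)) in
  MkSt (g true) (g false) (g false L) (g false 0).

Definition part (c k : bool) f : R -> R := fun x => f (c, k, x).

Lemma decK f : enc (dec f) = f.
Proof. by apply/funext => -[[[] []] x]. Qed.

Lemma encK z : inH L z -> dec (enc z) = z.
Proof.
case: z => w v xi psi [_ [_ [/= -> ->]]]; rewrite /dec /enc /=.
have e (g : R -> complex R) : (fun x => Complex (complex.Re (g x)) (complex.Im (g x))) = g.
  by apply/funext => x; case: (g x).
by congr MkSt; rewrite ?e//; [case: (v L)|case: (v 0)].
Qed.

Definition encH f := forall c, rspace L (part c true f) (part c false f).

Definition encN f := rnorm2 L (part true true f) (part true false f) +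
                   rnorm2 L (part false true f) (part false false f).

Lemma inHP z : inH L z <-> [/\ encH (enc z), sxi z = sv z L & spsi z = sv z 0].
Proof.
split=> [[[h1 h2] [[h3 h4] [h5 h6]]]|[h h5 h6]].
  by split => // -[]; split.
by split; [split; [exact: (h true).1|exact: (h false).1]|split;
  [split; [exact: (h true).2|exact: (h false).2]|split]].
Qed.

Lemma inH_dec f : inH L (dec f) <-> encH f.
Proof.
by rewrite inHP decK; split=> [[]|h].
Qed.

Lemma encN_ge0 f : encH f -> 0 <= encN f.
Proof. by move=> h; rewrite addr_ge0// rnorm2_ge0//; exact: h. Qed.

Lemma normH_enc z : inH L z -> normH L z = Num.sqrt (encN (enc z)).
Proof.
move=> [_ [_ [xiE psiE]]]; rewrite /normH xiE psiE; congr Num.sqrt.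
rewrite /encN /rnorm2 /cHnorm2 /cabs2 /part /enc /=.
by rewrite /reF /imF; ring.
Qed.

Lemma normH_eq0 z : inH L z -> normH L z = 0 -> encN (enc z) = 0.
Proof.
move=> Hz; rewrite normH_enc// => /eqP; rewrite sqrtr_eq0 => h.
by apply/eqP; rewrite eq_le h encN_ge0//; case/inHP: Hz.
Qed.

Lemma normH_lt z (e : R) : inH L z -> 0 < e -> (normH L z < e) = (encN (enc z) < e ^+ 2).
Proof.
move=> Hz e0; rewrite normH_enc// -[in LHS](gtr0_norm e0) -sqrtr_sqr.
by rewrite ltr_sqrt// exprn_gt0.
Qed.

Lemma enc_add z1 z2 : enc (addSt z1 z2) = axpy 1 (enc z1) (enc z2).
Proof.
apply/funext => -[[[] []] x]; rewrite /enc /axpy /=.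
- by case: (sw z1 x) (sw z2 x) => ? ? [? ?] /=; ring.
- by case: (sv z1 x) (sv z2 x) => ? ? [? ?] /=; ring.
- by case: (sw z1 x) (sw z2 x) => ? ? [? ?] /=; ring.
- by case: (sv z1 x) (sv z2 x) => ? ? [? ?] /=; ring.
Qed.

(** Real scalars act componentwise on the encoding, so the semigroup is treated as a real-linear
    one. *)
Lemma enc_scl (r : R) z : enc (sclSt (r%:C)%C z) = scal r (enc z).
Proof.
apply/funext => -[[[] []] x]; rewrite /enc /scal /=.
- by case: (sw z x) => ? ? /=; ring.
- by case: (sv z x) => ? ? /=; ring.
- by case: (sw z x) => ? ? /=; ring.
- by case: (sv z x) => ? ? /=; ring.
Qed.

Lemma enc_sub z1 z2 : enc (subSt z1 z2) = axpy (-1) (enc z1) (enc z2).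
Proof.
have e : -1 = ((-1)%:C)%C :> complex R by rewrite rmorphN1.
rewrite /subSt e enc_add enc_scl.
by apply/funext => i; rewrite /axpy /scal; ring.
Qed.

Lemma encH_lin c f g : encH f -> encH g -> encH (axpy c f g).
Proof. by move=> hf hg k; exact: (rspace_lin L_gt0 c (hf k) (hg k)). Qed.

Lemma encH_scale c f : encH f -> encH (scal c f).
Proof.
move=> hf; have -> : scal c f = axpy (c - 1) f f by apply/funext => i; rewrite /scal /axpy; ring.
exact: encH_lin.
Qed.

Lemma inH_encH z : inH L z -> encH (enc z). Proof. by case/inHP. Qed.

Lemma inH_add z1 z2 : inH L z1 -> inH L z2 -> inH L (addSt z1 z2).
Proof.
move=> h1 h2; apply/inHP; rewrite enc_add.
case/inHP: (h1) => H1 e1 e1'; case/inHP: (h2) => H2 e2 e2'.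
by split; [exact: encH_lin|rewrite /= e1 e2|rewrite /= e1' e2'].
Qed.

Lemma inH_scl (r : R) z : inH L z -> inH L (sclSt (r%:C)%C z).
Proof.
move=> h1; apply/inHP; rewrite enc_scl.
by case/inHP: (h1) => H1 e1 e1'; split; [exact: encH_scale|rewrite /= e1|rewrite /= e1'].
Qed.

Lemma inH_sub z1 z2 : inH L z1 -> inH L z2 -> inH L (subSt z1 z2).
Proof.
have e : -1 = ((-1)%:C)%C :> complex R by rewrite rmorphN1.
by move=> h1 h2; rewrite /subSt e; apply: inH_add => //; exact: inH_scl.
Qed.

Lemma cvg_normHP (F : R -> St R) : (forall h, 0 < h -> inH L (F h)) ->
  normH L (F h) @[h --> 0^'+] --> 0 <->
  forall e : R, 0 < e -> exists2 d : R, 0 < d & forall h, 0 < h < d -> encN (enc (F h)) < e.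
Proof.
move=> HF; rewrite cvg0_rightP; split=> H e e0.
  have s0 : 0 < Num.sqrt e by rewrite sqrtr_gt0.
  have [d d0 Hd] := H _ s0; exists d => // h hd.
  have h0 : 0 < h by case/andP: hd.
  have := Hd h hd; rewrite ger0_norm ?sqrtr_ge0// normH_lt//; last exact: HF.
  by rewrite sqr_sqrtr// ltW.
have s0 : 0 < e ^+ 2 by rewrite exprn_gt0.
have [d d0 Hd] := H _ s0; exists d => // h hd.
have h0 : 0 < h by case/andP: hd.
by rewrite ger0_norm ?sqrtr_ge0// normH_lt//; [exact: Hd|exact: HF].
Qed.

Variables (P : R -> R) (th1 th2 th3 th4 : R).

Definition encD f := forall c, rdomain L P th1 th2 th3 th4 (part c true f) (part c false f).

Definition encA f := enc (Aop L P th1 th2 th3 th4 (dec f)).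

Lemma reF_Pw' w : reF (Pw' L P w) = flux L P (reF w).
Proof. by apply/funext => x; rewrite /reF /Pw' /flux /=; ring. Qed.

Lemma imF_Pw' w : imF (Pw' L P w) = flux L P (imF w).
Proof. by apply/funext => x; rewrite /imF /Pw' /flux /=; ring. Qed.

Lemma encA_w c f : part c true (encA f) = part c false f.
Proof. by case: c. Qed.

Lemma encA_v c f : part c false (encA f) = der L (flux L P (part c true f)).
Proof.
case: c; apply/funext => x; rewrite /part /encA /enc /=.
  by rewrite /cder /= reF_Pw'.
by rewrite /cder /= imF_Pw'.
Qed.

Lemma DA_dec f : DA L P th1 th2 th3 th4 (dec f) <-> encD f.
Proof.
have eR w : complex.Re (cder L (Pw' L P w) L) = der L (flux L P (reF w)) L by rewrite /= reF_Pw'.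
rewrite /DA /cHs; split.
  move=> [[h1 h2] [[h3 h4] [_ [_ [h5 h6]]]]] -[]; split => //.
  - by move/(congr1 (@complex.Re R)): h5 => /=; rewrite reF_Pw'.
  - move/(congr1 (@complex.Re R)): h6; rewrite /Ffun /= reF_Pw' => ->.
    by rewrite /part /reF /=; ring.
  - by move/(congr1 (@complex.Im R)): h5 => /=; rewrite imF_Pw'.
  - move/(congr1 (@complex.Im R)): h6; rewrite /Ffun /= imF_Pw' => ->.
    by rewrite /part /imF /=; ring.
move=> h; have [h1 h2 h3 h4] := h true; have [h1' h2' h3' h4'] := h false.
do 4 (split => //); split.
  rewrite /cder reF_Pw' imF_Pw'; apply/eqP; rewrite eq_complex /=.
  by apply/andP; split; apply/eqP; [exact: h3|exact: h3'].
rewrite /cder reF_Pw' imF_Pw'; apply/eqP; rewrite /Ffun eq_complex /=.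
apply/andP; split; apply/eqP.
  by have := h4; rewrite /part => e; rewrite [LHS]e /cder /reF /=; ring.
by have := h4'; rewrite /part => e; rewrite [LHS]e /cder /imF /=; ring.
Qed.

End encoding.

Theorem theorem3p3 (R : realType) (L : R) (P : R -> R) (P0 : R)
    (th1 th2 th3 th4 : R) (a b : R) (T : R -> St R -> St R) :
  0 < L ->
  Hs L 2 P -> 0 < P0 -> (forall x, 0 <= x <= L -> P0 <= P x) ->
  0 < a -> 0 < b -> (a + b - 1) ^+ 2 < 4 * a * b ->
  th1 = th3 / b - a -> th2 = th4 / b ->
  th1 < 0 -> th3 < 0 -> 0 < th2 -> 0 < th4 ->
  IsC0Generated (inH L) (normH L) (DA L P th1 th2 th3 th4)
    (Aop L P th1 th2 th3 th4) T ->
  forall z0, inH L z0 -> normH L (T t z0) @[t --> +oo] --> 0.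
Proof.
move=> L0 [_ [P1 [pP [_ [P2 [pP1 LP2]]]]]] P0_gt0 P0P a0 b0 _ th1E th2E _ th30 _ th40.
move=> [TH [T0 [TD [Tlin [Tbd [Tcont Tgen]]]]]] z0 Hz0.
have [W [cW [CW [om [[cW0 CW0 om0] W_n2 W_add W_diss]]]]] :=
  real_lyapunov L0 pP pP1 LP2 P0_gt0 P0P a0 b0 th30 th40 th1E th2E.
pose H := encH L; pose D := encD L P th1 th2 th3 th4; pose A := encA L P th1 th2 th3 th4.
pose N := encN L.
pose WE f := W (part true true f) (part true false f) + W (part false true f) (part false false f).
pose S t f := enc (T t (dec L f)).
have inD f : H f -> inH L (dec L f) by move/(inH_dec L f).
have decS t f : 0 <= t -> H f -> dec L (S t f) = T t (dec L f).
  by move=> t0 Hf; apply: encK; apply: TH => //; exact: inD.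
have DH f : D f -> H f by move=> Df c; exact: (rdomain_rspace L0 pP pP1 LP2 b0 th40 th1E th2E (Df c)).
have AH f : D f -> H (A f).
  move=> Df c; rewrite encA_w encA_v.
  exact: (rdomain_image L0 pP pP1 LP2 b0 th40 th1E th2E (Df c)).
have S_H t f : 0 <= t -> H f -> H (S t f).
  by move=> t0 Hf; apply: inH_encH; apply: TH => //; exact: inD.
have S0 f : H f -> N (axpy (-1) (S 0 f) f) = 0.
  move=> Hf; have If := inD f Hf.
  rewrite /S -[X in axpy _ _ X](decK L f) -enc_sub.
  by apply: (normH_eq0 L0); [apply: inH_sub => //; exact: TH|exact: T0].
have SD t s f : 0 <= t -> 0 <= s -> H f -> N (axpy (-1) (S (t + s) f) (S t (S s f))) = 0.
  move=> t0 s0 Hf; have If := inD f Hf; rewrite /S -/(S s f) decS// -enc_sub.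
  apply: normH_eq0 => //; last exact: TD.
  by apply: inH_sub => //; apply: (TH) => //; [exact: addr_ge0|exact: TH].
have Slin t c1 c2 f1 f2 : 0 <= t -> H f1 -> H f2 ->
    N (axpy (-1) (S t (axpy 1 (scal c1 f1) (scal c2 f2))) (axpy 1 (scal c1 (S t f1)) (scal c2 (S t f2)))) = 0.
  move=> t0 H1 H2; have I1 := inD f1 H1; have I2 := inD f2 H2.
  have I3 := inH_add L0 (inH_scl L0 c1 I1) (inH_scl L0 c2 I2).
  have -> : S t (axpy 1 (scal c1 f1) (scal c2 f2)) =
     enc (T t (addSt (sclSt (c1%:C)%C (dec L f1)) (sclSt (c2%:C)%C (dec L f2)))).
    by rewrite /S -(encK I3) enc_add !enc_scl !decK.
  have -> : axpy 1 (scal c1 (S t f1)) (scal c2 (S t f2)) =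
     enc (addSt (sclSt (c1%:C)%C (T t (dec L f1))) (sclSt (c2%:C)%C (T t (dec L f2)))).
    by rewrite enc_add !enc_scl.
  rewrite -enc_sub; apply: normH_eq0 => //; last exact: Tlin.
  apply: inH_sub => //; first exact: TH.
  by apply: inH_add => //; apply: inH_scl => //; exact: TH.
have Sbd t : 0 <= t -> exists M : R, forall f, H f -> N (S t f) <= M * N f.
  (* [N] is the square of the norm, so the bound is squared. *)
  move=> t0; have [M HM] := Tbd t t0; exists (M ^+ 2) => f Hf.
  have If := inD f Hf; have := HM _ If.
  rewrite !normH_enc//; last exact: TH.
  rewrite decK -/(S t f) -/(N f) -/(N (S t f)) => h.
  have Nf : 0 <= N f by exact: encN_ge0.
  have NS : 0 <= N (S t f) by apply: encN_ge0 => //; exact: S_H.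
  rewrite -(sqr_sqrtr NS) -(sqr_sqrtr Nf) -exprMn ler_pXn2r// nnegrE ?sqrtr_ge0//.
  by rewrite (le_trans _ h)// sqrtr_ge0.
have Scont f (e : R) : H f -> 0 < e -> exists2 d : R, 0 < d &
    forall h, 0 < h < d -> N (axpy (-1) (S h f) f) < e.
  move=> Hf e0; have If := inD f Hf.
  have hI h : 0 < h -> inH L (subSt (T h (dec L f)) (dec L f)).
    by move=> h0; apply: inH_sub => //; apply: TH => //; exact: ltW.
  have [d d0 Hd] := (cvg_normHP hI).1 (Tcont _ If) e e0.
  by exists d => // k /Hd; rewrite enc_sub decK.
have quot f y h : 0 < h -> H f -> inH L y ->
    inH L (subSt (sclSt (h^-1%:C)%C (subSt (T h (dec L f)) (dec L f))) y) /\
    enc (subSt (sclSt (h^-1%:C)%C (subSt (T h (dec L f)) (dec L f))) y) =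
    axpy (-1) (scal h^-1 (axpy (-1) (S h f) f)) (enc y).
  move=> h0 Hf Iy; have If := inD f Hf; split; last by rewrite enc_sub enc_scl enc_sub decK.
  by apply: inH_sub => //; apply: inH_scl => //; apply: inH_sub => //; apply: TH => //; exact: ltW.
have Sgen f (e : R) : D f -> 0 < e -> exists2 d : R, 0 < d &
    forall h, 0 < h < d -> N (axpy (-1) (scal h^-1 (axpy (-1) (S h f) f)) (A f)) < e.
  move=> Df e0; have Hf := DH f Df; have If := inD f Hf.
  have [_ /(_ ((DA_dec L P th1 th2 th3 th4 f).2 Df))] := Tgen _ If.
  set y := Aop _ _ _ _ _ _ _.
  have DAf := (DA_dec L P th1 th2 th3 th4 f).2 Df.
  (* The two boundary conditions of the domain say that the last components of the image are the
     traces of (P w')'. *)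
  have Iy : inH L y.
    apply/inHP; split; first exact: AH.
      by rewrite /y /=; case: DAf => _ [_ [_ [_ [-> _]]]].
    by rewrite /y /=; case: DAf => _ [_ [_ [_ [_ ->]]]].
  move=> /(cvg_normHP (fun h h0 => (quot f y h h0 Hf Iy).1)) /(_ e e0)[d d0 Hd].
  exists d => // h hd; have h0 : 0 < h by case/andP: hd.
  by rewrite -(quot f y h h0 Hf Iy).2; exact: Hd.
have Sdom f y : H f -> H y -> (forall e : R, 0 < e -> exists2 d : R, 0 < d &
    forall h, 0 < h < d -> N (axpy (-1) (scal h^-1 (axpy (-1) (S h f) f)) y) < e) -> D f.
  move=> Hf Hy lim; have If := inD f Hf; have Iy := inD y Hy.
  have [[_ dom] _] := Tgen _ If.
  apply/(DA_dec L P th1 th2 th3 th4 f); apply: dom; exists (dec L y); split => //.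
  apply/(cvg_normHP (fun h h0 => (quot f _ h h0 Hf Iy).1)) => e /lim[d d0 Hd].
  exists d => // h hd; have h0 : 0 < h by case/andP: hd.
  by rewrite (quot f _ h h0 Hf Iy).2 decK; exact: Hd.
have Ddense f (e : R) : H f -> 0 < e -> exists2 g, D g & N (axpy (-1) f g) < e.
  move=> Hf e0; have e2 : 0 < e / 2 by rewrite divr_gt0.
  have [w1 [v1 [D1 n1]]] := rdomain_dense L0 th1 th3 pP pP1 LP2 P0_gt0 P0P b0 th40 th2E (Hf true) e2.
  have [w2 [v2 [D2 rnorm2]]] := rdomain_dense L0 th1 th3 pP pP1 LP2 P0_gt0 P0P b0 th40 th2E (Hf false) e2.
  exists (fun i => (if i.1.1 then (if i.1.2 then w1 else v1) else (if i.1.2 then w2 else v2)) i.2).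
    by case.
  by move: (ltrD n1 rnorm2); rewrite -splitr.
have Hlin c f g : H f -> H g -> H (axpy c f g) by exact: encH_lin.
have Nadd f g : H f -> H g -> N (axpy 1 f g) <= 2 * N f + 2 * N g.
  move=> Hf Hg; apply: le_trans (lerD (rnorm2_add L0 (Hf true) (Hg true)) (rnorm2_add L0 (Hf false) (Hg false))) _.
  by rewrite addrACA -!mulrDr; exact: lexx.
have Nscale c f : H f -> N (scal c f) = c ^+ 2 * N f.
  move=> Hf; rewrite /N /encN mulrDr.
  by rewrite -(rnorm2_scale L0 c (Hf true)) -(rnorm2_scale L0 c (Hf false)).
have WN f : H f -> cW * N f <= WE f <= CW * N f.
  move=> Hf; have /andP[u1 u2] := W_n2 _ _ (Hf true); have /andP[u3 u4] := W_n2 _ _ (Hf false).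
  by rewrite /N /encN /WE (mulrDr cW) (mulrDr CW); apply/andP; split;
    [exact: (lerD u1 u3)|exact: (lerD u2 u4)].
have Wadd (e : R) f g : 0 < e -> H f -> H g ->
    WE (axpy 1 f g) <= (1 + e) * WE f + (1 + e^-1) * WE g.
  move=> e0 Hf Hg.
  apply: le_trans (lerD (W_add e _ _ _ _ e0 (Hf true) (Hg true))
                        (W_add e _ _ _ _ e0 (Hf false) (Hg false))) _.
  by rewrite addrACA -!mulrDr; exact: lexx.
have Wdiss f : D f -> exists2 K : R, 0 <= K & forall h, 0 <= h ->
    WE (axpy h f (A f)) <= (1 - 2 * om * h) * WE f + h ^+ 2 * K.
  move=> Df; have [K1 K10 HK1] := W_diss _ _ (Df true); have [K2 K20 HK2] := W_diss _ _ (Df false).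
  exists (K1 + K2); first exact: addr_ge0.
  move=> h h0.
  have ew c : part c true (axpy h f (A f)) = (fun x => part c true f x + h * part c false f x).
    by rewrite -(encA_w L P th1 th2 th3 th4 c f).
  have ev c : part c false (axpy h f (A f)) =
      (fun x => part c false f x + h * der L (flux L P (part c true f)) x).
    by rewrite -(encA_v L P th1 th2 th3 th4 c f).
  rewrite /WE !ew !ev; apply: le_trans (lerD (HK1 h h0) (HK2 h h0)) _.
  by rewrite addrACA -!mulrDr; exact: lexx.
have N0 f : H f -> 0 <= N f by exact: encN_ge0.
apply: cvg0_pinfty => e e0; have e2 : 0 < e ^+ 2 by rewrite exprn_gt0.
have Hz : H (enc z0) by exact: inH_encH.
have [t0 t00 Ht] := semigroup_vanishes Hlin N0 Nadd Nscale S_H S0 SD Slin Sbd Scont DH AH Sgen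
  Sdom Ddense cW0 CW0 om0 WN Wadd Wdiss Hz e2.
exists t0 => // t t0t; rewrite ger0_norm ?sqrtr_ge0// normH_lt//.
  by have := Ht t t0t; rewrite /S encK.
by apply: TH => //; exact: le_trans t00 t0t.
Qed.
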